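(* Let $M,N$ be smooth manifolds and $\Phi\in C^\infty(M,N)$. There is a one-to-one correspondence between classes in the relative Deligne cohomology group $H^2_D(\Phi)$ and isomorphism classes of relative gerbes with connection for $\Phi$.
   Context: Relative Deligne cohomology. Let $d\log f=\frac{1}{2\pi\sqrt{-1}}f^{-1}df$. For a complex of sheaves $\underline A^\bullet$ and an open cover $\mathcal U$, let $T^\bullet_{(\mathcal U,A)}$ be the total complex of the Čech double complex $\check C^p(\mathcal U,\underline A^q)$. On $M$ take $\underline A^\bullet:\ \underline{U(1)}\xrightarrow{d\log}\underline\Omega^1$ (degrees 0,1), on $N$ take $\underline B^\bullet:\ \underline{U(1)}\xrightarrow{d\log}\underline\Omega^1\xrightarrow{d}\underline\Omega^2$ (degrees 0,1,2), where underlined symbols denote sheaves of smooth functions/forms. For covers $\mathcal U=\{U_i\}$ of $M$, $\mathcal V=\{V_j\}$ of $N$ and a map $r$ with $\Phi(U_i)\subset V_{r(i)}$, pull-back (with zero in the $\Omega^2$-component) gives a cochain map $T^\bullet_{(\mathcal V,B)}\to T^\bullet_{(\mathcal U,A)}$. Its mapping cone is $\operatorname{Cone}^n=T^{n-1}_{(\mathcal U,A)}\oplus T^n_{(\mathcal V,B)}$, $d(\alpha,\beta)=(\Phi^*\beta-d\alpha,d\beta)$. $H^\bullet_D(\Phi)$ is the direct limit over such pairs of covers of the cohomology of these cones. Gerbes. For line bundles $L_{ii'}$ on $U_{ii'}$, $(\delta L)_{ii'i''}=L_{i'i''}\otimes L_{ii''}^{-1}\otimes L_{ii'}$; for $E_i$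 on $U_i$, $(\delta E)_{ii'}=E_{i'}\otimes E_i^{-1}$; likewise for sections, connections, forms. Curvature of a line bundle with connection is the real form $F=dA$ with $\nabla\sigma=2\pi\sqrt{-1}A\sigma$. A gerbe with connection on $N$: an open cover, Hermitian line bundles $L_{jj'}$ on $V_{jj'}$ with $L_{jj'}\cong L_{j'j}^{-1}$, unitary sections $\theta$ of $\delta L$ with $\delta\theta=1$, connections $\nabla_{jj'}$ with $(\delta\nabla)\theta=0$, and 2-forms $\varpi_j$ with $\varpi_{j'}-\varpi_j=\operatorname{curv}(\nabla_{jj'})$; up to refinement of covers. A quasi-line bundle with connection for a gerbe with connection $(\mathcal U,L,\theta,\nabla,\varpi)$: Hermitian line bundles $E_i\to U_i$ with connections $\nabla^E_i$ and unitary sections $\psi_{ii'}$ of $(\delta E^{-1})_{ii'}\otimes L_{ii'}$ with $\delta\psi=\theta$ and $\delta\nabla^E\cong\nabla$ via $\psi$; its error 2-form is $\omega|_{U_i}=\varpi_i-\operatorname{curv}(\nabla^E_i)$. Two quasi-line bundles with connection for the same gerbe differ by a line bundle with connection. A relative gerbe with connection for $\Phi$ is a pair $(\mathcal L,\mathcal G)$, $\mathcal G$ a gerbe with connection on $N$ and $\mathcal L$ a quasi-line bundle with connection for $\Phi^*\mathcal G$. Two such, $(\mathcal L_1,\mathcal G_1)$ and $(\mathcal L_2,\mathcal G_2)$, are isomorphic if there is a quasi-line bundle with connection $\mathcal L'$ for $\mathcal G_2\otimes\mathcal G_1^{-1}$ with error 2-form zero such that the line bundle with connection $(\mathcal L_2\otimes\mathcal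 L_1^{-1})\otimes\Phi^*\mathcal L'^{-1}$ on $M$ admits a parallel unitary section. *)

(* Defs.v *)
From HB Require Import structures.
From mathcomp Require Import all_boot all_order all_algebra.
From mathcomp Require Import complex.
From mathcomp Require Import all_classical all_reals all_analysis.

Set Implicit Arguments.
Unset Strict Implicit.
Unset Printing Implicit Defensive.

Import Order.TTheory GRing.Theory Num.Theory.
Import numFieldNormedType.Exports.

Local Open Scope classical_set_scope.
Local Open Scope ring_scope.

Definition classes (T : Type) (E : T -> T -> Prop) : Type :=
  {c : T -> Prop | exists x, c = E x}.

Section Manifolds.
Variable R : realType.

Fixpoint Ck (n k : nat) (S : set 'rV[R]_n) (f : 'rV[R]_n -> R) : Prop :=
  if k is k'.+1 then
    (forall x, S x -> differentiable f x) /\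
    (forall v, Ck k' S (fun x => 'D_v f x))
  else forall x, S x -> {for x, continuous f}.

Definition Cinfty (n : nat) (S : set 'rV[R]_n) (f : 'rV[R]_n -> R) : Prop :=
  forall k, Ck k S f.

Record chart (n : nat) (T : topologicalType) := Chart {
  cdom : set T;
  ccod : set 'rV[R]_n;
  cfun : T -> 'rV[R]_n;
  cinv : 'rV[R]_n -> T
}.

Definition is_chart n (T : topologicalType) (c : chart n T) : Prop :=
  [/\ open (cdom c), open (ccod c),
      forall x, cdom c x ->
        [/\ ccod c (cfun c x), cinv c (cfun c x) = x & {for x, continuous (cfun c)}]
    & forall y, ccod c y ->
        [/\ cdom c (cinv c y), cfun c (cinv c y) = y & {for y, continuous (cinv c)}]].

(* The atlas is indexed by the points: [chart_at p] is a chart around [p].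
   Every atlas contains one of this form, and it determines the same smooth
   structure.  The tangent space at [x] is 'rV[R]_n through [chart_at x]. *)
Record manifold (n : nat) := Manifold {
  mcar :> topologicalType;
  chart_at : mcar -> chart n mcar;
  manifold_hausdorff : hausdorff_space mcar;
  manifold_second_countable : @second_countable mcar;
  chart_atP : forall p, is_chart (chart_at p);
  chart_at_dom : forall p, cdom (chart_at p) p;
  chart_transition : forall (p q : mcar) (j : 'I_n),
    Cinfty [set y | ccod (chart_at p) y /\ cdom (chart_at q) (cinv (chart_at p) y)]
           (fun y => cfun (chart_at q) (cinv (chart_at p) y) 0 j)
}.

Section OneManifold.
Variables (m : nat) (M : manifold m).

Definition smooth (W : set M) (f : M -> R) : Prop :=
  forall p : M,
    Cinfty [set y | ccod (chart_at p) y /\ W (cinv (chart_at p) y)]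
           (fun y => f (cinv (chart_at p) y)).

Definition csmooth (W : set M) (f : M -> R[i]) : Prop :=
  smooth W (fun x => complex.Re (f x)) /\ smooth W (fun x => complex.Im (f x)).

Definition U1 (W : set M) (f : M -> R[i]) : Prop :=
  csmooth W f /\ forall x, W x -> `|f x| = 1.

Definition form1 : Type := M -> 'rV[R]_m -> R.
Definition form2 : Type := M -> 'rV[R]_m -> 'rV[R]_m -> R.

(* The vector with components [v] in the chart at [p], based at the point with
   coordinates [y], as an element of the tangent space at that point. *)
Definition tcoord (p : M) (y v : 'rV[R]_m) : 'rV[R]_m :=
  'D_v (fun z => cfun (chart_at (cinv (chart_at p) y)) (cinv (chart_at p) z)) y.

Definition comp1 (A : form1) (p : M) (y v : 'rV[R]_m) : R :=
  A (cinv (chart_at p) y) (tcoord p y v).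

Definition comp2 (B : form2) (p : M) (y u v : 'rV[R]_m) : R :=
  B (cinv (chart_at p) y) (tcoord p y u) (tcoord p y v).

Definition smooth_form1 (W : set M) (A : form1) : Prop :=
  (forall x, W x -> forall (c : R) u v, A x (c *: u + v) = c * A x u + A x v) /\
  (forall (p : M) v,
    Cinfty [set y | ccod (chart_at p) y /\ W (cinv (chart_at p) y)]
           (fun y => comp1 A p y v)).

Definition smooth_form2 (W : set M) (B : form2) : Prop :=
  [/\ forall x, W x -> forall (c : R) u v w,
        B x (c *: u + v) w = c * B x u w + B x v w,
      forall x, W x -> forall u, B x u u = 0,
      forall x, W x -> forall u v, B x u v = - B x v u
    & forall (p : M) u v,
        Cinfty [set y | ccod (chart_at p) y /\ W (cinv (chart_at p) y)]
               (fun y => comp2 B p y u v)].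

Definition dfun (f : M -> R) : form1 := fun x v =>
  'D_v (fun y => f (cinv (chart_at x) y)) (cfun (chart_at x) x).

Definition dcfun (f : M -> R[i]) (x : M) (v : 'rV[R]_m) : R[i] :=
  Complex (dfun (fun y => complex.Re (f y)) x v)
          (dfun (fun y => complex.Im (f y)) x v).

Definition twopii : R[i] := Complex 0 (2 * pi).

(* The quotient is real when [f] has values in U(1). *)
Definition dlog (f : M -> R[i]) : form1 := fun x v =>
  complex.Re ((f x)^-1 * dcfun f x v / twopii).

Definition dform1 (A : form1) : form2 := fun x u v =>
  'D_u (fun y => comp1 A x y v) (cfun (chart_at x) x)
  - 'D_v (fun y => comp1 A x y u) (cfun (chart_at x) x).

End OneManifold.

Section Maps.
Variables (m n : nat) (M : manifold m) (N : manifold n) (Phi : M -> N).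

Definition smooth_map : Prop :=
  continuous Phi /\
  forall (p : M) (q : N) (j : 'I_n),
    Cinfty [set y | ccod (chart_at p) y /\
                    cdom (chart_at q) (Phi (cinv (chart_at p) y))]
           (fun y => cfun (chart_at q) (Phi (cinv (chart_at p) y)) 0 j).

Definition tmap (x : M) (v : 'rV[R]_m) : 'rV[R]_n :=
  'D_v (fun y => cfun (chart_at (Phi x)) (Phi (cinv (chart_at x) y)))
       (cfun (chart_at x) x).

Definition pull1 (A : form1 N) : form1 M := fun x v => A (Phi x) (tmap x v).

Definition pull2 (B : form2 N) : form2 M :=
  fun x u v => B (Phi x) (tmap x u) (tmap x v).

Record covpair := CovPair {
  cI : Type;
  cJ : Type;
  cU : cI -> set M;
  cV : cJ -> set N;
  cr : cI -> cJ;
  cU_open : forall i, open (cU i);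
  cV_open : forall j, open (cV j);
  cU_cover : forall x, exists i, cU i x;
  cV_cover : forall y, exists j, cV j y;
  crP : forall i x, cU i x -> cV (cr i) (Phi x)
}.

(* [c'] refines [c]; the last condition makes restriction of cochains commute
   with the maps induced by pull-back along [Phi]. *)
Record refinement (c' c : covpair) := Refinement {
  rI : cI c' -> cI c;
  rJ : cJ c' -> cJ c;
  rIP : forall i x, cU i x -> cU (rI i) x;
  rJP : forall j y, cV j y -> cV (rJ j) y;
  r_comm : (fun i => cr (rI i)) = (fun i => rJ (cr i))
}.

End Maps.
End Manifolds.

Section Cech.
Variables (R : realType) (m : nat) (X : manifold R m) (J : Type).

(* Cochains are families of functions and forms defined on all of [X]; only
   their values on the intersections of the cover matter.  U(1)-valued cochains
   are written multiplicatively.  The total differential is delta + (-1)^p d on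
   C^p(A^q). *)

Definition mdelta0 (h : J -> X -> R[i]) : J -> J -> X -> R[i] :=
  fun i j x => h j x / h i x.
Definition mdelta1 (f : J -> J -> X -> R[i]) : J -> J -> J -> X -> R[i] :=
  fun i j k x => f j k x / f i k x * f i j x.
Definition mdelta2 (g : J -> J -> J -> X -> R[i]) :
    J -> J -> J -> J -> X -> R[i] :=
  fun i j k l x => g j k l x / g i k l x * g i j l x / g i j k x.

Definition adelta0_1 (A : J -> form1 X) : J -> J -> form1 X :=
  fun i j x v => A j x v - A i x v.
Definition adelta1_1 (a : J -> J -> form1 X) : J -> J -> J -> form1 X :=
  fun i j k x v => a j k x v - a i k x v + a i j x v.
Definition adelta0_2 (w : J -> form2 X) : J -> J -> form2 X :=
  fun i j x u v => w j x u v - w i x u v.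

(* Coefficients A = (U(1) -> Omega^1), total degrees 0, 1, 2. *)
Definition TA0 : Type := J -> X -> R[i].
Definition TA1 : Type := (J -> J -> X -> R[i]) * (J -> form1 X).
Definition TA2 : Type := (J -> J -> J -> X -> R[i]) * (J -> J -> form1 X).

Definition dA0 (h : TA0) : TA1 := (mdelta0 h, fun i => dlog (h i)).
Definition dA1 (z : TA1) : TA2 :=
  (mdelta1 z.1, fun i j x v => adelta0_1 z.2 i j x v - dlog (z.1 i j) x v).

(* Coefficients B = (U(1) -> Omega^1 -> Omega^2), total degrees 1, 2, 3. *)
Definition TB1 : Type := (J -> J -> X -> R[i]) * (J -> form1 X).
Definition TB2 : Type :=
  (J -> J -> J -> X -> R[i]) * (J -> J -> form1 X) * (J -> form2 X).
Definition TB3 : Type :=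
  (J -> J -> J -> J -> X -> R[i]) * (J -> J -> J -> form1 X) *
  (J -> J -> form2 X).

Definition dB1 (z : TB1) : TB2 :=
  (mdelta1 z.1,
   fun i j x v => adelta0_1 z.2 i j x v - dlog (z.1 i j) x v,
   fun i => dform1 (z.2 i)).
Definition dB2 (z : TB2) : TB3 :=
  (mdelta2 z.1.1,
   fun i j k x v => adelta1_1 z.1.2 i j k x v + dlog (z.1.1 i j k) x v,
   fun i j x u v => adelta0_2 z.2 i j x u v - dform1 (z.1.2 i j) x u v).

Definition subA1 (z z' : TA1) : TA1 :=
  (fun i j x => z.1 i j x / z'.1 i j x, fun i x v => z.2 i x v - z'.2 i x v).
Definition subA2 (z z' : TA2) : TA2 :=
  (fun i j k x => z.1 i j k x / z'.1 i j k x,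
   fun i j x v => z.2 i j x v - z'.2 i j x v).
Definition subB2 (z z' : TB2) : TB2 :=
  (fun i j k x => z.1.1 i j k x / z'.1.1 i j k x,
   fun i j x v => z.1.2 i j x v - z'.1.2 i j x v,
   fun i x u v => z.2 i x u v - z'.2 i x u v).

Variable V : J -> set X.

Definition V2 (i j : J) : set X := V i `&` V j.
Definition V3 (i j k : J) : set X := V i `&` V j `&` V k.
Definition V4 (i j k l : J) : set X := V i `&` V j `&` V k `&` V l.

Definition smoothA0 (h : TA0) : Prop := forall i, U1 (V i) (h i).
(* Also used for TB1, which coincides with TA1. *)
Definition smoothA1 (z : TA1) : Prop :=
  (forall i j, U1 (V2 i j) (z.1 i j)) /\ (forall i, smooth_form1 (V i) (z.2 i)).
Definition smoothB2 (z : TB2) : Prop :=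
  [/\ forall i j k, U1 (V3 i j k) (z.1.1 i j k),
      forall i j, smooth_form1 (V2 i j) (z.1.2 i j)
    & forall i, smooth_form2 (V i) (z.2 i)].

Definition zeroA1 (z : TA1) : Prop :=
  (forall i j x, V2 i j x -> z.1 i j x = 1) /\
  (forall i x v, V i x -> z.2 i x v = 0).
Definition zeroA2 (z : TA2) : Prop :=
  (forall i j k x, V3 i j k x -> z.1 i j k x = 1) /\
  (forall i j x v, V2 i j x -> z.2 i j x v = 0).
Definition zeroB2 (z : TB2) : Prop :=
  [/\ forall i j k x, V3 i j k x -> z.1.1 i j k x = 1,
      forall i j x v, V2 i j x -> z.1.2 i j x v = 0
    & forall i x u v, V i x -> z.2 i x u v = 0].
Definition zeroB3 (z : TB3) : Prop :=
  [/\ forall i j k l x, V4 i j k l x -> z.1.1 i j k l x = 1,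
      forall i j k x v, V3 i j k x -> z.1.2 i j k x v = 0
    & forall i j x u v, V2 i j x -> z.2 i j x u v = 0].

End Cech.

Section Deligne.
Variables (R : realType) (m n : nat) (M : manifold R m) (N : manifold R n).
Variable Phi : M -> N.

Definition pullB1 (c : covpair Phi) (z : TB1 N (cJ c)) : TA1 M (cI c) :=
  (fun i i' x => z.1 (cr i) (cr i') (Phi x), fun i => pull1 Phi (z.2 (cr i))).
(* The Omega^2 component is sent to zero. *)
Definition pullB2 (c : covpair Phi) (z : TB2 N (cJ c)) : TA2 M (cI c) :=
  (fun i i' i'' x => z.1.1 (cr i) (cr i') (cr i'') (Phi x),
   fun i i' => pull1 Phi (z.1.2 (cr i) (cr i'))).

Definition cone1 (c : covpair Phi) : Type :=
  TA0 M (cI c) * TB1 N (cJ c).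
Definition cone2 (c : covpair Phi) : Type :=
  TA1 M (cI c) * TB2 N (cJ c).
Definition cone3 (c : covpair Phi) : Type :=
  TA2 M (cI c) * TB3 N (cJ c).

Definition dcone1 (c : covpair Phi) (z : cone1 c) : cone2 c :=
  (subA1 (pullB1 z.2) (dA0 z.1), dB1 z.2).
Definition dcone2 (c : covpair Phi) (z : cone2 c) : cone3 c :=
  (subA2 (pullB2 z.2) (dA1 z.1), dB2 z.2).

Definition smooth_cone1 (c : covpair Phi) (z : cone1 c) : Prop :=
  smoothA0 (@cU _ _ _ _ _ _ c) z.1 /\ smoothA1 (@cV _ _ _ _ _ _ c) z.2.
Definition smooth_cone2 (c : covpair Phi) (z : cone2 c) : Prop :=
  smoothA1 (@cU _ _ _ _ _ _ c) z.1 /\ smoothB2 (@cV _ _ _ _ _ _ c) z.2.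

Definition sub_cone2 (c : covpair Phi) (z z' : cone2 c) : cone2 c :=
  (subA1 z.1 z'.1, subB2 z.2 z'.2).
Definition zero_cone2 (c : covpair Phi) (z : cone2 c) : Prop :=
  zeroA1 (@cU _ _ _ _ _ _ c) z.1 /\ zeroB2 (@cV _ _ _ _ _ _ c) z.2.
Definition zero_cone3 (c : covpair Phi) (z : cone3 c) : Prop :=
  zeroA2 (@cU _ _ _ _ _ _ c) z.1 /\ zeroB3 (@cV _ _ _ _ _ _ c) z.2.

Definition is_cocycle (c : covpair Phi) (z : cone2 c) : Prop :=
  smooth_cone2 z /\ zero_cone3 (dcone2 z).

Definition cohomologous (c : covpair Phi) (z z' : cone2 c) : Prop :=
  exists2 y : cone1 c, smooth_cone1 y &
    zero_cone2 (sub_cone2 (sub_cone2 z z') (dcone1 y)).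

Definition restrict_cone2 (c' c : covpair Phi) (r : refinement c' c)
    (z : cone2 c) : cone2 c' :=
  ((fun i i' => z.1.1 (rI r i) (rI r i'), fun i => z.1.2 (rI r i)),
   (fun j j' j'' => z.2.1.1 (rJ r j) (rJ r j') (rJ r j''),
    fun j j' => z.2.1.2 (rJ r j) (rJ r j'),
    fun j => z.2.2 (rJ r j))).

Definition cocycle : Type :=
  {c : covpair Phi & {z : cone2 c | is_cocycle z}}.

(* Equality in the direct limit. *)
Definition cocycle_eq (z z' : cocycle) : Prop :=
  exists (c : covpair Phi) (r : refinement c (projT1 z))
         (r' : refinement c (projT1 z')),
    cohomologous (restrict_cone2 r (proj1_sig (projT2 z)))
                 (restrict_cone2 r' (proj1_sig (projT2 z'))).

Definition deligneH2 : Type := classes cocycle_eq.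

End Deligne.

Section Lines.
Variable R : realType.

Record line := Line {
  lfib :> vectType R[i];
  lherm : lfib -> lfib -> R[i]
}.

Definition is_line (l : line) : Prop :=
  [/\ \dim {:l} = 1%N,
      forall (c : R[i]) (u v w : l),
        lherm (c *: u + v) w = c * lherm u w + lherm v w,
      forall u v : l, lherm u v = conjc (lherm v u)
    & forall u : l, u != 0 -> 0 < lherm u u].

(* A nonzero vector of the line. *)
Definition lvec (l : line) : l := vpick {:l}.

(* The scalar c with u = c *: e. *)
Definition coef (l : line) (u e : l) : R[i] := lherm u e / lherm e e.

Definition dual_line (l : line) : line :=
  @Line 'Hom(l, R[i]^o)
    (fun f g => (f (lvec l) : R[i]) * conjc (g (lvec l) : R[i])
                / lherm (lvec l) (lvec l)).

(* a (x) b is Hom(b^-1, a). *)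
Definition tens_line (a b : line) : line :=
  @Line 'Hom(dual_line b, a)
    (fun f g => lherm (f (lvec (dual_line b))) (g (lvec (dual_line b)))
                / lherm (lvec (dual_line b)) (lvec (dual_line b))).

(* The element of the dual line taking the value 1 at e. *)
Definition dualv (l : line) (e : l) : dual_line l :=
  linfun (fun v : l => coef v e : R[i]^o).

Definition tensv (a b : line) (u : a) (v : b) : tens_line a b :=
  linfun (fun phi : 'Hom(b, R[i]^o) => (phi v : R[i]) *: u).

End Lines.

Section Bundles.
Variables (R : realType) (m : nat) (M : manifold R m).

(* [lb_frame p] is a unitary frame on the neighbourhood [lb_dom p] of [p].
   A bundle over an open set is given by data at all points of [M], with no
   condition outside the open set, so that restriction is implicit. *)
Record lbundle := LBundle {
  lb_fib :> M -> line R;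
  lb_dom : M -> set M;
  lb_frame : M -> forall x, lb_fib x;
  lb_conn : (forall x, lb_fib x) -> forall x, 'rV[R]_m -> lb_fib x
}.

Definition section (L : lbundle) : Type := forall x, L x.

Definition is_hermitian_lb (W : set M) (L : lbundle) : Prop :=
  [/\ forall x, W x -> is_line (L x),
      forall p, W p -> open (lb_dom L p) /\ lb_dom L p p,
      forall p x, W p -> W x -> lb_dom L p x ->
        lherm (lb_frame L p x) (lb_frame L p x) = 1
    & forall p q, W p -> W q ->
        csmooth (W `&` lb_dom L p `&` lb_dom L q)
                (fun x => lherm (lb_frame L p x) (lb_frame L q x))].

Definition smooth_section (W : set M) (L : lbundle) (s : section L) : Prop :=
  forall q, W q ->
    csmooth (W `&` lb_dom L q) (fun x => lherm (s x) (lb_frame L q x)).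

Definition unitary_section (W : set M) (L : lbundle) (s : section L) : Prop :=
  smooth_section W s /\ forall x, W x -> lherm (s x) (s x) = 1.

Definition parallel (W : set M) (L : lbundle) (s : section L) : Prop :=
  forall x v, W x -> lb_conn s x v = 0.

(* Hermitian connections, acting on the smooth sections over open subsets. *)
Definition is_connection (W : set M) (L : lbundle) : Prop :=
  forall W', open W' -> W' `<=` W ->
  forall s t : section L, smooth_section W' s -> smooth_section W' t ->
  [/\ (forall x, W' x -> s x = t x) ->
        forall x v, W' x -> lb_conn s x v = lb_conn t x v,
      forall x v, W' x ->
        lb_conn (fun y => s y + t y) x v = lb_conn s x v + lb_conn t x v,
      forall f, csmooth W' f -> forall x v, W' x ->
        lb_conn (fun y => f y *: s y) x v
        = dcfun f x v *: s x + f x *: lb_conn s x v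
    & [/\ forall x, W' x -> forall (c : R) u v,
            lb_conn s x (c *: u + v)
            = (c%:C)%C *: lb_conn s x u + lb_conn s x v,
          forall q, W' q ->
            smooth_form1 (W' `&` lb_dom L q) (fun x v =>
              complex.Re (lherm (lb_conn s x v) (lb_frame L q x))) /\
            smooth_form1 (W' `&` lb_dom L q) (fun x v =>
              complex.Im (lherm (lb_conn s x v) (lb_frame L q x)))
        & forall x v, W' x ->
            dcfun (fun y => lherm (s y) (t y)) x v
            = lherm (lb_conn s x v) (t x) + lherm (s x) (lb_conn t x v)]].

Definition is_lb (W : set M) (L : lbundle) : Prop :=
  is_hermitian_lb W L /\ is_connection W L.

(* Isomorphism of Hermitian line bundles over the open set [W]. *)
Definition lb_iso (W : set M) (L L' : lbundle) : Prop :=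
  exists f : forall x, L x -> L' x,
    [/\ forall x, W x -> forall (c : R[i]) (u v : L x),
          f x (c *: u + v) = c *: f x u + f x v,
        forall x, W x -> forall u v : L x, lherm (f x u) (f x v) = lherm u v
      & forall W', open W' -> W' `<=` W -> forall s : section L,
          smooth_section W' s ->
          smooth_section W' ((fun x => f x (s x)) : section L')].

(* The real form A with nabla s = 2 pi i A s, for a unitary frame s. *)
Definition conn_form (L : lbundle) (s : section L) : form1 M := fun x v =>
  complex.Re (lherm (lb_conn s x v) (s x) / twopii R).

Definition curv (L : lbundle) : form2 M := fun x =>
  dform1 (conn_form (lb_frame L x)) x.

Definition ldual (L : lbundle) : lbundle :=
  @LBundle (fun x => dual_line (L x)) (lb_dom L)
    (fun p x => dualv (lb_frame L p x))
    (fun phi x v =>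
       let s := lb_frame L x in
       let a : R[i] :=
         dcfun (fun y => (phi y : 'Hom(L y, R[i]^o)) (s y)) x v
         - (phi x : 'Hom(L x, R[i]^o)) (lb_conn s x v) in
       linfun (fun w : L x => coef w (s x) * a : R[i]^o)).

Definition ltens (L L' : lbundle) : lbundle :=
  @LBundle (fun x => tens_line (L x) (L' x))
    (fun p => lb_dom L p `&` lb_dom L' p)
    (fun p x => tensv (lb_frame L p x) (lb_frame L' p x))
    (fun u x v =>
       let s := lb_frame L x in
       let t := lb_frame L' x in
       let f y := coef (u y) (tensv (s y) (t y)) in
       dcfun f x v *: tensv (s x) (t x)
       + f x *: (tensv (lb_conn s x v) (t x) + tensv (s x) (lb_conn t x v))).

Section Delta.
Variable I : Type.

Definition delta_lb0 (E : I -> lbundle) (i i' : I) : lbundle :=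
  ltens (E i') (ldual (E i)).

Definition delta_lb1 (L : I -> I -> lbundle) (i i' i'' : I) : lbundle :=
  ltens (ltens (L i' i'') (ldual (L i i''))) (L i i').

End Delta.
End Bundles.

Section PullLB.
Variables (R : realType) (m n : nat) (M : manifold R m) (N : manifold R n).
Variable Phi : M -> N.

Definition lpull (L : lbundle N) : lbundle M :=
  @LBundle _ _ M (fun x => L (Phi x)) (fun p => Phi @^-1` lb_dom L (Phi p))
    (fun p x => lb_frame L (Phi p) (Phi x))
    (fun u x v =>
       let s := lb_frame L (Phi x) in
       let f (y : M) := coef (u y) (s (Phi y)) in
       dcfun f x v *: s (Phi x) + f x *: lb_conn s (Phi x) (tmap Phi x v)).

End PullLB.

Section TensorBases.
Variable R : realType.

(* The basis of c (x) b^-1 (x) a, the fibre of delta_lb1, induced by bases. *)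
Definition theta_line (bc ac ab : line R) : line R :=
  tens_line (tens_line bc (dual_line ac)) ab.
Definition thetav (bc ac ab : line R) (u : bc) (v : ac) (w : ab) :
  theta_line bc ac ab := tensv (tensv u (dualv v)) w.

(* Likewise for the fibre of (delta E^-1)_{ii'} (x) L_{ii'}. *)
Definition psi_line (e e' l : line R) : line R :=
  tens_line (tens_line (dual_line e') (dual_line (dual_line e))) l.
Definition psiv (e e' l : line R) (u : e) (u' : e') (w : l) : psi_line e e' l :=
  tensv (tensv (dualv u') (dualv (dualv u))) w.

End TensorBases.

Section Gerbes.
Variables (R : realType) (m : nat) (M : manifold R m) (J : Type).

Record gerbe := Gerbe {
  g_L : J -> J -> lbundle M;
  g_theta : forall i j k, section (delta_lb1 g_L i j k);
  g_form : J -> form2 M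
}.

Definition g_fib (G : gerbe) (i j : J) (x : M) : line R := g_L G i j x.

(* delta theta = 1: the line delta (delta L) is trivialised by contracting each
   L_{ab} with its dual, so the condition says that the alternating product of
   the coordinates of theta in bases induced by vectors of the L_{ab} is 1. *)
Definition theta_closed (V : J -> set M) (G : gerbe) : Prop :=
  forall a b c d x, V4 V a b c d x ->
  forall (lab : g_fib G a b x) (lac : g_fib G a c x) (lad : g_fib G a d x)
         (lbc : g_fib G b c x) (lbd : g_fib G b d x) (lcd : g_fib G c d x),
  lab != 0 -> lac != 0 -> lad != 0 -> lbc != 0 -> lbd != 0 -> lcd != 0 ->
  coef (g_theta G b c d x : theta_line _ _ _) (thetav lcd lbd lbc)
  / coef (g_theta G a c d x : theta_line _ _ _) (thetav lcd lad lac)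
  * coef (g_theta G a b d x : theta_line _ _ _) (thetav lbd lad lab)
  / coef (g_theta G a b c x : theta_line _ _ _) (thetav lbc lac lab) = 1.

Definition is_gerbe (V : J -> set M) (G : gerbe) : Prop :=
  [/\ forall j j', is_lb (V2 V j j') (g_L G j j'),
      forall j j', lb_iso (V2 V j j') (g_L G j j') (ldual (g_L G j' j)),
      forall j j' j'', unitary_section (V3 V j j' j'') (g_theta G j j' j''),
      theta_closed V G
    & [/\ forall j j' j'', parallel (V3 V j j' j'') (g_theta G j j' j''),
          forall j, smooth_form2 (V j) (g_form G j)
        & forall j j' x u v, V2 V j j' x ->
            g_form G j' x u v - g_form G j x u v = curv (g_L G j j') x u v]].

(* Quasi-line bundles for a gerbe whose line bundles have fibres [ell]. *)
Record qlb (ell : J -> J -> M -> line R) := QLB {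
  q_E : J -> lbundle M;
  q_psi : forall i i' x, psi_line (q_E i x) (q_E i' x) (ell i i' x)
}.

Definition q_psi_section (G : gerbe) (Q : qlb (g_fib G)) (i i' : J) :
    section (ltens (delta_lb0 (fun k => ldual (q_E Q k)) i i') (g_L G i i')) :=
  q_psi Q i i'.

(* delta psi = theta, in coordinates as in [theta_closed]. *)
Definition psi_theta (U : J -> set M) (G : gerbe) (Q : qlb (g_fib G)) : Prop :=
  forall a b c x, V3 U a b c x ->
  forall (ea : q_E Q a x) (eb : q_E Q b x) (ec : q_E Q c x)
         (lab : g_fib G a b x) (lac : g_fib G a c x) (lbc : g_fib G b c x),
  ea != 0 -> eb != 0 -> ec != 0 -> lab != 0 -> lac != 0 -> lbc != 0 ->
  coef (q_psi Q b c x) (psiv eb ec lbc) / coef (q_psi Q a c x) (psiv ea ec lac)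
  * coef (q_psi Q a b x) (psiv ea eb lab)
  = coef (g_theta G a b c x : theta_line _ _ _) (thetav lbc lac lab).

Definition is_qlb (U : J -> set M) (G : gerbe) (Q : qlb (g_fib G)) : Prop :=
  [/\ forall i, is_lb (U i) (q_E Q i),
      forall i i', unitary_section (V2 U i i') (q_psi_section Q i i'),
      psi_theta U Q
    & forall i i', parallel (V2 U i i') (q_psi_section Q i i')].

Definition error (G : gerbe) (Q : qlb (g_fib G)) (i : J) : form2 M :=
  fun x u v => g_form G i x u v - curv (q_E Q i) x u v.

Definition g_tens (G G' : gerbe) : gerbe :=
  @Gerbe (fun i j => ltens (g_L G i j) (g_L G' i j))
    (fun i j k x =>
       let bc := lvec (g_fib G j k x) in let bc' := lvec (g_fib G' j k x) in
       let ac := lvec (g_fib G i k x) in let ac' := lvec (g_fib G' i k x) in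
       let ab := lvec (g_fib G i j x) in let ab' := lvec (g_fib G' i j x) in
       (coef (g_theta G i j k x : theta_line _ _ _) (thetav bc ac ab)
        * coef (g_theta G' i j k x : theta_line _ _ _) (thetav bc' ac' ab'))
       *: thetav (tensv bc bc') (tensv ac ac') (tensv ab ab'))
    (fun j x u v => g_form G j x u v + g_form G' j x u v).

Definition g_inv (G : gerbe) : gerbe :=
  @Gerbe (fun i j => ldual (g_L G i j))
    (fun i j k x =>
       let bc := lvec (g_fib G j k x) in
       let ac := lvec (g_fib G i k x) in
       let ab := lvec (g_fib G i j x) in
       (coef (g_theta G i j k x : theta_line _ _ _) (thetav bc ac ab))^-1
       *: thetav (dualv bc) (dualv ac) (dualv ab))
    (fun j x u v => - g_form G j x u v).

Definition q_tens ell ell' (Q : qlb ell) (Q' : qlb ell') :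
    qlb (fun i i' x => tens_line (ell i i' x) (ell' i i' x)) :=
  @QLB (fun i i' x => tens_line (ell i i' x) (ell' i i' x))
    (fun i => ltens (q_E Q i) (q_E Q' i))
    (fun i i' x =>
       let e := lvec (q_E Q i x) in let f := lvec (q_E Q' i x) in
       let e' := lvec (q_E Q i' x) in let f' := lvec (q_E Q' i' x) in
       let l := lvec (ell i i' x) in let k := lvec (ell' i i' x) in
       (coef (q_psi Q i i' x) (psiv e e' l)
        * coef (q_psi Q' i i' x) (psiv f f' k))
       *: psiv (tensv e f) (tensv e' f') (tensv l k)).

Definition q_inv ell (Q : qlb ell) :
    qlb (fun i i' x => dual_line (ell i i' x)) :=
  @QLB (fun i i' x => dual_line (ell i i' x))
    (fun i => ldual (q_E Q i))
    (fun i i' x =>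
       let e := lvec (q_E Q i x) in
       let e' := lvec (q_E Q i' x) in
       let l := lvec (ell i i' x) in
       (coef (q_psi Q i i' x) (psiv e e' l))^-1
       *: psiv (dualv e) (dualv e') (dualv l)).

(* Two quasi-line bundles for the same gerbe, on the same cover, differ by the
   line bundle with connection obtained by gluing the E_i (x) E'_i^-1 along
   psi (x) psi'^-1, an element of which maps the fibre over i' to that over i.
   It has a parallel unitary section. *)
Definition difference_trivial (U : J -> set M) ell (Q Q' : qlb ell) : Prop :=
  exists s : forall i, section (ltens (q_E Q i) (ldual (q_E Q' i))),
    [/\ forall i, unitary_section (U i) (s i),
        forall i, parallel (U i) (s i)
      & forall i i' x, V2 U i i' x ->
        forall (e : q_E Q i x) (e' : q_E Q i' x)
               (f : q_E Q' i x) (f' : q_E Q' i' x) (l : ell i i' x),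
        e != 0 -> e' != 0 -> f != 0 -> f' != 0 -> l != 0 ->
        coef (s i x : tens_line _ _) (tensv e (dualv f))
        = coef (q_psi Q i i' x) (psiv e e' l)
          / coef (q_psi Q' i i' x) (psiv f f' l)
          * coef (s i' x : tens_line _ _) (tensv e' (dualv f'))].

End Gerbes.

Section Reindex.
Variables (R : realType) (m : nat) (M : manifold R m) (J K : Type) (t : K -> J).

Definition g_reindex (G : gerbe M J) : gerbe M K :=
  @Gerbe _ _ M K (fun k k' => g_L G (t k) (t k'))
    (fun k k' k'' => g_theta G (t k) (t k') (t k''))
    (fun k => g_form G (t k)).

Definition q_reindex ell (Q : @qlb R m M J ell) :
    @qlb R m M K (fun k k' => ell (t k) (t k')) :=
  @QLB _ _ M K (fun k k' => ell (t k) (t k'))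
    (fun k => q_E Q (t k)) (fun k k' => q_psi Q (t k) (t k')).

End Reindex.

Section RelativeGerbes.
Variables (R : realType) (m n : nat) (M : manifold R m) (N : manifold R n).
Variable Phi : M -> N.

Definition g_pull (J : Type) (G : gerbe N J) : gerbe M J :=
  @Gerbe _ _ M J (fun i j => lpull Phi (g_L G i j))
    (fun i j k x => g_theta G i j k (Phi x))
    (fun j => pull2 Phi (g_form G j)).

Definition q_pull (J : Type) ell (Q : @qlb R n N J ell) :
    @qlb R m M J (fun i j x => ell i j (Phi x)) :=
  @QLB _ _ M J (fun i j x => ell i j (Phi x))
    (fun i => lpull Phi (q_E Q i)) (fun i j x => q_psi Q i j (Phi x)).

Definition g_pull_reindex (I J : Type) (r : I -> J) (G : gerbe N J) :
  gerbe M I := g_reindex r (g_pull G).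

(* The quasi-line bundle is defined on a refinement of the pulled back cover. *)
Record relgerbe_data := RelGerbeData {
  rg_cov : covpair Phi;
  rg_G : gerbe N (cJ rg_cov);
  rg_Q : qlb (g_fib (g_pull_reindex (@cr _ _ _ _ _ _ rg_cov) rg_G))
}.

Definition is_relgerbe (X : relgerbe_data) : Prop :=
  is_gerbe (@cV _ _ _ _ _ _ (rg_cov X)) (rg_G X) /\
  is_qlb (@cU _ _ _ _ _ _ (rg_cov X)) (rg_Q X).

Definition relgerbe : Type := {X : relgerbe_data | is_relgerbe X}.

(* Restriction of the quasi-line bundle of a relative gerbe to a refinement. *)
Definition rg_restrict (X : relgerbe_data) (c : covpair Phi)
    (r : refinement c (rg_cov X)) :
    qlb (g_fib (g_pull_reindex (fun i => rJ r (@cr _ _ _ _ _ _ c i)) (rg_G X))) :=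
  eq_rect _ (fun rho => qlb (g_fib (g_pull_reindex rho (rg_G X))))
    (q_reindex (rI r) (rg_Q X)) _ (r_comm r).

Definition relgerbe_iso_data (X1 X2 : relgerbe_data) : Prop :=
  exists (c : covpair Phi) (r1 : refinement c (rg_cov X1))
         (r2 : refinement c (rg_cov X2)),
  let D := g_tens (g_reindex (rJ r2) (rg_G X2))
                  (g_inv (g_reindex (rJ r1) (rg_G X1))) in
  exists Q' : qlb (g_fib D),
    [/\ is_qlb (@cV _ _ _ _ _ _ c) Q',
        forall j x u v, @cV _ _ _ _ _ _ c j x -> error Q' j x u v = 0
      & difference_trivial (@cU _ _ _ _ _ _ c)
          (q_tens (rg_restrict r2) (q_inv (rg_restrict r1)))
          (q_reindex (@cr _ _ _ _ _ _ c) (q_pull Q'))].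

Definition relgerbe_iso (X1 X2 : relgerbe) : Prop :=
  relgerbe_iso_data (proj1_sig X1) (proj1_sig X2).

Definition relgerbe_classes : Type := classes relgerbe_iso.

End RelativeGerbes.

(* Main.v *)
(* In local unitary frames of its line bundles, a relative gerbe with connection
   has coordinates (h, a, g, A, w): the functions theta = g s s^-1 s and
   psi = h e^-1 e s, the connection forms A of the s and a of the e, and the
   2-forms w.  The gerbe and quasi-line bundle axioms say exactly that these form
   a cocycle of the cone, a change of frames changes them by a coboundary, and a
   frame description of an isomorphism between two relative gerbes is exactly a
   cochain bounding the difference of their cocycles.  Frames exist globally
   on all the sets involved only after refining both covers, compatibly with Phi,
   so that even the double intersections are small.  Restrictions of a cocycle
   along two refinement maps are homotopic, hence the class of the cocycle does not
   depend on the choices.  Conversely a cocycle is realized by trivial bundles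
   carrying the connections d + 2 pi i A and d + 2 pi i a. *)
Require Import Defs.
From HB Require Import structures.
From mathcomp Require Import all_boot all_order all_algebra.
From mathcomp Require Import complex.
From mathcomp Require Import all_classical all_reals all_analysis.
From mathcomp Require Import ring lra.

Set Implicit Arguments.
Unset Strict Implicit.
Unset Printing Implicit Defensive.

Import Order.TTheory GRing.Theory Num.Theory.
Import numFieldNormedType.Exports.

Local Open Scope classical_set_scope.
Local Open Scope ring_scope.

(** * Smooth functions and forms *)

(** A cocycle [Z X] representing [X] is chosen for every relative gerbe [X], and isomorphism of [X]
    with [Y] is shown to be equivalent to [cocycle_eq (Z X) (Z Y)]; isomorphism thus inherits from
    [cocycle_eq] that it is an equivalence relation. Three obstacles shape the argument. The
    connections of duals, tensor products and pull-backs, and the curvature, are defined by the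
    frame stored at each point, so all of them must be made independent of that frame; for the
    curvature this needs d (dlog f) = 0, hence the symmetry of second derivatives. Two cocycles
    representing [X] may use different refinement maps r and r', while the homotopy of restrictions
    concerns a single cocycle; that cocycle is found on a cover in which every member is repeated,
    which demands frames of the mixed line bundles with indices r j and r' k. Finally [refinement]
    carries an equality of index maps, so a restricted quasi-line bundle is a transport along it,
    and statements about it are proved with the index map left variable. *)

Section Calculus.
Variable R : realType.

(** The first order expansion of [f] at [x] is also one of [g], and uniqueness of the differential
    then identifies it as that of [g]. *)
Lemma near_eq_differentiable (V W : normedModType R) (f g : V -> W) (x : V) :
  (\near x, f x = g x) -> differentiable f x -> differentiable g x.
Proof.
move=> fg /diff_locallyP[cdf fE].
have gE : g \o shift x = cst (g x) + 'd f x +o_ 0 id.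
  apply/eqaddoP => _/posnumP[e].
  move/eqaddoP : fE => /(_ e%:num (gt0 _)) fE.
  have fg0 : \forall h \near 0, f (h + x) = g (h + x).
    by move: fg; rewrite (near_shift 0 x) /= subr0.
  near=> h.
  have : `|(f \o shift x - (cst (f x) + 'd f x)) h| <= e%:num * `|h| by near: h; exact: fE.
  have fgh : f (h + x) = g (h + x) by near: h; exact: fg0.
  by rewrite /= !fctE /= fgh (nbhs_singleton fg).
have dE := diff_unique cdf gE.
by apply/diff_locallyP; rewrite dE.
Unshelve. all: by end_near. Qed.

Lemma near_near (T : topologicalType) (P : T -> Prop) (x : T) :
  (\near x, P x) -> \near x, \near x, P x.
Proof. by move=> Px; move: (nbhs_interior Px). Qed.

(** Derivatives are taken in the ambient space and [S] only selects the points where conditions are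
    imposed, so [Ck] can be tested at one point at a time and depends only on germs. *)
Lemma Ck_pointwise n k (S : set 'rV[R]_n) (f : 'rV[R]_n -> R) :
  Ck k S f <-> forall y, S y -> Ck k [set y] f.
Proof.
elim: k f => [|k IH] f /=.
  by split=> [H y Sy _ -> | H y Sy]; [exact: H | exact: H Sy _ erefl].
split=> [[dH kH] y Sy|H].
  by split=> [_ -> | v]; [exact: dH | apply: (IH _).1 (kH v) _ Sy].
split=> [y Sy | v]; first exact: (H y Sy).1.
by apply/IH => y Sy; apply: (H y Sy).2.
Qed.

Lemma Ck_near n k (y : 'rV[R]_n) (f g : 'rV[R]_n -> R) :
  (\near y, f y = g y) -> Ck k [set y] f -> Ck k [set y] g.
Proof.
elim: k f g => [|k IH] f g fg /=.
  move=> H _ ->; have := H y erefl.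
  rewrite /prop_for /continuous_at -(nbhs_singleton fg) => cf.
  by apply: cvg_trans cf; apply: (@near_eq_cvg _ _ _ _ f g fg).
move=> [df kf]; split=> [_ ->|v]; first exact: near_eq_differentiable fg (df y erefl).
apply: IH (kf v).
by have := near_near fg; apply: filterS => z /= fgz; apply: near_eq_derive.
Qed.

Lemma Ck_S n k (S : set 'rV[R]_n) (f : 'rV[R]_n -> R) : Ck k.+1 S f -> Ck k S f.
Proof.
elim: k f => [|k IH] f.
  by move=> [df _] y Sy; apply: differentiable_continuous; exact: df.
by move=> [df H]; split=> // v; apply: IH; exact: (H v).
Qed.

Lemma Ck_cst n k (S : set 'rV[R]_n) (c : R) : Ck k S (fun _ => c).
Proof.
elim: k c => [|k IH] c /=; first by move=> y _; exact: cst_continuous.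
split=> [y _|v]; first exact: differentiable_cst.
have -> : 'D_v (fun _ : 'rV[R]_n => c) = (fun=> 0) by apply/funext => y; exact: derive_cst.
exact: IH.
Qed.

Lemma Ck_congr_on n k (S : set 'rV[R]_n) (f g : 'rV[R]_n -> R) :
  (forall y, S y -> \near y, f y = g y) -> Ck k S f -> Ck k S g.
Proof.
move=> fg /Ck_pointwise H; apply/Ck_pointwise => y Sy.
by apply: Ck_near (H y Sy); exact: fg.
Qed.

Lemma Ck_sub n k (S S' : set 'rV[R]_n) (f : 'rV[R]_n -> R) :
  S' `<=` S -> Ck k S f -> Ck k S' f.
Proof.
by move=> SS /Ck_pointwise H; apply/Ck_pointwise => y /SS; exact: H.
Qed.

Lemma Ck_D n k (S : set 'rV[R]_n) (f g : 'rV[R]_n -> R) : open S ->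
  Ck k S f -> Ck k S g -> Ck k S (fun y => f y + g y).
Proof.
move=> oS; elim: k f g => [|k IH] f g /=.
  by move=> cf cg y Sy; apply: continuousD; [exact: cf|exact: cg].
move=> [df kf] [dg kg]; split=> [y Sy|v].
  by apply: differentiableD; [exact: df|exact: dg].
apply: Ck_congr_on (IH _ _ (kf v) (kg v)) => y Sy.
near=> z; have Sz : S z by near: z; exact: open_nbhs_nbhs.
by rewrite deriveD //; apply: diff_derivable; [exact: df|exact: dg].
Unshelve. all: by end_near. Qed.

Lemma Ck_M n k (S : set 'rV[R]_n) (f g : 'rV[R]_n -> R) : open S ->
  Ck k S f -> Ck k S g -> Ck k S (fun y => f y * g y).
Proof.
move=> oS; elim: k f g => [|k IH] f g.
  by move=> cf cg y Sy; apply: continuousM; [exact: cf|exact: cg].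
move=> kf kg; have := kf; have := kg; move=> [dg kg'] [df kf']; split=> [y Sy|v].
  by apply: differentiableM; [exact: df|exact: dg].
apply: (@Ck_congr_on _ _ _ (fun y => f y * 'D_v g y + g y * 'D_v f y)).
  move=> y Sy; near=> z; have Sz : S z by near: z; exact: open_nbhs_nbhs.
  by rewrite deriveM //; apply: diff_derivable; [exact: df|exact: dg].
by apply: Ck_D => //; apply: IH; [exact: Ck_S kf | exact: kg' | exact: Ck_S kg | exact: kf'].
Unshelve. all: by end_near. Qed.

Lemma Ck_sum n k (S : set 'rV[R]_n) p (f : 'I_p -> 'rV[R]_n -> R) : open S ->
  (forall i, Ck k S (f i)) -> Ck k S (fun y => \sum_i f i y).
Proof.
move=> oS; elim: p f => [|p IH] f H.
  have -> : (fun y => \sum_i f i y) = (fun=> 0) by apply/funext => y; rewrite big_ord0.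
  exact: Ck_cst.
have -> : (fun y => \sum_i f i y) = (fun y => f ord0 y + \sum_i f (lift ord0 i) y).
  by apply/funext => y; rewrite big_ord_recl.
by apply: Ck_D => //; apply: IH => i; exact: H.
Qed.

Lemma differentiable_rV m n (g : 'rV[R]_m -> 'rV[R]_n) y :
  (forall j, differentiable (fun z => g z 0 j) y) -> differentiable g y.
Proof.
move=> H.
have -> : g = \sum_j (fun z => g z 0 j *: delta_mx 0 j).
  by apply/funext => z; rewrite fct_sumE [LHS]row_sum_delta.
apply: differentiable_sum => j; exact: differentiableZl.
Qed.

Lemma derive_comp m n (g : 'rV[R]_m -> 'rV[R]_n) (f : 'rV[R]_n -> R) y v :
  differentiable g y -> differentiable f (g y) ->
  'D_v (f \o g) y = 'D_('D_v g y) f (g y).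
Proof.
move=> dg df; rewrite !deriveE //; last exact: differentiable_comp.
by rewrite diff_comp.
Qed.

Lemma derive_rV m n (g : 'rV[R]_m -> 'rV[R]_n) y v j :
  differentiable g y -> ('D_v g y) 0 j = 'D_v (fun z => g z 0 j) y.
Proof. by move=> dg; rewrite derive_mx ?mxE //; exact: diff_derivable. Qed.

Lemma derive_dirE n (f : 'rV[R]_n -> R) y w : differentiable f y ->
  'D_w f y = \sum_j w 0 j * 'D_(delta_mx 0 j) f y.
Proof.
move=> df; rewrite deriveE // {1}(row_sum_delta w) linear_sum.
by apply: eq_bigr => j _; rewrite linearZ deriveE.
Qed.

(** Induction on [k]: by the chain rule a derivative of [f \o g] is a sum of products of derivatives
    of the components of [g] with partial derivatives of [f] composed with [g]. Continuity of [g] is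
    asked for only when [k = 0]; above that it follows from differentiability of the components. *)
Lemma Ck_comp m n k (S : set 'rV[R]_m) (T : set 'rV[R]_n)
    (g : 'rV[R]_m -> 'rV[R]_n) (f : 'rV[R]_n -> R) : open S ->
  (forall y, S y -> T (g y)) ->
  (forall j, Ck k S (fun y => g y 0 j)) -> (k = 0%N -> {in S, continuous g}) ->
  Ck k T f -> Ck k S (f \o g).
Proof.
move=> oS ST; elim: k f => [|k IH] f gk g0 fk.
  move=> y Sy; apply: continuous_comp; first by apply: g0 => //; rewrite inE.
  exact/fk/ST.
have dg y : S y -> differentiable g y.
  by move=> Sy; apply: differentiable_rV => j; exact: (gk j).1.
split=> [y Sy|v].
  by apply: differentiable_comp; [exact: dg | apply: fk.1; exact: ST].
apply: (@Ck_congr_on _ _ _ (fun y => \sum_j 'D_v (fun z => g z 0 j) y *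
   ('D_(delta_mx 0 j) f \o g) y)).
  move=> y Sy; near=> z; have Sz : S z by near: z; exact: open_nbhs_nbhs.
  have df : differentiable f (g z) by apply: fk.1; exact: ST.
  rewrite derive_comp //; last exact: dg.
  rewrite derive_dirE //; apply: eq_bigr => j _.
  by rewrite derive_rV //; exact: dg.
apply: Ck_sum => // j; apply: Ck_M => //; first exact: (gk j).2.
apply: IH.
- by move=> i; apply: Ck_S; exact: gk.
- by move=> _ y; rewrite inE => Sy; apply: differentiable_continuous; exact: dg.
- exact: fk.2.
Unshelve. all: by end_near. Qed.

Lemma is_derive_line n (f : 'rV[R]_n -> R) (u w : 'rV[R]_n) (s : R) :
  differentiable f (s *: u + w) ->
  is_derive s 1 (fun s : R => f (s *: u + w)) ('D_u f (s *: u + w)).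
Proof.
move=> df; have := diff_derivable (v := u) df; rewrite /derivable => cf.
have E : (fun h : R => h^-1 *: (((fun s : R => f (s *: u + w)) \o shift s) (h *: (1 : R)) -
    f (s *: u + w))) =
    (fun h => h^-1 *: ((f \o shift (s *: u + w)) (h *: u) - f (s *: u + w))).
  by apply/funext => h /=; rewrite [h%:A]mulr1 scalerDl addrA.
by apply: DeriveDef; rewrite /derivable /derive E.
Qed.

(** The alternating sum of [f] over the corners of the parallelogram at [y] with sides [h *: u] and
    [h *: v]. Its symmetry in [u] and [v] is the source of the symmetry of second derivatives. *)
Definition second_difference n (f : 'rV[R]_n -> R) (y u v : 'rV[R]_n) (h : R) :=
  f (h *: u + (h *: v + y)) - f (h *: u + y) - f (h *: v + y) + f y.

Lemma second_differenceC n (f : 'rV[R]_n -> R) y u v h :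
  second_difference f y u v h = second_difference f y v u h.
Proof. by rewrite /second_difference addrCA; ring. Qed.

(** The mean value theorem, applied in the direction [u] to the difference of [f] along two parallel
    sides, gives [h] times a difference of values of ['D_u f]. Expanding ['D_u f] to first order at
    [y], everything cancels but [h ^+ 2 * 'D_v ('D_u f) y]. *)
Lemma second_difference_approx n (f : 'rV[R]_n -> R) (y u v : 'rV[R]_n) (e : R) :
  0 < e -> (\near y, differentiable f y) -> differentiable ('D_u f) y ->
  \forall h \near 0^'+,
    `|second_difference f y u v h - h ^+ 2 * 'D_v ('D_u f) y| <= e * h ^+ 2.
Proof.
move=> e0 nf dDu.
(* The two points where ['D_u f] is expanded have distances from [y] adding up to at most
   [h * (2 * |u| + |v|)]; the added 1 keeps [K] positive. *)
pose K := 2 * `|u| + `|v| + 1.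
have K0 : 0 < K by rewrite /K ltr_wpDl // addr_ge0 // mulr_ge0.
have e'0 : 0 < e / K by rewrite divr_gt0.
have /diff_locallyP[_ /eqaddoP /(_ _ e'0) apx] := dDu.
have nf' : \forall w \near (0 : 'rV[R]_n), differentiable f (w + y).
  by move: nf; rewrite (near_shift 0 y) /= subr0.
have /nbhs_ballP[r /= r0 rP] : nbhs (0 : 'rV[R]_n) [set w |
   differentiable f (w + y) /\
   `|'D_u f (w + y) - ('D_u f y + 'd ('D_u f) y w)| <= e / K * `|w|].
  by near=> w; split; [near: w; exact: nf' | near: w; exact: apx].
near=> h.
have h0 : 0 < h by [].
have hK : h * K < r.
  by rewrite -ltr_pdivlMr //; near: h; apply: nbhs_right_lt; rewrite divr_gt0.
have inb (a b : R) : 0 <= a <= h -> 0 <= b <= h -> ball (0 : 'rV[R]_n) r (a *: u + b *: v).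
  move=> /andP[a0 ah] /andP[b0 bh].
  rewrite -ball_normE /= sub0r normrN (le_lt_trans _ hK) //.
  rewrite (le_trans (ler_normD _ _)) // !normrZ (ger0_norm a0) (ger0_norm b0).
  have := normr_ge0 u; have := normr_ge0 v; rewrite /K => v0 u0.
  have : a * `|u| <= h * `|u| by rewrite ler_wpM2r.
  have : b * `|v| <= h * `|v| by rewrite ler_wpM2r.
  nra.
have h00 : 0 <= h by exact: ltW.
pose phi (s : R) := f (s *: u + (h *: v + y)) - f (s *: u + y).
have dphi (s : R) : 0 <= s <= h ->
    is_derive s 1 phi ('D_u f (s *: u + (h *: v + y)) - 'D_u f (s *: u + y)).
  move=> sh; apply: is_deriveB; apply: is_derive_line.
    by rewrite addrA; apply: (rP _ _).1; apply: inb => //; rewrite lexx h00.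
  rewrite -[s *: u]addr0 -[X in _ + X + _](scale0r v).
  by apply: (rP _ _).1; apply: inb => //; rewrite lexx h00.
have [c] : exists2 c, c \in `]0, h[%R & phi h - phi 0 =
    ('D_u f (c *: u + (h *: v + y)) - 'D_u f (c *: u + y)) * (h - 0).
  apply: (@MVT R phi (fun s => 'D_u f (s *: u + (h *: v + y)) - 'D_u f (s *: u + y))) => //.
    move=> x; rewrite in_itv /= => /andP[x0 xh]; apply: dphi.
    by rewrite !ltW.
  apply: derivable_within_continuous => x; rewrite in_itv /= => xh.
  by have [] := dphi x xh.
rewrite in_itv /= subr0 => /andP[c0 ch] E.
have -> : second_difference f y u v h = phi h - phi 0.
  by rewrite /second_difference /phi !scale0r !add0r; ring.
rewrite E.
have ch' : 0 <= c <= h by rewrite !ltW.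
have P1 := (rP _ (inb c h ch' _)).2; have P2 := (rP _ (inb c 0 ch' _)).2.
rewrite ?lexx ?h00 in P1 P2; move: (P1 isT) (P2 isT) => {P1 P2}.
rewrite scale0r addr0 addrA.
have -> : 'd ('D_u f) y (c *: u + h *: v) = c * 'd ('D_u f) y u + h * 'D_v ('D_u f) y.
  by rewrite (deriveE v) // linearD !linearZ.
have -> : 'd ('D_u f) y (c *: u) = c * 'd ('D_u f) y u by rewrite linearZ.
move=> P1 P2.
have B1 : `|c *: u + h *: v| <= h * (`|u| + `|v|).
  rewrite (le_trans (ler_normD _ _)) // !normrZ (gtr0_norm c0) (gtr0_norm h0) mulrDr.
  by rewrite lerD2r ler_wpM2r // ltW.
have B2 : `|c *: u| <= h * `|u|.
  by rewrite normrZ (gtr0_norm c0) ler_wpM2r // ltW.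
set a1 := 'D_u f _ in P1 *; set a2 := 'D_u f (c *: u + y) in P2 *.
set b := 'D_v _ _ in P1 *; set d := 'D_u f y in P1 P2; set l := 'd _ _ u in P1 P2.
have -> : (a1 - a2) * h - h ^+ 2 * b =
  h * ((a1 - (d + (c * l + h * b))) - (a2 - (d + c * l))) by ring.
rewrite normrM (gtr0_norm h0) expr2 mulrCA ler_wpM2l //.
apply: (le_trans (ler_normB _ _)); apply: (le_trans (lerD P1 P2)).
rewrite -mulrDr mulrAC ler_pdivrMr // -mulrA ler_wpM2l ?(ltW e0) //.
apply: (le_trans (lerD B1 B2)); rewrite /K; nra.
Unshelve. all: by end_near. Qed.

(** For small [h] both mixed derivatives times [h ^+ 2] lie within [e / 2 * h ^+ 2] of the same
    second difference. *)
Lemma derive_comm n (f : 'rV[R]_n -> R) (y u v : 'rV[R]_n) :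
  (\near y, differentiable f y) -> differentiable ('D_u f) y ->
  differentiable ('D_v f) y -> 'D_v ('D_u f) y = 'D_u ('D_v f) y.
Proof.
move=> nf du dv; apply/eqP; rewrite -subr_eq0 -normr_le0; apply/ler_addgt0Pl => e e0.
have e2 : 0 < e / 2 by rewrite divr_gt0.
have A1 := second_difference_approx v e2 nf du.
have A2 := second_difference_approx u e2 nf dv.
have : \forall h \near (0 : R)^'+, `|'D_v ('D_u f) y - 'D_u ('D_v f) y| <= e + 0.
  near=> h.
  have h0 : 0 < h by [].
  have H1 := near A1 h; have H2 := near A2 h.
  rewrite addr0 -(ler_pM2l (exprn_gt0 2 h0)) -{1}(gtr0_norm (exprn_gt0 2 h0)) -normrM.
  have {H1} : `|second_difference f y u v h - h ^+ 2 * 'D_v ('D_u f) y| <= e / 2 * h ^+ 2 by apply: H1.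
  have {H2} : `|second_difference f y v u h - h ^+ 2 * 'D_u ('D_v f) y| <= e / 2 * h ^+ 2 by apply: H2.
  rewrite (second_differenceC f y v u) => H2 H1.
  set s := second_difference _ _ _ _ _ in H1 H2.
  set a := 'D_v _ _ in H1 *; set b := 'D_u _ _ in H2 *.
  have -> : h ^+ 2 * (a - b) = (s - h ^+ 2 * b) - (s - h ^+ 2 * a) by ring.
  apply: (le_trans (ler_normB _ _)); apply: (le_trans (lerD H2 H1)).
  by rewrite -mulrDl -splitr mulrC.
by move=> /(@filter_ex _ _ (at_right_proper_filter _)) [].
Unshelve. all: by end_near. Qed.

End Calculus.

(** * Complex numbers of modulus one *)

Section ComplexUnits.
Variable R : realType.
Implicit Types x y : R[i].

Lemma ReM x y : complex.Re (x * y) = complex.Re x * complex.Re y - complex.Im x * complex.Im y.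
Proof. by case: x; case: y. Qed.
Lemma ImM x y : complex.Im (x * y) = complex.Re x * complex.Im y + complex.Im x * complex.Re y.
Proof. by case: x; case: y. Qed.
Lemma ReD x y : complex.Re (x + y) = complex.Re x + complex.Re y.
Proof. by case: x; case: y. Qed.
Lemma ImD x y : complex.Im (x + y) = complex.Im x + complex.Im y.
Proof. by case: x; case: y. Qed.
Lemma complexP x y : complex.Re x = complex.Re y -> complex.Im x = complex.Im y -> x = y.
Proof. by case: x => a b; case: y => c d /= -> ->. Qed.

Lemma norm1_sqr x : `|x| = 1 -> complex.Re x ^+ 2 + complex.Im x ^+ 2 = 1.
Proof.
case: x => a b; rewrite normc_def /= => -[] H.
by rewrite -[LHS]sqr_sqrtr ?H ?expr1n // addr_ge0 ?sqr_ge0.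
Qed.

Lemma norm1_neq0 x : `|x| = 1 -> x != 0.
Proof. by move=> H; rewrite -normr_eq0 H oner_eq0. Qed.

Lemma norm1_mulconj x : `|x| = 1 -> x * conjc x = 1.
Proof.
move=> /norm1_sqr; case: x => a b /= H; apply: complexP => /=; last by ring.
by rewrite -H; ring.
Qed.

Lemma norm1_inv x : `|x| = 1 -> x^-1 = conjc x.
Proof.
by move=> H; rewrite -[RHS](mulKf (norm1_neq0 H)) norm1_mulconj // mulr1.
Qed.

Lemma conjc_norm1 x : x * conjc x = 1 -> `|x| = 1.
Proof.
case: x => a b /(congr1 (@complex.Re R)) /= H; rewrite normc_def /=.
have -> : a ^+ 2 + b ^+ 2 = 1 by rewrite -H; ring.
by rewrite sqrtr1.
Qed.

Lemma twopii_neq0 : twopii R != 0.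
Proof.
rewrite /twopii; apply/eqP => -[] /eqP; rewrite mulf_eq0 (gt_eqF (pi_gt0 R)) orbF.
by rewrite pnatr_eq0.
Qed.

Lemma twopii_inv : (twopii R)^-1 = Complex 0 (- (2 * pi)^-1).
Proof.
have p0 : (2 * pi : R) != 0 by rewrite mulf_neq0 ?pnatr_eq0 // gt_eqF // pi_gt0.
apply: (mulfI twopii_neq0); rewrite divff ?twopii_neq0 //.
by rewrite /twopii; apply: complexP; rewrite /= ?mulr0 ?mul0r ?addr0 // sub0r mulrN opprK divff.
Qed.

Lemma Re_div_twopii x : complex.Re (x / twopii R) = complex.Im x / (2 * pi).
Proof. by rewrite twopii_inv ReM /=; ring. Qed.

Lemma Im_div_twopii x : complex.Im (x / twopii R) = - (complex.Re x / (2 * pi)).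
Proof. by rewrite twopii_inv ImM /=; ring. Qed.

End ComplexUnits.

(** * Functions, forms and logarithmic differentials on a manifold *)

Section SmoothFunctions.
Variables (R : realType) (m : nat) (M : manifold R m).
Implicit Types (W : set M) (p x : M).

Lemma cinv_cfun p x : cdom (chart_at p) x -> cinv (chart_at p) (cfun (chart_at p) x) = x.
Proof. by case: (chart_atP p) => _ _ H _ /H[]. Qed.
Lemma cinv_self x : cinv (chart_at x) (cfun (chart_at x) x) = x.
Proof. by apply: cinv_cfun; exact: chart_at_dom. Qed.
Lemma ccod_self x : ccod (chart_at x) (cfun (chart_at x) x).
Proof. by case: (chart_atP x) => _ _ H _; case: (H _ (chart_at_dom x)). Qed.
Definition chart_preim W p := [set y | ccod (chart_at p) y /\ W (cinv (chart_at p) y)].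

Lemma chart_preim_open W p : open W -> open (chart_preim W p).
Proof.
move=> oW; rewrite openE => y [cy Wy]; case: (chart_atP p) => _ oc _ H.
rewrite /interior; apply: filterI; first exact: open_nbhs_nbhs.
by case: (H _ cy) => _ _ /(_ W); apply; exact: open_nbhs_nbhs.
Qed.

Lemma chart_preim_self W x : W x -> chart_preim W x (cfun (chart_at x) x).
Proof. by split; [exact: ccod_self | rewrite cinv_self]. Qed.

Lemma near_chart W p y (P : M -> Prop) : open W -> (forall z, W z -> P z) ->
  chart_preim W p y -> \near y, P (cinv (chart_at p) y).
Proof.
move=> oW WP Wy; apply: filterS (open_nbhs_nbhs (conj (chart_preim_open (p := p) oW) Wy)).
by move=> z [_ /WP].
Qed.

Lemma smooth_sub W W' (f : M -> R) : W' `<=` W -> smooth W f -> smooth W' f.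
Proof.
by move=> WW sf p k; apply: Ck_sub (sf p k) => y [cy /WW Wy].
Qed.

Lemma smooth_congr W (f g : M -> R) : open W -> (forall x, W x -> f x = g x) ->
  smooth W f -> smooth W g.
Proof.
move=> oW fg sf p k; apply: Ck_congr_on (sf p k) => y Wy.
exact: near_chart oW fg Wy.
Qed.

Lemma smooth_local W (f : M -> R) :
  (forall x, W x -> exists2 O, O x & smooth (W `&` O) f) -> smooth W f.
Proof.
move=> H p k; apply/Ck_pointwise => y [cy Wy]; case: (H _ Wy) => O Oy sf.
by apply: Ck_sub (sf p k) => _ ->.
Qed.

Lemma smooth_cst W (c : R) : smooth W (fun _ => c).
Proof. by move=> p k; exact: Ck_cst. Qed.

Lemma smoothD W (f g : M -> R) : open W -> smooth W f -> smooth W g ->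
  smooth W (fun x => f x + g x).
Proof. by move=> oW sf sg p k; apply: Ck_D; [exact: chart_preim_open|exact: sf|exact: sg]. Qed.

Lemma smoothM W (f g : M -> R) : open W -> smooth W f -> smooth W g ->
  smooth W (fun x => f x * g x).
Proof. by move=> oW sf sg p k; apply: Ck_M; [exact: chart_preim_open|exact: sf|exact: sg]. Qed.

Lemma smoothN W (f : M -> R) : open W -> smooth W f -> smooth W (fun x => - f x).
Proof.
move=> oW sf; have := smoothM oW (smooth_cst W (-1)) sf.
by apply: smooth_congr => // x _; rewrite mulN1r.
Qed.

Lemma csmooth_sub W W' (f : M -> R[i]) : W' `<=` W -> csmooth W f -> csmooth W' f.
Proof. by move=> WW [a b]; split; exact: smooth_sub WW _. Qed.

Lemma csmooth_congr W (f g : M -> R[i]) : open W -> (forall x, W x -> f x = g x) ->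
  csmooth W f -> csmooth W g.
Proof.
by move=> oW fg [a b]; split; [apply: smooth_congr a | apply: smooth_congr b] => // x /fg ->.
Qed.

Lemma csmooth_local W (f : M -> R[i]) :
  (forall x, W x -> exists2 O, O x & csmooth (W `&` O) f) -> csmooth W f.
Proof.
by move=> H; split; apply: smooth_local => x /H; case=> O Ox [a b]; exists O.
Qed.

Lemma csmooth_cst W (c : R[i]) : csmooth W (fun _ => c).
Proof. by split; exact: smooth_cst. Qed.

Lemma csmoothM W (f g : M -> R[i]) : open W -> csmooth W f -> csmooth W g ->
  csmooth W (fun x => f x * g x).
Proof.
move=> oW [a b] [c d]; split.
  apply: smooth_congr (smoothD oW (smoothM oW a c) (smoothN oW (smoothM oW b d))) => //.
  by move=> x _; rewrite ReM.
apply: smooth_congr (smoothD oW (smoothM oW a d) (smoothM oW b c)) => //.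
by move=> x _; rewrite ImM.
Qed.

Lemma csmooth_conj W (f : M -> R[i]) : open W -> csmooth W f ->
  csmooth W (fun x => conjc (f x)).
Proof.
move=> oW [a b]; split; first by apply: smooth_congr a => // x _; case: (f x).
by apply: smooth_congr (smoothN oW b) => // x _; case: (f x).
Qed.

Lemma U1_neq0 W f x : U1 W f -> W x -> f x != 0.
Proof. by move=> [_ H] /H; exact: norm1_neq0. Qed.

Lemma U1_sub W W' f : W' `<=` W -> U1 W f -> U1 W' f.
Proof. by move=> WW [a b]; split=> [|x /WW]; [exact: csmooth_sub WW a | exact: b]. Qed.

Lemma U1_1 W : U1 W (fun _ => 1).
Proof. by split=> [|x _]; [exact: csmooth_cst | rewrite normr1]. Qed.

Lemma U1_M W f g : open W -> U1 W f -> U1 W g -> U1 W (fun x => f x * g x).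
Proof.
move=> oW [a b] [c d]; split; first exact: csmoothM.
by move=> x Wx; rewrite normrM b // d // mulr1.
Qed.

Lemma U1_V W f : open W -> U1 W f -> U1 W (fun x => (f x)^-1).
Proof.
move=> oW [a b]; split; last by move=> x Wx; rewrite normfV b // invr1.
by apply: csmooth_congr (csmooth_conj oW a) => // x /b /norm1_inv.
Qed.

Lemma U1_div W f g : open W -> U1 W f -> U1 W g -> U1 W (fun x => f x / g x).
Proof. by move=> oW a b; apply: U1_M => //; exact: U1_V. Qed.

Lemma dfun_congr W (f g : M -> R) x v : open W -> (forall x, W x -> f x = g x) ->
  W x -> dfun f x v = dfun g x v.
Proof.
move=> oW fg Wx; apply: near_eq_derive.
by apply: (near_chart oW fg); exact: chart_preim_self.
Qed.

Lemma smooth_differentiable W (f : M -> R) p y : smooth W f -> chart_preim W p y ->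
  differentiable (fun y => f (cinv (chart_at p) y)) y.
Proof. by move=> sf Wy; apply: (sf p 1%N).1. Qed.

Lemma dfun_derivable W (f : M -> R) x v : smooth W f -> W x ->
  derivable (fun y => f (cinv (chart_at x) y)) (cfun (chart_at x) x) v.
Proof.
move=> sf Wx; apply: diff_derivable; apply: smooth_differentiable sf _.
exact: chart_preim_self.
Qed.

Lemma dfun_cst (c : R) x v : dfun (fun _ : M => c) x v = 0.
Proof. exact: derive_cst. Qed.

Lemma dfunD W (f g : M -> R) x v : smooth W f -> smooth W g -> W x ->
  dfun (fun y => f y + g y) x v = dfun f x v + dfun g x v.
Proof. by move=> sf sg Wx; rewrite /dfun deriveD //; apply: (@dfun_derivable W). Qed.

Lemma dfunM W (f g : M -> R) x v : smooth W f -> smooth W g -> W x ->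
  dfun (fun y => f y * g y) x v = f x * dfun g x v + g x * dfun f x v.
Proof.
move=> sf sg Wx; rewrite /dfun deriveM //=; try exact: (@dfun_derivable W).
by rewrite !cinv_self.
Qed.

Lemma dfunN W (f : M -> R) x v : smooth W f -> W x ->
  dfun (fun y => - f y) x v = - dfun f x v.
Proof. by move=> sf Wx; rewrite /dfun deriveN //; apply: (@dfun_derivable W). Qed.

Lemma dfun_linear W (f : M -> R) x c u v : smooth W f -> W x ->
  dfun f x (c *: u + v) = c * dfun f x u + dfun f x v.
Proof.
move=> sf Wx; have df := smooth_differentiable sf (chart_preim_self Wx).
by rewrite /dfun !deriveE // linearP.
Qed.

Lemma transition_differentiable p q y : ccod (chart_at p) y ->
  cdom (chart_at q) (cinv (chart_at p) y) ->
  differentiable (fun z => cfun (chart_at q) (cinv (chart_at p) z)) y.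
Proof.
move=> cy dy; apply: differentiable_rV => j.
by have [H _] := chart_transition p q j 1%N; apply: H.
Qed.

Lemma cdom_open p : open (cdom (chart_at p)).
Proof. by case: (chart_atP p). Qed.

(** [dfun f] at a point is computed in the chart at that point, whereas [comp1] reads it in the
    chart at [p]. The chain rule reconciles them, the derivative of the transition map being exactly
    [tcoord]. *)
Lemma comp1_dfun W (f : M -> R) p y v : open W -> smooth W f -> chart_preim W p y ->
  comp1 (dfun f) p y v = 'D_v (fun z => f (cinv (chart_at p) z)) y.
Proof.
move=> oW sf [cy Wy]; set x := cinv (chart_at p) y.
pose tau z := cfun (chart_at x) (cinv (chart_at p) z).
have dtau : differentiable tau y by apply: transition_differentiable => //; exact: chart_at_dom.
have E : \near y, f (cinv (chart_at x) (tau y)) = f (cinv (chart_at p) y).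
  apply: (near_chart (W := cdom (chart_at x)) (P := fun z =>
     f (cinv (chart_at x) (cfun (chart_at x) z)) = f z)).
  - exact: cdom_open.
  - by move=> z dz; rewrite cinv_cfun.
  - by split=> //; exact: chart_at_dom.
rewrite -(near_eq_derive v E).
rewrite -[LHS]/('D_('D_v tau y) (fun z => f (cinv (chart_at x) z)) (tau y)).
rewrite -derive_comp //; apply: smooth_differentiable sf _.
exact: chart_preim_self.
Qed.

Lemma Cinfty_derive n (S : set 'rV[R]_n) f v : Cinfty S f -> Cinfty S ('D_v f).
Proof. by move=> sf k; exact: (sf k.+1).2. Qed.

Lemma smooth_form1_sub W W' (A : form1 M) : W' `<=` W -> smooth_form1 W A -> smooth_form1 W' A.
Proof.
move=> WW [l s]; split; first by move=> x /WW; exact: l.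
by move=> p v k; apply: Ck_sub (s p v k) => y [cy /WW].
Qed.

Lemma smooth_form1_congr W (A B : form1 M) : open W ->
  (forall x v, W x -> A x v = B x v) -> smooth_form1 W A -> smooth_form1 W B.
Proof.
move=> oW AB [l s]; split; first by move=> x Wx c u v; rewrite -!AB // l.
move=> p v k; apply: Ck_congr_on (s p v k) => y Wy.
near=> z; have [_ Wz] : chart_preim W p z.
  by near: z; apply: open_nbhs_nbhs; split; [exact: chart_preim_open|].
exact: AB.
Unshelve. all: by end_near. Qed.

Lemma smooth_form1D W (A B : form1 M) : open W -> smooth_form1 W A -> smooth_form1 W B ->
  smooth_form1 W (fun x v => A x v + B x v).
Proof.
move=> oW [l s] [l' s']; split; first by move=> x Wx c u v; rewrite l // l' //; ring.
by move=> p v k; apply: Ck_D; [exact: chart_preim_open|exact: s|exact: s'].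
Qed.

Lemma smooth_form1Z W (f : M -> R) (A : form1 M) : open W -> smooth W f -> smooth_form1 W A ->
  smooth_form1 W (fun x v => f x * A x v).
Proof.
move=> oW sf [l s]; split; first by move=> x Wx c u v; rewrite l //; ring.
by move=> p v k; apply: Ck_M; [exact: chart_preim_open|exact: sf|exact: s].
Qed.

Lemma smooth_form1N W (A : form1 M) : open W -> smooth_form1 W A ->
  smooth_form1 W (fun x v => - A x v).
Proof.
move=> oW sA; apply: smooth_form1_congr (smooth_form1Z oW (smooth_cst W (-1)) sA) => //.
by move=> x v _; rewrite mulN1r.
Qed.

Lemma smooth_form1_0 W : smooth_form1 W (fun (x : M) v => 0).
Proof.
split; first by move=> x _ c u v; rewrite mulr0 addr0.
by move=> p v k; exact: Ck_cst.
Qed.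

Lemma smooth_form1_dfun W f : open W -> smooth W f -> smooth_form1 W (dfun f).
Proof.
move=> oW sf; split; first by move=> x Wx c u v; exact: dfun_linear sf Wx.
move=> p v k; apply: Ck_congr_on (Cinfty_derive v (sf p) k) => y Wy.
near=> z; apply/esym; apply: (comp1_dfun _ oW sf).
by near: z; apply: open_nbhs_nbhs; split; [exact: chart_preim_open|].
Unshelve. all: by end_near. Qed.

Lemma comp1_differentiable W (A : form1 M) x v : smooth_form1 W A -> W x ->
  differentiable (fun y => comp1 A x y v) (cfun (chart_at x) x).
Proof. by move=> [_ s] Wx; apply: (s x v 1%N).1; exact: chart_preim_self. Qed.

Lemma dform1_congr W (A B : form1 M) x u v : open W ->
  (forall x v, W x -> A x v = B x v) -> W x -> dform1 A x u v = dform1 B x u v.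
Proof.
move=> oW AB Wx; have H w : \forall y \near cfun (chart_at x) x, comp1 A x y w = comp1 B x y w.
  near=> z; have [_ Wz] : chart_preim W x z.
    near: z; apply: open_nbhs_nbhs; split; first exact: chart_preim_open.
    exact: chart_preim_self.
  exact: AB.
by rewrite /dform1 (near_eq_derive u (H v)) (near_eq_derive v (H u)).
Unshelve. all: by end_near. Qed.

Lemma dform1D W (A B : form1 M) x u v : smooth_form1 W A -> smooth_form1 W B -> W x ->
  dform1 (fun x v => A x v + B x v) x u v = dform1 A x u v + dform1 B x u v.
Proof.
move=> sA sB Wx; have D C w w' (sC : smooth_form1 W C) := diff_derivable (v := w')
   (comp1_differentiable w sC Wx).
rewrite /dform1; rewrite (@deriveD _ _ _ (fun y => comp1 A x y v) (fun y => comp1 B x y v)); try exact: D.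
rewrite (@deriveD _ _ _ (fun y => comp1 A x y u) (fun y => comp1 B x y u)); try exact: D.
by rewrite opprD addrACA.
Qed.

Lemma dform1N W (A : form1 M) x u v : smooth_form1 W A -> W x ->
  dform1 (fun x v => - A x v) x u v = - dform1 A x u v.
Proof.
move=> sA Wx; have D C w w' (sC : smooth_form1 W C) := diff_derivable (v := w')
   (comp1_differentiable w sC Wx).
rewrite /dform1; rewrite (@deriveN _ _ _ (fun y => comp1 A x y v)); last exact: D.
rewrite (@deriveN _ _ _ (fun y => comp1 A x y u)); last exact: D.
by rewrite opprB opprK addrC.
Qed.

Lemma dform1_0 x u v : dform1 (fun (_ : M) _ => 0) x u v = 0.
Proof. by rewrite /dform1 /comp1 !derive_cst subrr. Qed.

Lemma dcfun_congr W (f g : M -> R[i]) x v : open W -> (forall x, W x -> f x = g x) ->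
  W x -> dcfun f x v = dcfun g x v.
Proof.
by move=> oW fg Wx; rewrite /dcfun; congr Complex; apply: (dfun_congr v oW _ Wx) => y /fg ->.
Qed.

Lemma dcfun_cst (c : R[i]) x v : dcfun (fun _ : M => c) x v = 0.
Proof. by rewrite /dcfun !dfun_cst. Qed.

Lemma dcfunD W (f g : M -> R[i]) x v : open W -> csmooth W f -> csmooth W g -> W x ->
  dcfun (fun y => f y + g y) x v = dcfun f x v + dcfun g x v.
Proof.
move=> oW [a b] [c d] Wx; apply: complexP; rewrite /dcfun /=.
  by rewrite -(dfunD v a c Wx); apply: (dfun_congr v oW _ Wx) => y _; rewrite ReD.
by rewrite -(dfunD v b d Wx); apply: (dfun_congr v oW _ Wx) => y _; rewrite ImD.
Qed.

Lemma dcfunM W (f g : M -> R[i]) x v : open W -> csmooth W f -> csmooth W g -> W x ->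
  dcfun (fun y => f y * g y) x v = dcfun f x v * g x + f x * dcfun g x v.
Proof.
move=> oW [a b] [c d] Wx; apply: complexP; rewrite /dcfun /=.
  rewrite (@dfun_congr W _ (fun y => complex.Re (f y) * complex.Re (g y) +
     - (complex.Im (f y) * complex.Im (g y)))) //; last by move=> y _; rewrite ReM.
  rewrite (@dfunD W) ?(@dfunN W) ?(@dfunM W) //;
   try (by apply: smoothM); try (by apply: smoothN => //; apply: smoothM).
  by rewrite ReD !ReM /=; ring.
rewrite (@dfun_congr W _ (fun y => complex.Re (f y) * complex.Im (g y) +
   (complex.Im (f y) * complex.Re (g y)))) //; last by move=> y _; rewrite ImM.
rewrite (@dfunD W) ?(@dfunM W) //; try (by apply: smoothM).
by rewrite ImD !ImM /=; ring.
Qed.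

Lemma dlog_congr W (f g : M -> R[i]) x v : open W -> (forall x, W x -> f x = g x) ->
  W x -> dlog f x v = dlog g x v.
Proof. by move=> oW fg Wx; rewrite /dlog (dcfun_congr v oW fg Wx) fg. Qed.

Lemma dlog1 x v : dlog (fun _ : M => 1) x v = 0.
Proof. by rewrite /dlog dcfun_cst mulr0 mul0r. Qed.

Lemma dlogM W f g x v : open W -> U1 W f -> U1 W g -> W x ->
  dlog (fun y => f y * g y) x v = dlog f x v + dlog g x v.
Proof.
move=> oW uf ug Wx; rewrite /dlog (dcfunM v oW uf.1 ug.1 Wx) -ReD; congr complex.Re.
have f0 := U1_neq0 uf Wx; have g0 := U1_neq0 ug Wx; have t0 := @twopii_neq0 R.
by field; rewrite f0 g0 t0.
Qed.

Lemma dlogV W f x v : open W -> U1 W f -> W x -> dlog (fun y => (f y)^-1) x v = - dlog f x v.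
Proof.
move=> oW uf Wx; apply/eqP; rewrite -addr_eq0 -(dlogM v oW (U1_V oW uf) uf Wx).
rewrite (@dlog_congr W _ (fun=> 1)) ?dlog1 // => y Wy.
by rewrite mulVf //; exact: U1_neq0 uf Wy.
Qed.

Lemma dlog_div W f g x v : open W -> U1 W f -> U1 W g -> W x ->
  dlog (fun y => f y / g y) x v = dlog f x v - dlog g x v.
Proof. by move=> oW uf ug Wx; rewrite (dlogM v oW uf (U1_V oW ug) Wx) (dlogV v oW ug Wx). Qed.

(** This is half the differential of |f|^2 = 1. *)
Lemma U1_orth W f x v : open W -> U1 W f -> W x ->
  complex.Re (f x) * dfun (fun y => complex.Re (f y)) x v +
  complex.Im (f x) * dfun (fun y => complex.Im (f y)) x v = 0.
Proof.
move=> oW [[sa sb] n1] Wx.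
have := dfun_cst 1 x v.
rewrite -(@dfun_congr W (fun y => complex.Re (f y) * complex.Re (f y) +
   complex.Im (f y) * complex.Im (f y))) //; last first.
  by move=> y Wy; rewrite -!expr2 norm1_sqr // n1.
rewrite (@dfunD W) ?(@dfunM W) //; try (by apply: smoothM).
by move=> H; apply: (mulfI (x := 2)); rewrite ?pnatr_eq0 // mulr0 -H; ring.
Qed.

(** By [U1_orth] the form f^-1 df is imaginary, so the real part in the definition of [dlog] loses
    nothing. *)
Lemma dcfun_U1 W f x v : open W -> U1 W f -> W x ->
  dcfun f x v = twopii R * ((dlog f x v)%:C)%C * f x.
Proof.
move=> oW uf Wx; have H := U1_orth v oW uf Wx; have [_ n1] := uf.
have f0 := U1_neq0 uf Wx; have t0 := @twopii_neq0 R.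
have -> : dcfun f x v = ((f x)^-1 * dcfun f x v / twopii R) * twopii R * f x.
  by field; rewrite f0 t0.
rewrite [twopii R * _]mulrC; congr (_ * _ * _); apply: complexP => //=.
rewrite (norm1_inv (n1 x Wx)).
have -> : conjc (f x) * dcfun f x v = Complex 0 (complex.Im (conjc (f x) * dcfun f x v)).
  by apply: complexP => //=; rewrite ReM /=; case: (f x) H => a b /= H; rewrite -H; ring.
set t := complex.Im (conjc _ * _); rewrite /twopii.
have p0 : (2 * pi : R) != 0 by rewrite mulf_neq0 ?pnatr_eq0 // gt_eqF // pi_gt0.
have -> : Complex 0 t / Complex 0 (2 * pi) = Complex (t / (2 * pi)) 0 :> R[i].
  apply: (mulIf t0); rewrite mulfVK //; apply: complexP; rewrite /= ?mulr0 ?mul0r ?addr0 ?subrr //.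
  by rewrite divfK.
by [].
Qed.

(** On the unit circle the inverse is the conjugate, which leaves the angular form. Being free of
    inverses, it can be differentiated by the product rule. *)
Lemma dlogE W f x v : U1 W f -> W x -> dlog f x v =
  (2 * pi)^-1 * (complex.Re (f x) * dfun (fun y => complex.Im (f y)) x v -
                 complex.Im (f x) * dfun (fun y => complex.Re (f y)) x v).
Proof.
move=> uf Wx; rewrite /dlog Re_div_twopii (norm1_inv (uf.2 x Wx)) ImM /=.
by case: (f x) => a b /=; ring.
Qed.

Lemma smooth_form1_dlog W f : open W -> U1 W f -> smooth_form1 W (dlog f).
Proof.
move=> oW uf; have [[sa sb] _] := uf.
apply: (@smooth_form1_congr W (fun x v => (2 * pi)^-1 * (complex.Re (f x) * dfun (fun y => complex.Im (f y)) x v +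
                 - (complex.Im (f x) * dfun (fun y => complex.Re (f y)) x v)))) => //.
  by move=> x v Wx; rewrite (dlogE v uf Wx).
apply: smooth_form1Z => //; first exact: smooth_cst.
apply: smooth_form1D => //; last apply: smooth_form1N => //.
  by apply: smooth_form1Z => //; exact: smooth_form1_dfun.
by apply: smooth_form1Z => //; exact: smooth_form1_dfun.
Qed.

Lemma derive_minor (V : normedModType R) (f g h k : V -> R) (c : R) (y w : V) :
  derivable f y w -> derivable g y w -> derivable h y w -> derivable k y w ->
  'D_w (fun z => c * (f z * g z - h z * k z)) y =
  c * (f y * 'D_w g y + g y * 'D_w f y - (h y * 'D_w k y + k y * 'D_w h y)).
Proof.
move=> df dg dh dk; have D1 := derivableM df dg; have D2 := derivableM dh dk.
have D3 := derivableB D1 D2.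
rewrite [LHS](deriveZ c D3) (deriveB D1 D2) (deriveM df dg) (deriveM dh dk).
by [].
Qed.

(** The vectors (au, bu) and (av, bv) of the plane are both orthogonal to the unit vector (A, B),
    hence proportional. *)
Lemma minor_eq0 (A B au bu av bv : R) : A ^+ 2 + B ^+ 2 = 1 ->
  A * au + B * bu = 0 -> A * av + B * bv = 0 -> au * bv - av * bu = 0.
Proof.
move=> n1 Hu Hv; rewrite -[LHS]mul1r -n1.
have -> : (A ^+ 2 + B ^+ 2) * (au * bv - av * bu) =
  (A * au + B * bu) * (A * bv - B * av) - (A * av + B * bv) * (A * bu - B * au) by ring.
by rewrite Hu Hv !mul0r subrr.
Qed.

(** [P] and [Q] stand for the two derivatives in [dform1 (dlog f)], with [X], [Y], [X'], [Y'] the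
    mixed second derivatives. These cancel and a multiple of the minor remains. *)
Lemma minor_cancel (c A B au bu av bv X Y X' Y' P Q : R) :
  P = c * (A * X + bv * au - (B * Y + av * bu)) ->
  Q = c * (A * X' + bu * av - (B * Y' + au * bv)) ->
  X = X' -> Y = Y' -> au * bv - av * bu = 0 -> P - Q = 0.
Proof.
move=> -> -> -> -> K.
have -> : c * (A * X' + bv * au - (B * Y' + av * bu)) -
   c * (A * X' + bu * av - (B * Y' + au * bv)) = c * (2 * (au * bv - av * bu)) by ring.
by rewrite K !mulr0.
Qed.

(* The second derivatives cancel by symmetry and, since |f| = 1, the covectors
   d(Re f) and d(Im f) are proportional. *)
Lemma dform1_dlog W f x u v : open W -> U1 W f -> W x -> dform1 (dlog f) x u v = 0.
Proof.
move=> oW uf Wx; have [[sa sb] _] := uf.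
pose y0 := cfun (chart_at x) x.
pose a z := complex.Re (f (cinv (chart_at x) z)).
pose b z := complex.Im (f (cinv (chart_at x) z)).
have Sy0 : chart_preim W x y0 := chart_preim_self Wx.
have oS := chart_preim_open (p := x) oW.
have nS : \near y0, chart_preim W x y0 by apply: open_nbhs_nbhs.
pose c := (2 * pi : R)^-1.
have E w : \forall z \near y0, comp1 (dlog f) x z w = c * (a z * 'D_w b z - b z * 'D_w a z).
  near=> z; have Sz : chart_preim W x z by near: z.
  have Ea : comp1 (dfun (fun y => complex.Re (f y))) x z w = 'D_w a z.
    exact: (comp1_dfun w oW sa Sz).
  have Eb : comp1 (dfun (fun y => complex.Im (f y))) x z w = 'D_w b z.
    exact: (comp1_dfun w oW sb Sz).
  by rewrite -Ea -Eb /comp1 (dlogE _ uf Sz.2).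
have da z : chart_preim W x z -> differentiable a z by exact: (smooth_differentiable sa).
have db z : chart_preim W x z -> differentiable b z by exact: (smooth_differentiable sb).
have dda w : differentiable ('D_w a) y0 by apply: (Cinfty_derive w (sa x) 1%N).1.
have ddb w : differentiable ('D_w b) y0 by apply: (Cinfty_derive w (sb x) 1%N).1.
have DE w w' : 'D_w (fun z => comp1 (dlog f) x z w') y0 =
   c * (a y0 * 'D_w ('D_w' b) y0 + 'D_w' b y0 * 'D_w a y0 -
                  (b y0 * 'D_w ('D_w' a) y0 + 'D_w' a y0 * 'D_w b y0)).
  rewrite (near_eq_derive w (E w')).
  apply: derive_minor; apply: diff_derivable.
  - exact: da.
  - exact: ddb.
  - exact: db.
  - exact: dda.
have Sa : 'D_u ('D_v a) y0 = 'D_v ('D_u a) y0.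
  have na : \near y0, differentiable a y0 by apply: filterS nS => z; exact: da.
  exact: (derive_comm na (dda v) (dda u)).
have Sb : 'D_u ('D_v b) y0 = 'D_v ('D_u b) y0.
  have nb : \near y0, differentiable b y0 by apply: filterS nS => z; exact: db.
  exact: (derive_comm nb (ddb v) (ddb u)).
have Hw w : a y0 * 'D_w a y0 + b y0 * 'D_w b y0 = 0.
  by have := U1_orth w oW uf Wx; rewrite -{1 3}(cinv_self x).
have n1 : a y0 ^+ 2 + b y0 ^+ 2 = 1.
  have fx : f (cinv (chart_at x) y0) = f x by rewrite cinv_self.
  rewrite /a /b fx; exact: norm1_sqr (uf.2 x Wx).
have K := minor_eq0 n1 (Hw u) (Hw v).
transitivity ('D_u (fun z => comp1 (dlog f) x z v) y0 - 'D_v (fun z => comp1 (dlog f) x z u) y0).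
  by [].
exact: (minor_cancel (DE u v) (DE v u) Sb Sa K).
Unshelve. all: by end_near. Qed.

End SmoothFunctions.

(** * Pull-back of functions along a smooth map *)

Section PullBack.
Variables (R : realType) (m n : nat) (M : manifold R m) (N : manifold R n).
Variables (Phi : M -> N) (sPhi : smooth_map Phi).

Lemma pull_open W : open W -> open (Phi @^-1` W).
Proof. by move=> oW; apply: open_comp => // x _; exact: sPhi.1. Qed.

Lemma smooth_pull W (f : N -> R) : open W -> smooth W f ->
  smooth (Phi @^-1` W) (fun x => f (Phi x)).
Proof.
move=> oW sf p k; apply/Ck_pointwise => y0 [cy Wy].
pose q := Phi (cinv (chart_at p) y0).
(* Near [y0] the image of [Phi] stays in a single chart domain of [N], where [f] after [Phi] is a
   composite of two coordinate maps; a germ suffices by [Ck_pointwise]. *)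
pose W' := W `&` cdom (chart_at q).
have oW' : open W' by apply: openI => //; exact: cdom_open.
pose S := chart_preim (Phi @^-1` W') p.
have oS : open S by apply: chart_preim_open; exact: pull_open.
pose tau z := cfun (chart_at q) (Phi (cinv (chart_at p) z)).
have tauk k' j : Ck k' S (fun z => tau z 0 j).
  by apply: Ck_sub (sPhi.2 p q j k') => z [cz [_ dz]].
apply: (@Ck_sub _ _ _ S); first by move=> _ ->; split=> //; split=> //; exact: chart_at_dom.
apply: (@Ck_congr_on _ _ _ _ ((fun z => f (cinv (chart_at q) z)) \o tau)).
  move=> y Sy; apply: (near_chart (W := Phi @^-1` W') (P := fun z =>
     f (cinv (chart_at q) (cfun (chart_at q) (Phi z))) = f (Phi z))) => //.
    exact: pull_open.
  by move=> z [_ dz]; rewrite cinv_cfun.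
apply: (@Ck_comp _ _ _ _ S (chart_preim W q)) => //; last exact: sf.
  move=> z [_ [Wz dz]]; split; last by rewrite cinv_cfun.
  by case: (chart_atP q) => _ _ /(_ _ dz)[].
move=> _ z; rewrite inE => Sz; apply: differentiable_continuous.
by apply: differentiable_rV => j; apply: (tauk 1%N j).1.
Qed.

Lemma csmooth_pull W (f : N -> R[i]) : open W -> csmooth W f ->
  csmooth (Phi @^-1` W) (fun x => f (Phi x)).
Proof. by move=> oW [a b]; split; [exact: (smooth_pull oW a)|exact: (smooth_pull oW b)]. Qed.

Lemma U1_pull W (f : N -> R[i]) : open W -> U1 W f -> U1 (Phi @^-1` W) (fun x => f (Phi x)).
Proof. by move=> oW [a b]; split=> [|x Wx]; [exact: csmooth_pull | exact: b]. Qed.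

Lemma dfun_pull W (f : N -> R) x v : open W -> smooth W f -> W (Phi x) ->
  dfun (fun x => f (Phi x)) x v = dfun f (Phi x) (tmap Phi x v).
Proof.
move=> oW sf Wx; pose q := Phi x; pose y0 := cfun (chart_at x) x.
pose tau z := cfun (chart_at q) (Phi (cinv (chart_at x) z)).
have ty : tau y0 = cfun (chart_at q) q by rewrite /tau cinv_self.
have dtau : differentiable tau y0.
  apply: differentiable_rV => j; apply: (sPhi.2 x q j 1%N).1; split; first exact: ccod_self.
  by rewrite cinv_self; exact: chart_at_dom.
have E : \forall z \near y0, f (cinv (chart_at q) (tau z)) = f (Phi (cinv (chart_at x) z)).
  apply: (near_chart (W := Phi @^-1` cdom (chart_at q)) (P := fun z =>
     f (cinv (chart_at q) (cfun (chart_at q) (Phi z))) = f (Phi z))) => //.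
  - by apply: pull_open; exact: cdom_open.
  - by move=> z dz; rewrite cinv_cfun.
  - by apply: chart_preim_self; exact: chart_at_dom.
rewrite /dfun -(near_eq_derive v E).
rewrite -[LHS]/('D_v ((fun z => f (cinv (chart_at q) z)) \o tau) y0).
rewrite derive_comp //; first by rewrite ty.
by rewrite ty; apply: smooth_differentiable sf _; exact: chart_preim_self.
Qed.

Lemma dcfun_pull W (f : N -> R[i]) x v : open W -> csmooth W f -> W (Phi x) ->
  dcfun (fun x => f (Phi x)) x v = dcfun f (Phi x) (tmap Phi x v).
Proof.
move=> oW [a b] Wx; rewrite /dcfun.
by rewrite -(dfun_pull v oW a Wx) -(dfun_pull v oW b Wx).
Qed.

End PullBack.

(** * Hermitian lines and unitary frames *)

Lemma linfun_linear (K : fieldType) (aT rT : vectType K) (f : aT -> rT) :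
  linear f -> forall v, linfun f v = f v.
Proof.
move=> lf v; pose g : {linear aT -> rT} := HB.pack f (GRing.isLinear.Build _ _ _ _ f lf).
exact: (lfunE g).
Qed.

Lemma scaler_inj (K : fieldType) (V : lmodType K) (v : V) (a b : K) : v != 0 ->
  a *: v = b *: v -> a = b.
Proof.
move=> v0 /eqP; rewrite -subr_eq0 -scalerBl scaler_eq0 (negPf v0) orbF subr_eq0.
by move=> /eqP.
Qed.

Section LineAlgebra.
Variable R : realType.
Implicit Types l a b : line R.

Lemma line_scale l (u e : l) : is_line l -> e != 0 -> exists c, u = c *: e.
Proof.
move=> [d1 _ _ _] e0; apply/vlineP.
have /eqP -> : <[e]>%VS == fullv by rewrite eqEdim subvf d1 dim_vline e0.
exact: memvf.
Qed.

Lemma lherm0 l (u : l) : is_line l -> lherm 0 u = 0.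
Proof.
move=> [_ lin _ _]; have := lin 1 0 0 u; rewrite scaler0 addr0 mul1r => /eqP.
by rewrite -subr_eq0 opprD addrA subrr sub0r oppr_eq0 => /eqP.
Qed.

Lemma lhermZ l c (u v : l) : is_line l -> lherm (c *: u) v = c * lherm u v.
Proof. by move=> hl; case: (hl) => _ lin _ _; rewrite -[c *: u]addr0 lin lherm0 // addr0. Qed.

Lemma lhermD l (u v w : l) : is_line l -> lherm (u + v) w = lherm u w + lherm v w.
Proof. by move=> [_ lin _ _]; rewrite -[u]scale1r lin mul1r scale1r. Qed.

Lemma lhermZr l c (u v : l) : is_line l -> lherm u (c *: v) = conjc c * lherm u v.
Proof.
move=> hl; case: (hl) => _ _ sym _; rewrite sym lhermZ // (sym v u).
by rewrite rmorphM /= conjcK.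
Qed.

Lemma lherm_neq0 l (e : l) : is_line l -> e != 0 -> lherm e e != 0.
Proof. by move=> [_ _ _ pos] /pos H; rewrite gt_eqF. Qed.

Lemma unit_neq0 l (e : l) : is_line l -> lherm e e = 1 -> e != 0.
Proof. by move=> hl H; apply/eqP => E; move: H; rewrite E lherm0 // => /eqP; rewrite eq_sym oner_eq0. Qed.

Lemma coefZl l c (u e : l) : is_line l -> coef (c *: u) e = c * coef u e.
Proof. by move=> hl; rewrite /coef lhermZ // mulrA. Qed.

Lemma coefZ l c (e : l) : is_line l -> e != 0 -> coef (c *: e) e = c.
Proof. by move=> hl e0; rewrite coefZl // /coef divff ?mulr1 // lherm_neq0. Qed.

Lemma coefD l (u v e : l) : is_line l -> coef (u + v) e = coef u e + coef v e.
Proof. by move=> hl; rewrite /coef lhermD // mulrDl. Qed.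

Lemma coef_refl l (e : l) : is_line l -> e != 0 -> coef e e = 1.
Proof. by move=> hl e0; rewrite -{1}[e]scale1r coefZ. Qed.

Lemma coefK l (u e : l) : is_line l -> e != 0 -> coef u e *: e = u.
Proof. by move=> hl e0; have [c ->] := line_scale u hl e0; rewrite coefZ. Qed.

Lemma coef_unit l (u e : l) : lherm e e = 1 -> coef u e = lherm u e.
Proof. by move=> H; rewrite /coef H divr1. Qed.

Lemma coefZr l c (u e : l) : is_line l -> e != 0 -> c != 0 -> coef u (c *: e) = c^-1 * coef u e.
Proof.
move=> hl e0 c0; have [d ->] := line_scale u hl e0.
rewrite [in RHS]coefZ // -[X in coef X]/(d *: e).
have -> : d *: e = (c^-1 * d) *: (c *: e) by rewrite scalerA mulrAC mulVf // mul1r.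
by rewrite coefZ // scaler_eq0 negb_or c0.
Qed.

Lemma coef_neq0 l (u e : l) : is_line l -> u != 0 -> e != 0 -> coef u e != 0.
Proof.
move=> hl u0 e0; apply/eqP => c0; move: u0.
by rewrite -(coefK u hl e0) c0 scale0r eqxx.
Qed.

Lemma dim1_neq0 l : is_line l -> lvec l != 0.
Proof.
move=> [d1 _ _ _]; rewrite /lvec vpick0; apply/eqP => E.
by move: d1; rewrite E dimv0.
Qed.

Lemma conjcM (x y : R[i]) : conjc (x * y) = conjc x * conjc y.
Proof. exact: rmorphM. Qed.
Lemma conjcV (x : R[i]) : conjc x^-1 = (conjc x)^-1.
Proof. exact: fmorphV. Qed.

Lemma dim_Hom1 (V W : vectType R[i]) : \dim {:V} = 1%N -> \dim {:W} = 1%N ->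
  \dim {: 'Hom(V, W)} = 1%N.
Proof. rewrite !dimvf => d1 d2; transitivity (dim V * dim W)%N => //; by rewrite d1 d2. Qed.

Lemma dualvE l (e v : l) : is_line l -> dualv e v = coef v e.
Proof.
move=> hl; rewrite /dualv linfun_linear // => c x y /=.
by rewrite coefD // coefZl.
Qed.

Lemma dual_scaleE l (e : l) c d : is_line l -> e != 0 ->
  ((c *: (dualv e : dual_line l)) : 'Hom(l, R[i]^o)) (d *: e) = c * d.
Proof.
move=> hl e0; rewrite lfunE /= linearZ /= dualvE // coef_refl //.
by rewrite /GRing.scale /= mulr1.
Qed.

Lemma lfun_zero l (V : vectType R[i]) (f : 'Hom(l, V)) (e : l) : is_line l -> e != 0 ->
  f e = 0 -> f = 0.
Proof.
move=> hl e0 fe; apply/lfunP => v; have [c ->] := line_scale v hl e0.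
by rewrite lfunE /= linearZ /= fe scaler0.
Qed.

Lemma dual_lineP l : is_line l -> is_line (dual_line l).
Proof.
move=> hl; have e0 := dim1_neq0 hl; have h0 := lherm_neq0 hl e0.
case: (hl) => d1 _ sym pos; split.
- by apply: dim_Hom1 => //; rewrite dimvf.
- move=> c u v w /=; rewrite !lfunE /= lfunE /= /GRing.scale /=; ring.
- move=> u v /=; rewrite !conjcM conjcV conjcK -sym; ring.
- move=> u u0 /=; apply: divr_gt0; last exact: pos.
  rewrite -normCK; apply: exprn_gt0; rewrite normr_gt0.
  by apply/eqP => H; move: u0; rewrite (lfun_zero hl e0 H) eqxx.
Qed.

Lemma dualv_neq0 l (e : l) : is_line l -> e != 0 -> dualv e != 0 :> dual_line l.
Proof.
move=> hl e0; apply/eqP => H; have : dualv e e = 0 by rewrite H lfunE.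
by rewrite dualvE // coef_refl // => /eqP; rewrite oner_eq0.
Qed.

Lemma dualvZ l c (e : l) : is_line l -> c != 0 -> e != 0 ->
  dualv (c *: e) = c^-1 *: dualv e :> dual_line l.
Proof.
move=> hl c0 e0; apply/lfunP => v; rewrite lfunE /= !dualvE // coefZr //.
Qed.

(** The metric of [dual_line] evaluates at the arbitrary vector [lvec l]. Rescaling that vector
    changes numerator and denominator alike, so it may be traded for [e]. *)
Lemma lherm_dualv l (e : l) : is_line l -> e != 0 ->
  lherm (dualv e : dual_line l) (dualv e) = (lherm e e)^-1.
Proof.
move=> hl e0 /=; rewrite !dualvE //; have g0 := dim1_neq0 hl.
have [c E] := line_scale (lvec l) hl e0; rewrite E in g0 *.
have c0 : c != 0 by apply: contraNneq g0 => ->; rewrite scale0r.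
rewrite coefZ // lhermZ // lhermZr //.
have h0 := lherm_neq0 hl e0; have cc0 : conjc c != 0 by rewrite fmorph_eq0.
by field; rewrite c0 cc0 h0.
Qed.

(** Two unit vectors differ by a scalar of modulus one, and dualizing inverts it, that is,
    conjugates it. *)
Lemma lherm_dualv_unit l (e f : l) : is_line l -> lherm e e = 1 -> lherm f f = 1 ->
  lherm (dualv e : dual_line l) (dualv f) = conjc (lherm e f).
Proof.
move=> hl e1 f1; have e0 := unit_neq0 hl e1; have f0 := unit_neq0 hl f1.
have hd := dual_lineP hl.
have [c E] := line_scale e hl f0; have c0 : c != 0.
  by apply: contraNneq e0 => c0; rewrite E c0 scale0r.
have cc : c * conjc c = 1 by rewrite -e1 E lhermZ // lhermZr // f1 mulr1.
rewrite E dualvZ // (lhermZ _ _ _ hd) lherm_dualv // lhermZ // f1 invr1 !mulr1.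
by apply: (mulfI c0); rewrite mulfV.
Qed.

Lemma tensvE a b (u : a) (v : b) (phi : dual_line b) : tensv u v phi = (phi v : R[i]) *: u.
Proof.
rewrite /tensv linfun_linear // => c x y /=.
by rewrite !lfunE /= lfunE /= scalerDl scalerA.
Qed.

Lemma tensvZ a b c d (u : a) (v : b) : tensv (c *: u) (d *: v) = (c * d) *: tensv u v :> tens_line a b.
Proof.
apply/lfunP => phi; rewrite lfunE /= !tensvE linearZ /= !scalerA.
by congr (_ *: _); rewrite linearZ /= /GRing.scale /=; ring.
Qed.

Lemma tens_lineP a b : is_line a -> is_line b -> is_line (tens_line a b).
Proof.
move=> ha hb; have hd := dual_lineP hb; have e0 := dim1_neq0 hd; have h0 := lherm_neq0 hd e0.
case: (hd) => d1 _ symd posd; case: (ha) => d1a lina syma posa; split.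
- exact: dim_Hom1.
- by move=> c u v w /=; rewrite !lfunE /= lfunE /= lina mulrDl mulrA.
- by move=> u v /=; rewrite conjcM conjcV -syma -symd.
- move=> u u0 /=; apply: divr_gt0; last exact: posd.
  apply: posa; apply: contraNneq u0 => H; apply/eqP.
  exact: (lfun_zero hd e0 H).
Qed.

(** As for the dual, the arbitrary vector in the definition of the metric of [tens_line] is a
    multiple of a dual basis vector, and the multiple cancels. *)
Lemma lherm_tensv a b (u u' : a) (v v' : b) : is_line a -> is_line b ->
  lherm (tensv u v : tens_line a b) (tensv u' v') = lherm u u' * lherm v v'.
Proof.
move=> ha hb; have hd := dual_lineP hb; have e0 := dim1_neq0 hb.
have de0 := dualv_neq0 hb e0; have g0 := dim1_neq0 hd.
rewrite [LHS]/=; have [c E] := line_scale (lvec (dual_line b)) hd de0; rewrite E in g0 *.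
have c0 : c != 0 by apply: contraNneq g0 => ->; rewrite scale0r.
have [x ->] := line_scale v hb e0; have [y ->] := line_scale v' hb e0.
rewrite !tensvE lhermZ // lhermZr // !lfunE /= !dualvE // !coefZ // coef_refl // lhermZ // lhermZr //.
have h0 := lherm_neq0 hb e0; have cc0 : conjc c != 0 by rewrite fmorph_eq0.
rewrite /GRing.scale /= !conjcM conjc1.
by field; rewrite c0 cc0 h0.
Qed.

Lemma tensv_neq0 a b (u : a) (v : b) : is_line a -> is_line b -> u != 0 -> v != 0 ->
  tensv u v != 0 :> tens_line a b.
Proof.
move=> ha hb u0 v0; apply/eqP => H.
have : lherm (tensv u v : tens_line a b) (tensv u v) = 0.
  by rewrite H lherm0 //; exact: tens_lineP.
by rewrite lherm_tensv // => /eqP; rewrite mulf_eq0 !(negPf (lherm_neq0 _ _)).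
Qed.

Lemma theta_lineP a b l : is_line a -> is_line b -> is_line l -> is_line (theta_line a b l).
Proof. by move=> ha hb hc; do 2![apply: tens_lineP => //]; exact: dual_lineP. Qed.

Lemma thetav_neq0 a b l (u : a) (v : b) (w : l) : is_line a -> is_line b -> is_line l ->
  u != 0 -> v != 0 -> w != 0 -> thetav u v w != 0.
Proof.
move=> ha hb hc u0 v0 w0; have hd := dual_lineP hb.
have ht := tens_lineP ha hd.
by apply: tensv_neq0 => //; apply: tensv_neq0 => //; exact: dualv_neq0.
Qed.

Lemma thetavZ a b l (u : a) (v : b) (w : l) x y z : is_line b -> v != 0 -> y != 0 ->
  thetav (x *: u) (y *: v) (z *: w) = (x / y * z) *: thetav u v w.
Proof. by move=> hb v0 y0; rewrite /thetav dualvZ // !tensvZ. Qed.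

Lemma psi_lineP a b l : is_line a -> is_line b -> is_line l -> is_line (psi_line a b l).
Proof. by move=> ha hb hc; do 2![apply: tens_lineP => //]; do ?exact: dual_lineP; do 2!apply: dual_lineP. Qed.

Lemma psiv_neq0 a b l (u : a) (v : b) (w : l) : is_line a -> is_line b -> is_line l ->
  u != 0 -> v != 0 -> w != 0 -> psiv u v w != 0.
Proof.
move=> ha hb hc u0 v0 w0; have hd := dual_lineP hb; have hda := dual_lineP ha.
have hdda := dual_lineP hda; have ht := tens_lineP hd hdda.
apply: tensv_neq0 => //; apply: tensv_neq0 => //; first exact: dualv_neq0.
by apply: dualv_neq0 => //; exact: dualv_neq0.
Qed.

(** The scalar of [v] is inverted by one dual; that of [u] passes through two duals and comes back
    unchanged. *)
Lemma psivZ a b l (u : a) (v : b) (w : l) x y z : is_line a -> is_line b ->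
  u != 0 -> v != 0 -> x != 0 -> y != 0 ->
  psiv (x *: u) (y *: v) (z *: w) = (y^-1 * x * z) *: psiv u v w.
Proof.
move=> ha hb u0 v0 x0 y0; have hda := dual_lineP ha.
rewrite /psiv (dualvZ ha x0 u0) (dualvZ hb y0 v0) (dualvZ hda) ?invr_eq0 ?dualv_neq0 //.
by rewrite invrK !tensvZ.
Qed.

End LineAlgebra.

(** * Unitary frames and connection forms *)

Section UnitaryFrames.
Variables (R : realType) (m : nat) (M : manifold R m).
Implicit Types (W O : set M) (L : lbundle M) (A : form1 M).

(* [s] is a unitary frame of [L] over the open set [W], in which the connection
   is d + 2 pi i A. *)
Definition uframe W L (s : section L) A : Prop :=
 [/\ open W,
     forall x, W x -> is_line (L x) /\ lherm (s x) (s x) = 1,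
     forall p, W p -> [/\ open (lb_dom L p), lb_dom L p p,
       forall x, W x -> lb_dom L p x -> lherm (lb_frame L p x) (lb_frame L p x) = 1
       & csmooth (W `&` lb_dom L p) (fun x => lherm (s x) (lb_frame L p x))]
   & forall O (f : M -> R[i]) (t : section L), open O -> O `<=` W -> csmooth O f ->
       (forall y, O y -> t y = f y *: s y) ->
       forall x v, O x ->
         lb_conn t x v = (dcfun f x v + twopii R * ((A x v)%:C)%C * f x) *: s x ].

Lemma uframe_sub W W' L (s : section L) A : open W' -> W' `<=` W ->
  uframe W s A -> uframe W' s A.
Proof.
move=> oW' WW [oW hl hd hc]; split => //.
- by move=> x /WW; exact: hl.
- move=> p Wp; have [a b c d] := hd p (WW _ Wp); split => // [x /WW|]; first exact: c.
  by apply: csmooth_sub d => x [/WW].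
- by move=> O f t oO /subset_trans OW; apply: hc => //; exact: OW.
Qed.

Lemma uframe_set0 L (s : section L) A : uframe set0 s A.
Proof. by split=> //; [exact: open0 | move=> O f t _ O0 _ _ x v /O0]. Qed.

Lemma lherm_trans (l : line R) (u v e : l) : is_line l -> lherm e e = 1 ->
  lherm u v = lherm u e * lherm e v.
Proof.
move=> hl e1; have e0 := unit_neq0 hl e1; have [c ->] := line_scale u hl e0.
by rewrite !lhermZ // e1 mulr1.
Qed.

Lemma uframe_neq0 W L (s : section L) A x : uframe W s A -> W x -> s x != 0.
Proof. by move=> [_ hl _ _] /hl[h1 h2]; exact: unit_neq0 h2. Qed.

Lemma uframe_scale W L (s : section L) A x (u : L x) : uframe W s A -> W x ->
  u = lherm u (s x) *: s x.
Proof.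
move=> uf Wx; have s0 := uframe_neq0 uf Wx; case: uf => _ /(_ _ Wx)[h1 h2] _ _.
by rewrite -coef_unit // coefK.
Qed.

Lemma norm1_lherm (l : line R) (e f : l) : is_line l -> lherm e e = 1 -> lherm f f = 1 ->
  `|lherm f e| = 1.
Proof.
move=> hl e1 f1; apply: conjc_norm1; case: (hl) => _ _ sym _.
by rewrite -sym -lherm_trans.
Qed.

(** The connections of [ldual], [ltens] and [lpull] and the curvature are defined through the stored
    frames [lb_frame]. This comparison carries them over to an arbitrary unitary frame. *)
Lemma uframe_frame W L (s : section L) A p : uframe W s A -> W p ->
  exists2 a : M -> R[i], U1 (W `&` lb_dom L p) a &
    forall x, W x -> lb_dom L p x -> lb_frame L p x = a x *: s x.
Proof.
move=> uf Wp; exists (fun x => lherm (lb_frame L p x) (s x)); last first.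
  by move=> x Wx _; exact: uframe_scale uf Wx.
case: uf => oW hl hd _; have [od dp f1 sm] := hd p Wp; have oI := openI oW od.
split; last first.
  by move=> x [Wx dx]; have [h1 h2] := hl x Wx; apply: norm1_lherm => //; exact: f1.
apply: csmooth_congr (csmooth_conj oI sm) => // x [Wx dx].
by have [[_ _ sym _] _] := hl x Wx; rewrite -sym.
Qed.

(** Both directions insert a unit vector into the Hermitian product: the coefficient against one
    frame is the coefficient against the other times a smooth transition function or its
    conjugate. *)
Lemma smooth_section_coef W W' L (s t : section L) A : uframe W s A -> open W' -> W' `<=` W ->
  smooth_section W' t <-> csmooth W' (fun x => lherm (t x) (s x)).
Proof.
move=> uf oW' WW; split=> H.
  apply: csmooth_local => x Wx; exists (lb_dom L x).
    by case: uf => _ _ /(_ _ (WW _ Wx))[].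
  have [oW hl /(_ _ (WW _ Wx))[od dx f1 sm] _] := uf.
  have oI := openI oW' od.
  have sm' : csmooth (W' `&` lb_dom L x) (fun y => lherm (s y) (lb_frame L x y)).
    by apply: csmooth_sub sm => y [/WW].
  apply: csmooth_congr (csmoothM oI (H x Wx) (csmooth_conj oI sm')) => // y [Wy dy].
  have [hy s1] := hl y (WW _ Wy); case: (hy) => _ _ sym _.
  by rewrite -sym -lherm_trans //; apply: f1 => //; exact: WW.
move=> q Wq; have [oW hl /(_ _ (WW _ Wq))[od dx f1 sm] _] := uf.
have oI := openI oW' od.
have sm' : csmooth (W' `&` lb_dom L q) (fun y => lherm (s y) (lb_frame L q y)).
  by apply: csmooth_sub sm => y [/WW].
have H' : csmooth (W' `&` lb_dom L q) (fun y => lherm (t y) (s y)) by apply: csmooth_sub H => y [].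
apply: csmooth_congr (csmoothM oI H' sm') => // y [Wy dy].
by have [hy s1] := hl y (WW _ Wy); rewrite -lherm_trans.
Qed.

Lemma unitary_section_coef W W' L (s t : section L) A (f : M -> R[i]) : uframe W s A -> open W' ->
  W' `<=` W -> (forall x, W' x -> t x = f x *: s x) -> unitary_section W' t <-> U1 W' f.
Proof.
move=> uf oW' WW tE; have [_ hl _ _] := uf.
have cE x : W' x -> lherm (t x) (s x) = f x.
  by move=> Wx; have [hx s1] := hl x (WW _ Wx); rewrite tE // lhermZ // s1 mulr1.
have nE x : W' x -> lherm (t x) (t x) = f x * conjc (f x).
  move=> Wx; have [hx s1] := hl x (WW _ Wx).
  by rewrite tE // lhermZ // lhermZr // s1 mulr1.
split=> [[/(smooth_section_coef _ uf oW' WW) sm n1]|[sm n1]].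
  split; first exact: csmooth_congr sm.
  by move=> x Wx; apply: conjc_norm1; rewrite -nE // n1.
split; last by move=> x Wx; rewrite nE // norm1_mulconj // n1.
by apply/(smooth_section_coef _ uf oW' WW); apply: csmooth_congr sm => // x /cE.
Qed.

(** For [f] of modulus one, nabla (f s) = 2 pi i (dlog f + A) f s, and neither f s nor 2 pi i
    vanishes. *)
Lemma parallel_coef W W' L (s t : section L) A (f : M -> R[i]) : uframe W s A -> open W' ->
  W' `<=` W -> U1 W' f -> (forall x, W' x -> t x = f x *: s x) ->
  parallel W' t <-> forall x v, W' x -> dlog f x v + A x v = 0.
Proof.
move=> uf oW' WW f1 tE; have [_ _ _ hc] := uf.
have E x v : W' x -> lb_conn t x v = (twopii R * ((dlog f x v + A x v)%:C)%C * f x) *: s x.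
  move=> Wx; rewrite (hc W' f t oW' WW f1.1 tE x v Wx) (dcfun_U1 v oW' f1 Wx).
  by congr (_ *: _); rewrite rmorphD /= -mulrDl -mulrDr.
split=> H x v Wx; last by rewrite E // H // mulr0 mul0r scale0r.
have := H x v Wx; rewrite E // => /eqP.
rewrite scaler_eq0 (negPf (uframe_neq0 uf (WW _ Wx))) orbF !mulf_eq0.
rewrite (negPf (twopii_neq0 R)) (negPf (U1_neq0 f1 Wx)) orbF /= => /eqP.
by move=> /(congr1 (@complex.Re R)).
Qed.

(** The dual connection is defined by the Leibniz rule for the pairing with the stored frame a s.
    The differential of [a] enters once through the pairing and once through nabla (a s), and
    cancels. *)
Lemma uframe_dual W L (s : section L) A : uframe W s A ->
  uframe W ((fun x => dualv (s x)) : section (ldual L)) (fun x v => - A x v).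
Proof.
move=> uf; have [oW hl hd hc] := uf; split => //.
- move=> x Wx; have [hx s1] := hl x Wx; split; first exact: dual_lineP.
  by rewrite lherm_dualv ?s1 ?invr1 //; exact: unit_neq0 s1.
- move=> p Wp; have [od dp f1 sm] := hd p Wp; split => //.
    move=> x Wx dx; have [hx s1] := hl x Wx.
    by rewrite lherm_dualv ?f1 ?invr1 //; apply: unit_neq0 => //; exact: f1.
  have oI := openI oW od; apply: csmooth_congr (csmooth_conj oI sm) => // x [Wx dx].
  by have [hx s1] := hl x Wx; rewrite lherm_dualv_unit //; exact: f1.
move=> O f t oO OW sf tE x v Ox /=; have Wx := OW _ Ox.
have [od dx f1 sm] := hd x Wx; have [a ua aE] := uframe_frame uf Wx.
pose O' := O `&` lb_dom L x; have oO' : open O' by exact: openI.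
have O'x : O' x by [].
have sub : O' `<=` W `&` lb_dom L x by move=> y [/OW].
have ua' := U1_sub sub ua; have sf' : csmooth O' f by apply: csmooth_sub sf => y [].
have [hx s1] := hl x Wx; have s0 := unit_neq0 hx s1; have a0 := U1_neq0 ua' O'x.
have -> : lb_conn (lb_frame L x) x v = (dcfun a x v + twopii R * ((A x v)%:C)%C * a x) *: s x.
  apply: (hc O' a _ oO' _ ua'.1 _ x v O'x); first by move=> y [/OW].
  by move=> y [/OW Wy dy]; exact: aE.
rewrite (@dcfun_congr _ _ _ O' _ (fun y => f y * a y)) //; last first.
  move=> y [Oy dy]; have [hy s1y] := hl y (OW _ Oy); have s0y := unit_neq0 hy s1y.
  rewrite tE // aE //; last exact: OW.
  exact: dual_scaleE.
rewrite (dcfunM v oO' sf' ua'.1 O'x).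
have tx d : (t x : 'Hom(L x, R[i]^o)) (d *: s x) = f x * d by rewrite tE //; exact: dual_scaleE.
rewrite tx; apply/lfunP => w; rewrite linfun_linear; last first.
  move=> c y z; rewrite coefD // coefZl // mulrDl /GRing.scale /=; ring.
have [d ->] := line_scale w hx s0.
rewrite [RHS](_ : _ = (dcfun f x v + twopii R * ((- A x v)%:C)%C * f x) * d); last exact: dual_scaleE.
rewrite (aE x) // coefZr // coefZ // rmorphN /=; by field.
Qed.

(** The tensor connection is defined by the Leibniz rule in the product of the stored frames a s and
    b s'. Rewriting a section in that product frame and differentiating back absorbs the
    differentials of [a] and [b]. *)
Lemma uframe_tens W L L' (s : section L) (s' : section L') A A' : uframe W s A -> uframe W s' A' ->
  uframe W ((fun x => tensv (s x) (s' x)) : section (ltens L L')) (fun x v => A x v + A' x v).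
Proof.
move=> uf uf'; have [oW hl hd hc] := uf; have [_ hl' hd' hc'] := uf'; split => //.
- move=> x Wx; have [hx s1] := hl x Wx; have [hx' s1'] := hl' x Wx; split; first exact: tens_lineP.
  by rewrite lherm_tensv // s1 s1' mulr1.
- move=> p Wp; have [od dp f1 sm] := hd p Wp; have [od' dp' f1' sm'] := hd' p Wp; split => //.
  + exact: openI.
  + move=> x Wx [dx dx']; have [hx s1] := hl x Wx; have [hx' s1'] := hl' x Wx.
    by rewrite lherm_tensv // f1 // f1' // mulr1.
  have oI : open (W `&` (lb_dom L p `&` lb_dom L' p)) by apply: openI => //; exact: openI.
  have sm2 : csmooth (W `&` (lb_dom L p `&` lb_dom L' p)) (fun x => lherm (s x) (lb_frame L p x)).
    by apply: csmooth_sub sm => x [? []].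
  have sm2' : csmooth (W `&` (lb_dom L p `&` lb_dom L' p)) (fun x => lherm (s' x) (lb_frame L' p x)).
    by apply: csmooth_sub sm' => x [? []].
  apply: csmooth_congr (csmoothM oI sm2 sm2') => // x [Wx _].
  by have [hx _] := hl x Wx; have [hx' _] := hl' x Wx; rewrite lherm_tensv.
move=> O f t oO OW sf tE x v Ox /=; have Wx := OW _ Ox.
have [od dx f1 sm] := hd x Wx; have [a ua aE] := uframe_frame uf Wx.
have [od' dx' f1' sm'] := hd' x Wx; have [b ub bE] := uframe_frame uf' Wx.
pose O' := O `&` (lb_dom L x `&` lb_dom L' x).
have oO' : open O' by apply: openI => //; exact: openI.
have O'x : O' x by [].
have ua' : U1 O' a by apply: U1_sub ua => y [/OW ? []].
have ub' : U1 O' b by apply: U1_sub ub => y [/OW ? []].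
have sf' : csmooth O' f by apply: csmooth_sub sf => y [].
have OW' : O' `<=` W by move=> y [/OW].
have [hx s1] := hl x Wx; have s0 := unit_neq0 hx s1; have a0 := U1_neq0 ua' O'x.
have [hx' s1'] := hl' x Wx; have s0' := unit_neq0 hx' s1'; have b0 := U1_neq0 ub' O'x.
have -> : lb_conn (lb_frame L x) x v = (dcfun a x v + twopii R * ((A x v)%:C)%C * a x) *: s x.
  by apply: (hc O' a _ oO' OW' ua'.1 _ x v O'x) => y [/OW Wy [dy _]]; exact: aE.
have -> : lb_conn (lb_frame L' x) x v = (dcfun b x v + twopii R * ((A' x v)%:C)%C * b x) *: s' x.
  by apply: (hc' O' b _ oO' OW' ub'.1 _ x v O'x) => y [/OW Wy [_ dy]]; exact: bE.
have oc := U1_M oO' ua' ub'; have oci := U1_V oO' oc.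
(* The coefficient of [t] in the product of the stored frames. *)
pose g y := f y * (a y * b y)^-1.
have sg : csmooth O' g by apply: csmoothM => //; exact: oci.1.
have gE y : O' y -> coef (t y) (tensv (lb_frame L x y) (lb_frame L' x y)) = g y.
  move=> O'y; have [Oy [dy dy']] := O'y; have Wy := OW _ Oy.
  have [hy sy1] := hl y Wy; have [hy' sy1'] := hl' y Wy.
  have st0 : tensv (s y) (s' y) != 0 :> tens_line (L y) (L' y).
    by apply: tensv_neq0 => //; [exact: unit_neq0 sy1|exact: unit_neq0 sy1'].
  have ht := tens_lineP hy hy'.
  rewrite tE // aE // bE // tensvZ coefZr //; last exact: U1_neq0 oc O'y.
  by rewrite coefZ // /g mulrC.
rewrite (dcfun_congr v oO' gE O'x) gE //.
rewrite (aE x) // (bE x) // !tensvZ.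
have fE : dcfun f x v = dcfun g x v * (a x * b x) + g x * (dcfun a x v * b x + a x * dcfun b x v).
  rewrite -(dcfunM v oO' ua'.1 ub'.1 O'x) -(dcfunM v oO' sg oc.1 O'x).
  apply: (dcfun_congr v oO' _ O'x) => y O'y; rewrite /g mulfVK //; exact: U1_neq0 oc O'y.
have -> : f x = g x * (a x * b x) by rewrite /g mulfVK // mulf_neq0.
rewrite fE -!scalerDl !scalerA -!scalerDl; congr (_ *: _).
rewrite rmorphD /=; ring.
Qed.

(** Differentiating [lherm s s = 1] by metric compatibility makes the product of nabla s with s
    imaginary. Divided by 2 pi i it is real, so [conn_form], which keeps only a real part,
    determines nabla s. *)
Lemma uframe_is_lb W L p : open W -> is_lb W L -> W p ->
  let W' := W `&` lb_dom L p in
  uframe W' (lb_frame L p) (conn_form (lb_frame L p)) /\ smooth_form1 W' (conn_form (lb_frame L p)).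
Proof.
move=> oW [[hl hd f1 sm] hc] Wp W'; have [odp dpp] := hd p Wp.
have oW' : open W' by exact: openI.
have W'W : W' `<=` W by move=> x [].
pose s := lb_frame L p.
have s1 x : W' x -> lherm (s x) (s x) = 1 by move=> [Wx dx]; exact: f1.
have sms O : O `<=` W' -> smooth_section O s.
  move=> OW q Oq; have [Wq _] := OW _ Oq; apply: csmooth_sub (sm p q Wp Wq) => x [/OW[? ?] ?].
  by split.
have nE x v : W' x -> lb_conn s x v = (twopii R * ((conn_form s x v)%:C)%C) *: s x.
  move=> W'x; have [c1 c2 c3 [c4 c5 c6]] := hc W' oW' W'W s s (sms _ (fun _ h => h)) (sms _ (fun _ h => h)).
  have hx := hl x (W'W _ W'x); have s0 := unit_neq0 hx (s1 x W'x).
  rewrite -[LHS](coefK _ hx s0) coef_unit ?s1 //; congr (_ *: _).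
  have := c6 x v W'x; rewrite (dcfun_congr v oW' s1 W'x) dcfun_cst.
  case: (hx) => _ _ sym _; rewrite (sym (s x) (lb_conn s x v)) => H.
  rewrite /conn_form; set h := lherm _ _ in H *.
  have -> : ((complex.Re (h / twopii R))%:C)%C = h / twopii R.
    apply: complexP => //; rewrite Im_div_twopii /=.
    move: H => /(congr1 (@complex.Re R)); rewrite ReD; case: h => a b /= H.
    have -> : a = 0 by lra.
    by rewrite mul0r oppr0.
  by rewrite mulrC divfK ?twopii_neq0.
split.
  split => //.
  - by move=> x W'x; split; [exact: hl (W'W _ W'x)|exact: s1].
  - move=> q W'q; have Wq := W'W _ W'q; have [odq dqq] := hd q Wq; split => //.
      by move=> x W'x dx; apply: f1 => //; exact: W'W.
    by apply: csmooth_sub (sm p q Wp Wq) => x [[Wx dx] dx'].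
  move=> O f t oO OW' sf tE x v Ox.
  have OW : O `<=` W := subset_trans OW' W'W.
  have sfs : smooth_section O ((fun y => f y *: s y) : section L).
    move=> q Oq; have Wq := OW _ Oq; have [odq dqq] := hd q Wq; have oI := openI oO odq.
    have sf' : csmooth (O `&` lb_dom L q) f by apply: csmooth_sub sf => y [].
    apply: csmooth_congr (csmoothM oI sf' (sms O OW' q Oq)) => // y [Oy dy].
    by rewrite lhermZ //; exact: hl (OW _ Oy).
  have st : smooth_section O t.
    move=> q Oq; have Wq := OW _ Oq; have [odq dqq] := hd q Wq; have oI := openI oO odq.
    by apply: csmooth_congr (sfs q Oq) => // y [Oy dy]; rewrite tE.
  have [c1 _ _ _] := hc O oO OW t _ st sfs.
  have [_ _ c3 _] := hc O oO OW s s (sms O OW') (sms O OW').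
  rewrite (c1 tE x v Ox) (c3 f sf x v Ox) nE; last exact: OW'.
  by rewrite scalerA -scalerDl; congr (_ *: _); ring.
have [_ _ _ [_ c5 _]] := hc W' oW' W'W s s (sms _ (fun _ h => h)) (sms _ (fun _ h => h)).
have W'p : W' p by [].
have [_ im] := c5 p W'p.
have im' : smooth_form1 W' (fun x v => complex.Im (lherm (lb_conn s x v) (s x))).
  by apply: smooth_form1_sub im => x W'x; split=> //; case: W'x.
apply: smooth_form1_congr (smooth_form1Z oW' (smooth_cst W' (2 * pi)^-1) im') => // x v _.
by rewrite /conn_form Re_div_twopii mulrC.
Qed.

(** The alternative is the one delivered by the trivializing refinement: a nonempty set lies in the
    domain of one stored frame, while over the empty set the zero section serves as a dummy
    frame. *)
Lemma uframe_exists W W' L : open W -> is_lb W L -> open W' -> W' `<=` W ->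
  W' = set0 \/ (exists2 p, W p & W' `<=` lb_dom L p) ->
  exists (s : section L) (A : form1 M), uframe W' s A /\ smooth_form1 W' A.
Proof.
move=> oW hL oW' WW [->|[p Wp Wd]].
  exists (fun x => 0), (fun x v => 0); split; first exact: uframe_set0.
  exact: smooth_form1_0.
have [u sA] := uframe_is_lb oW hL Wp.
have sub : W' `<=` W `&` lb_dom L p by move=> x W'x; split; [exact: WW|exact: Wd].
exists (lb_frame L p), (conn_form (lb_frame L p)); split; first exact: uframe_sub u.
exact: smooth_form1_sub sA.
Qed.

(** The gauge transformation law: nabla t is computed once as nabla (f s) and once in the frame [t]
    itself, with coefficient 1, and the two results are compared. *)
Lemma uframe_change W L (s t : section L) A B : uframe W s A -> uframe W t B ->
  exists f : M -> R[i], [/\ U1 W f, forall x, W x -> t x = f x *: s x &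
    forall x v, W x -> B x v = A x v + dlog f x v].
Proof.
move=> us ut; have [oW hs _ hcs] := us; have [_ ht _ hct] := ut.
pose f x := lherm (t x) (s x); have tE x : W x -> t x = f x *: s x.
  by move=> Wx; exact: uframe_scale us Wx.
have ss : unitary_section W t.
  by apply/(unitary_section_coef (f := fun=> 1) ut oW) => // [x _|]; [rewrite scale1r|exact: U1_1].
have uf : U1 W f by apply/(unitary_section_coef us oW _ tE).1.
exists f; split => // x v Wx.
have E1 := hcs W f t oW (fun _ h => h) uf.1 tE x v Wx.
have E2 : lb_conn t x v = (dcfun (fun=> 1) x v + twopii R * ((B x v)%:C)%C * 1) *: t x.
  apply: (hct W (fun=> 1) t oW (fun _ h => h) (csmooth_cst _ _) _ x v Wx).
  by move=> y _; rewrite scale1r.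
move: E2; rewrite {}E1 dcfun_cst add0r mulr1 tE // scalerA (dcfun_U1 v oW uf Wx) => /eqP.
rewrite -subr_eq0 -scalerBl scaler_eq0 (negPf (uframe_neq0 us Wx)) orbF -!mulrDl -mulrBl.
rewrite mulf_eq0 (negPf (U1_neq0 uf Wx)) orbF -mulrDr -mulrBr mulf_eq0.
rewrite (negPf (twopii_neq0 R)) /= -rmorphD -rmorphB /= => /eqP.
move=> /(congr1 (@complex.Re R)) /= /eqP; rewrite subr_eq0 => /eqP <-.
by rewrite addrC.
Qed.

(** [curv] at [x] uses the stored frame at [x], whose connection form is A + dlog a; the second
    summand is closed by [dform1_dlog]. *)
Lemma curv_uframe W L (s : section L) A x u v : uframe W s A -> smooth_form1 W A -> W x ->
  curv L x u v = dform1 A x u v.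
Proof.
move=> uf sA Wx; have [oW hl hd hc] := uf; have [od dx f1 sm] := hd x Wx.
have [a ua aE] := uframe_frame uf Wx; have oI := openI oW od.
have sA' : smooth_form1 (W `&` lb_dom L x) A by apply: smooth_form1_sub sA => y [].
rewrite /curv (@dform1_congr _ _ _ (W `&` lb_dom L x) _ (fun y w => A y w + dlog a y w)) //.
  rewrite (dform1D _ _ sA' (smooth_form1_dlog oI ua)) //.
  by rewrite (dform1_dlog _ _ oI ua) // addr0.
move=> y w [Wy dy]; rewrite /conn_form.
rewrite (hc (W `&` lb_dom L x) a _ oI _ ua.1 _ y w) //; last first.
  by move=> z [Wz dz]; exact: aE.
have [hy s1] := hl y Wy; have uy : (W `&` lb_dom L x) y by [].
rewrite (dcfun_U1 w oI ua uy) aE // lhermZ // lhermZr // s1 mulr1.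
have -> : (twopii R * ((dlog a y w)%:C)%C * a y + twopii R * ((A y w)%:C)%C * a y) * conjc (a y)
   / twopii R = ((dlog a y w + A y w)%:C)%C.
  have H := norm1_mulconj (ua.2 y uy); have t0 := twopii_neq0 R.
  rewrite -mulrDl -mulrDr -rmorphD /= -(mulrA _ (a y)) H mulr1.
  by rewrite mulrC mulKf.
by rewrite /= addrC.
Qed.

End UnitaryFrames.

Section PulledFrames.
Variables (R : realType) (m n : nat) (M : manifold R m) (N : manifold R n).
Variables (Phi : M -> N) (sPhi : smooth_map Phi).

(** The pulled back connection is defined on multiples of a stored frame pulled back from [N].
    Passing to the frame [s] costs the differential of a pulled back function, which [dcfun_pull]
    evaluates through [tmap]. *)
Lemma uframe_pull W (L : lbundle N) (s : section L) A : uframe W s A ->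
  uframe (Phi @^-1` W) ((fun x => s (Phi x)) : section (lpull Phi L)) (pull1 Phi A).
Proof.
move=> uf; have [oW hl hd hc] := uf; have oPW := pull_open sPhi oW; split => //.
- by move=> x Wx; exact: hl.
- move=> p Wp; have [od dp f1 sm] := hd _ Wp; split => //.
  + exact: pull_open.
  + by move=> x Wx dx; exact: f1.
  exact: (csmooth_pull sPhi (openI oW od) sm).
move=> O f t oO OW sf tE x v Ox /=; have Wx := OW _ Ox.
have [od dx f1 sm] := hd _ Wx; have [a ua aE] := uframe_frame uf Wx.
have oI := openI oW od.
pose O' := O `&` Phi @^-1` (lb_dom L (Phi x)).
have oO' : open O' by apply: openI => //; exact: pull_open.
have O'x : O' x by [].
have ua' : U1 O' (fun y => a (Phi y)).
  by apply: U1_sub (U1_pull sPhi oI ua) => y [/OW ? ?].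
have sf' : csmooth O' f by apply: csmooth_sub sf => y [].
have [hx s1] := hl _ Wx; have s0 := unit_neq0 hx s1; have a0 := U1_neq0 ua' O'x.
have -> : lb_conn (lb_frame L (Phi x)) (Phi x) (tmap Phi x v) =
  (dcfun a (Phi x) (tmap Phi x v) + twopii R * ((pull1 Phi A x v)%:C)%C * a (Phi x)) *: s (Phi x).
  apply: (hc (W `&` lb_dom L (Phi x)) a _ oI _ ua.1 _ (Phi x)) => //.
  by move=> y [Wy dy]; exact: aE.
have uai := U1_V oO' ua'.
pose g y := f y * (a (Phi y))^-1.
have sg : csmooth O' g by apply: csmoothM => //; exact: uai.1.
have gE y : O' y -> coef (t y) (lb_frame L (Phi x) (Phi y)) = g y.
  move=> O'y; have [Oy dy] := O'y; have Wy := OW _ Oy; have [hy sy1] := hl _ Wy.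
  rewrite tE // (aE (Phi y)) // coefZr ?(unit_neq0 hy sy1) //; last exact: U1_neq0 ua' O'y.
  by rewrite coefZ ?(unit_neq0 hy sy1) // /g mulrC.
rewrite (dcfun_congr v oO' gE O'x) gE // (aE (Phi x)) //.
rewrite -(dcfun_pull sPhi v oI ua.1) //.
have fE : dcfun f x v = dcfun g x v * a (Phi x) + g x * dcfun (fun y => a (Phi y)) x v.
  rewrite -(dcfunM v oO' sg ua'.1 O'x).
  by apply: (dcfun_congr v oO' _ O'x) => y O'y; rewrite /g mulfVK //; exact: U1_neq0 ua' O'y.
have -> : f x = g x * a (Phi x) by rewrite /g mulfVK.
rewrite fE !scalerA -scalerDl; congr (_ *: _); ring.
Qed.

End PulledFrames.

(** * Refinements trivializing double intersections *)

Section Topology.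

(** Every [x] receives a basic open set inside [O x], and one point is kept for each basic set that
    occurs. Enumerating the basis enumerates the kept points. *)
Lemma second_countable_lindelof (T : topologicalType) (O : T -> set T) :
  @second_countable T -> (forall x, nbhs x (O x)) ->
  exists (S : set T) (e : T -> nat), {in S &, injective e} /\
    forall x, exists2 s, S s & O s x.
Proof.
move=> [B /countable_injP[c cinj] [Bo Bb]] On.
have /choice[b bP] x : exists U, [/\ B U, U x & U `<=` O x].
  by have [U [BU Ux] UO] := Bb x (O x) (On x); exists U.
(* A chosen point with basic set [U]. The value [x] is a default for [U] outside the image of [b];
   on the image the choice does not depend on it. *)
pose H U x := match pselect (exists y, b y = U) with
  | left p => sval (cid p) | right _ => x end.
have Hb U x : (exists y, b y = U) -> b (H U x) = U.
  by rewrite /H => bU; case: pselect => // p; case: cid.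
have HE U x x' : (exists y, b y = U) -> H U x = H U x'.
  by rewrite /H => bU; case: pselect.
exists [set x | H (b x) x = x], (c \o b); split.
  move=> x x'; rewrite !inE /= => Hx Hx' /cinj bE.
  have {}bE : b x = b x' by apply: bE; rewrite inE; [case: (bP x)|case: (bP x')].
  by rewrite -Hx -Hx' -bE; apply: HE; exists x.
move=> x; have bx : exists y, b y = b x by exists x.
exists (H (b x) x); first by rewrite /= Hb //; exact: HE.
by have [_ _] := bP (H (b x) x); apply; rewrite Hb //; case: (bP x).
Qed.

(** A closed ball in a chart gives a compact neighbourhood of [x], and compact neighbourhoods in a
    Hausdorff space provide small closed neighbourhoods. *)
Lemma manifold_regular (R : realType) m (M : manifold R m) (x : M) (W : set M) :
  open W -> W x -> exists A, [/\ open A, A x & closure A `<=` W].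
Proof.
move=> oW Wx; pose y0 := cfun (chart_at x) x.
have : nbhs y0 (chart_preim W x).
  by apply: open_nbhs_nbhs; split; [exact: chart_preim_open|exact: chart_preim_self].
move=> /nbhs_ballP[r /= r0 rW]; have r20 : 0 < r / 2 by rewrite divr_gt0.
pose K := closed_ball y0 (r / 2).
have KW : K `<=` chart_preim W x.
  apply: subset_trans rW => y; rewrite /K closed_ballE // /closed_ball_ /= => yr.
  rewrite -ball_normE /=; apply: le_lt_trans yr _.
  by rewrite ltr_pdivrMr // ltr_pMr // ltr1n.
have cK : compact K.
  apply: bounded_closed_compact; last exact: closed_ball_closed.
  exists (`|y0| + r / 2); split; first by rewrite num_real.
  move=> t tr y; rewrite /K closed_ballE // /closed_ball_ /= => yr.
  apply: le_trans (ltW tr); rewrite -[y](subrK y0) addrC -(opprB y0 y).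
  by rewrite (le_trans (ler_normB _ _)) // lerD2l.
have [oc _ cc1 cc2] := chart_atP x.
have cV : compact (cinv (chart_at x) @` K).
  apply: continuous_compact => //; apply: continuous_in_subspaceT => y.
  by rewrite inE => /KW[/cc2[]].
have nV : nbhs x (cinv (chart_at x) @` K).
  have [_ _ cx] := cc1 x (chart_at_dom x).
  have nK : nbhs y0 K by apply/nbhs_ballP; exists (r / 2) => //; exact: subset_closed_ball.
  have nU : nbhs x (cdom (chart_at x) `&` cfun (chart_at x) @^-1` K).
    apply: filterI; last exact: (cx K nK).
    by apply: open_nbhs_nbhs; split=> //; exact: chart_at_dom.
  apply: filterS nU => z [dz Kz].
  by exists (cfun (chart_at x) z); last exact: cinv_cfun.
have reg := compact_regular (@manifold_hausdorff _ _ M) cV nV.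
have [B Bx BW] := reg W (open_nbhs_nbhs (conj oW Wx)).
exists B°; split; [exact: open_interior | by [] |].
by apply: subset_trans BW; apply: closureS; exact: interior_subset.
Qed.

End Topology.

(** * Refinements of pairs of covers *)

Section Refinements.
Variables (R : realType) (m n : nat) (M : manifold R m) (N : manifold R n).
Variables (Phi : M -> N).

Lemma r_commE (c' c : covpair Phi) (r : refinement c' c) i : cr (rI r i) = rJ r (cr i).
Proof. by have := congr1 (fun f : cI c' -> cJ c => f i) (r_comm r). Qed.

Lemma refinement_comp_comm (c c' c'' : covpair Phi) (r : refinement c' c) (s : refinement c'' c') :
  (fun i => cr (rI r (rI s i))) = (fun i => rJ r (rJ s (cr i))).
Proof. by apply/funext => i; rewrite !r_commE. Qed.

Definition refinement_comp (c c' c'' : covpair Phi) (r : refinement c' c) (s : refinement c'' c') :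
    refinement c'' c :=
  @Refinement _ _ _ _ _ _ c'' c (fun i => rI r (rI s i)) (fun j => rJ r (rJ s j))
    (fun i x h => rIP r (rIP s h)) (fun j y h => rJP r (rJP s h)) (refinement_comp_comm r s).

Definition refinement_id (c : covpair Phi) : refinement c c :=
  @Refinement _ _ _ _ _ _ c c (fun i => i) (fun j => j) (fun i x h => h) (fun j y h => h) erefl.

Lemma refinement_eq (c' c : covpair Phi) (r s : refinement c' c) :
  rI r = rI s -> rJ r = rJ s -> r = s.
Proof.
case: r s => [a b p1 p2 p3] [a' b' q1 q2 q3] /= ea eb; subst a' b'.
by rewrite (Prop_irrelevance p1 q1) (Prop_irrelevance p2 q2) (Prop_irrelevance p3 q3).
Qed.

Lemma common_refinement (c1 c2 : covpair Phi) :
  exists c (r1 : refinement c c1) (r2 : refinement c c2), True.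
Proof.
have oU (i : cI c1 * cI c2) : open (cU i.1 `&` cU i.2) by apply: openI; exact: cU_open.
have oV (i : cJ c1 * cJ c2) : open (cV i.1 `&` cV i.2) by apply: openI; exact: cV_open.
have cvU x : exists i : cI c1 * cI c2, (cU i.1 `&` cU i.2) x.
  by have [i ix] := cU_cover c1 x; have [i' ix'] := cU_cover c2 x; exists (i, i').
have cvV x : exists i : cJ c1 * cJ c2, (cV i.1 `&` cV i.2) x.
  by have [i ix] := cV_cover c1 x; have [i' ix'] := cV_cover c2 x; exists (i, i').
have crP' (i : cI c1 * cI c2) x : (cU i.1 `&` cU i.2) x ->
    (cV (cr i.1, cr i.2).1 `&` cV (cr i.1, cr i.2).2) (Phi x).
  by move=> [/crP ? /crP].
pose c := @CovPair _ _ _ _ _ Phi _ _ _ _ (fun i : cI c1 * cI c2 => (cr i.1, cr i.2)) oU oV cvU cvV crP'.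
exists c, (@Refinement _ _ _ _ _ _ c c1 fst fst (fun i x h => h.1) (fun i x h => h.1) erefl).
by exists (@Refinement _ _ _ _ _ _ c c2 snd snd (fun i x h => h.2) (fun i x h => h.2) erefl).
Qed.

(* Both covers are made countable, each with a numbered family of open sets A
   whose closures lie in members of the cover, and the new open sets are indexed
   by pairs (centre, A).  On the pair (y, A) one imposes finitely many conditions,
   one for each A' not after A: lying in D(y) if y is in the closure of A', and
   avoiding that closure otherwise.  If two new open sets meet, the centre of the
   later one is thus in the closure of the A of the other.  Keeping the centre and
   A independent makes the index maps of the two covers commute on the nose. *)
Lemma trivializing_refinement (c : covpair Phi) (D : cJ c -> cJ c -> N -> set N)
    (E : cI c -> M -> set M) : smooth_map Phi ->
  (forall j j' y, cV j y -> cV j' y -> open (D j j' y) /\ D j j' y y) ->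
  (forall i x, cU i x -> open (E i x) /\ E i x x) ->
  exists (c' : covpair Phi) (r : refinement c' c),
    (forall k k', V2 (@cV _ _ _ _ _ _ c') k k' = set0 \/
       exists2 p, V2 (@cV _ _ _ _ _ _ c) (rJ r k) (rJ r k') p &
         V2 (@cV _ _ _ _ _ _ c') k k' `<=` D (rJ r k) (rJ r k') p) /\
    (forall i, cU i = set0 \/ exists2 x, cU (rI r i) x & cU i `<=` E (rI r i) x).
Proof.
move=> sPhi hD hE.
have /choice[jN jNP] := cV_cover c; have /choice[iM iMP] := cU_cover c.
have /choice[A AP] y : exists A, [/\ open A, A y & closure A `<=` cV (jN y)].
  by apply: manifold_regular; [exact: cV_open|exact: jNP].
have /choice[B BP] x : exists B, [/\ open B, B (Phi x) & closure B `<=` cV (cr (iM x))].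
  by apply: manifold_regular; [exact: cV_open|apply: crP; exact: iMP].
have [SN [eN [eNinj SNc]]] : exists (S : set N) (e : N -> nat), {in S &, injective e} /\
    forall x, exists2 s, S s & A s x.
  apply: second_countable_lindelof; first exact: manifold_second_countable.
  by move=> y; apply: open_nbhs_nbhs; case: (AP y).
have [SM [eM [eMinj SMc]]] : exists (S : set M) (e : M -> nat), {in S &, injective e} /\
    forall x, exists2 s, S s & (cU (iM s) `&` Phi @^-1` B s) x.
  apply: second_countable_lindelof; first exact: manifold_second_countable.
  move=> x; have [oB Bx _] := BP x; apply: open_nbhs_nbhs; split; last by split.
  by apply: openI; [exact: cU_open|exact: pull_open].
(* Labels from [M] contribute to the new cover of [N] subsets of the sets [cV (cr i)]. A new index
   on [M] can then be sent to a label of this kind, over which the old index is [cr i] by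
   definition. *)
pose jl (l : N + M) := match l with inl s => jN s | inr s => cr (iM s) end.
pose Al (l : N + M) := match l with inl s => A s | inr s => B s end.
pose Sl (l : N + M) := match l with inl s => SN s | inr s => SM s end.
(* Even and odd numbers keep the two kinds of labels apart. *)
pose el (l : N + M) : nat := match l with inl s => (eN s).*2 | inr s => (eM s).*2.+1 end.
have AlP l : open (Al l) /\ closure (Al l) `<=` cV (jl l).
  by case: l => s; [case: (AP s)|case: (BP s)].
have elinj l l' : Sl l -> Sl l' -> el l = el l' -> l = l'.
  case: l => s; case: l' => s' /= Ss Ss'.
  - by move=> /double_inj /eNinj ->; rewrite ?inE.
  - by move=> H; have := congr1 odd H; rewrite /= !odd_double.
  - by move=> H; have := congr1 odd H; rewrite /= !odd_double.
  - by move=> [] /double_inj /eMinj ->; rewrite ?inE.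
(* [D] is imposed in both orders of the indices, since the set whose centre is used may be the first
   or the second of the two that meet. *)
pose F y l l' z := (closure (Al l') y -> D (jl l) (jl l') y z /\ D (jl l') (jl l) y z) /\
  (~ closure (Al l') y -> ~ closure (Al l') z).
(* The pair is discarded, giving the empty set, unless its label is kept and its centre lies in the
   corresponding open set. The bound includes the label itself, for two sets with one label and
   different centres. *)
pose W (k : N * (N + M)) := [set z | [/\ Sl k.2, Al k.2 k.1, Al k.2 z &
  forall l', Sl l' -> (el l' < (el k.2).+1)%N -> F k.1 k.2 l' z]].
have WV k : W k `<=` cV (jl k.2).
  by move=> z [_ _ Az _]; apply: (AlP k.2).2; exact: subset_closure.
have FD y l l' : Al l y -> closure (Al l') y -> [/\ open (D (jl l) (jl l') y),
    open (D (jl l') (jl l) y), D (jl l) (jl l') y y & D (jl l') (jl l) y y].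
  move=> Ay Ay'; have Vy : cV (jl l) y by apply: (AlP l).2; exact: subset_closure.
  have Vy' : cV (jl l') y by apply: (AlP l').2.
  by have [? ?] := hD _ _ _ Vy Vy'; have [? ?] := hD _ _ _ Vy' Vy.
have Fo y l l' : Al l y -> open (F y l l').
  move=> Ay; have [cy|ncy] := pselect (closure (Al l') y).
    have [D1 D2 _ _] := FD _ _ _ Ay cy.
    rewrite (_ : F y l l' = D (jl l) (jl l') y `&` D (jl l') (jl l) y); first exact: openI.
    by apply/seteqP; split=> z; [move=> [/(_ cy)] | move=> ?; split].
  rewrite (_ : F y l l' = ~` closure (Al l')).
    by apply: closed_openC; exact: closed_closure.
  by apply/seteqP; split=> z; [move=> [_ /(_ ncy)] | move=> ?; split].
have Fy y l l' : Al l y -> F y l l' y.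
  by move=> Ay; split=> // cy; have [_ _ ? ?] := FD _ _ _ Ay cy.
have Wo k : open (W k).
  have [Sk|nS] := pselect (Sl k.2 /\ Al k.2 k.1); last first.
    rewrite (_ : W k = set0); first exact: open0.
    by apply/seteqP; split=> // z [? ? _ _]; case: nS.
  case: Sk => Sk Ak.
  (* Each number belongs to at most one kept label, so each step of the induction adds at most one
     open condition. *)
  have fin d : open [set z | forall l', Sl l' -> (el l' < d)%N -> F k.1 k.2 l' z].
    elim: d => [|d IH].
      by rewrite (_ : [set z | _] = setT); [exact: openT|apply/seteqP; split].
    have [[l0 [Sl0 el0]]|no] := pselect (exists l0, Sl l0 /\ el l0 = d); last first.
      rewrite (_ : [set z | _] = [set z | forall l', Sl l' -> (el l' < d)%N -> F k.1 k.2 l' z]) //.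
      apply/seteqP; split=> z H l' Sl'; first by move=> /ltnW; exact: H.
      rewrite ltnS leq_eqVlt => /orP[/eqP ed|]; last exact: H.
      by case: no; exists l'.
    rewrite (_ : [set z | _] = [set z | forall l', Sl l' -> (el l' < d)%N -> F k.1 k.2 l' z]
        `&` F k.1 k.2 l0); first by apply: openI => //; exact: Fo.
    apply/seteqP; split=> z.
      by move=> H; split=> [l' Sl' /ltnW|]; apply: H => //; rewrite el0.
    move=> [H1 H2] l' Sl'; rewrite ltnS leq_eqVlt => /orP[/eqP ed|]; last exact: H1.
    by rewrite (elinj l' l0) // el0.
  rewrite (_ : W k = Al k.2 `&` [set z | forall l', Sl l' -> (el l' < (el k.2).+1)%N -> F k.1 k.2 l' z]).
    by apply: openI => //; exact: (AlP _).1.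
  by apply/seteqP; split=> z; [case|case].
have Wc y l : Sl l -> Al l y -> W (y, l) y by move=> Sy Ay; split=> // l' _ _; exact: Fy.
(* Cutting with the preimage of the set of centre [Phi k.1] and label [inr k.2] makes [r'] below a
   map of covers; the last factor keeps [U k] inside one domain [E], or empty. *)
pose U (k : M * M) := cU (iM k.2) `&` Phi @^-1` W (Phi k.1, inr k.2) `&`
  [set z | cU (iM k.2) k.1 /\ E (iM k.2) k.1 z].
have Uo k : open (U k).
  apply: openI; first by apply: openI; [exact: cU_open|apply: pull_open].
  have [Ux|nU] := pselect (cU (iM k.2) k.1).
    rewrite (_ : [set z | _] = E (iM k.2) k.1); first by case: (hE _ _ Ux).
    by apply/seteqP; split=> z; [case|].
  by rewrite (_ : [set z | _] = set0); [exact: open0|apply/seteqP; split=> z []].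
have Vcov y : exists k, W k y.
  by have [s Ss As] := SNc y; exists (y, inl s); exact: Wc.
have Ucov x : exists k, U k x.
  have [s Ss [Us Bs]] := SMc x; exists (x, s); split; last by have [] := hE _ _ Us.
  by split=> //; apply: Wc.
pose r' (k : M * M) : N * (N + M) := (Phi k.1, inr k.2).
have r'P k x : U k x -> W (r' k) (Phi x) by move=> [[]].
pose c' := @CovPair _ _ _ _ _ Phi _ _ U W r' Uo Wo Ucov Vcov r'P.
exists c', (@Refinement _ _ _ _ _ _ c' c (fun k => iM k.2) (fun k => jl k.2)
  (fun k x (h : U k x) => h.1.1) WV erefl); split; last first.
  move=> k; have [Ux|nU] := pselect (cU (iM k.2) k.1); last first.
    by left; apply/seteqP; split=> // z [_ [? _]]; case: nU.
  by right; exists k.1 => // z [_ []].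
move=> k k'; have [[z [Wz Wz']]|no] := pselect (exists z, V2 W k k' z); last first.
  by left; apply/seteqP; split=> // z Wz; case: no; exists z.
right; have [Sk Ak Az Fz] := Wz; have [Sk' Ak' Az' Fz'] := Wz'.
have [le|/ltnW le] := leqP (el k'.2) (el k.2).
  have [_ F2] := Fz _ Sk' le; have cy : closure (Al k'.2) k.1.
    by apply: contrapT => /F2; apply; exact: subset_closure.
  exists k.1.
    by split; [apply: (AlP k.2).2; exact: subset_closure | exact: (AlP k'.2).2].
  by move=> z' [[_ _ _ Fk] _]; have [H _] := Fk _ Sk' le; case: (H cy).
have [_ F2] := Fz' _ Sk le; have cy : closure (Al k.2) k'.1.
  by apply: contrapT => /F2; apply; exact: subset_closure.
exists k'.1.
  by split; [exact: (AlP k.2).2 | apply: (AlP k'.2).2; exact: subset_closure].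
by move=> z' [_ [_ _ _ Fk]]; have [H _] := Fk _ Sk le; case: (H cy).
Qed.

End Refinements.

(** * Cone cocycles and change of refinement *)

Local Notation cUs c := (@cU _ _ _ _ _ _ c).
Local Notation cVs c := (@cV _ _ _ _ _ _ c).

Section Cocycles.
Variables (R : realType) (m n : nat) (M : manifold R m) (N : manifold R n).
Variables (Phi : M -> N) (sPhi : smooth_map Phi).
Implicit Types c : covpair Phi.

Lemma V2_open c i j : open (V2 (cVs c) i j).
Proof. by apply: openI; exact: cV_open. Qed.
Lemma U2_open c i j : open (V2 (cUs c) i j).
Proof. by apply: openI; exact: cU_open. Qed.
Lemma crP2 c i i' x : V2 (cUs c) i i' x -> V2 (cVs c) (cr i) (cr i') (Phi x).
Proof. by move=> [/crP ? /crP]. Qed.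
Lemma crP3 c i i' i'' x : V3 (cUs c) i i' i'' x -> V3 (cVs c) (cr i) (cr i') (cr i'') (Phi x).
Proof. by move=> [[/crP ? /crP ?] /crP]. Qed.

(** The functions are known to be invertible only over the intersections of the covers, so the
    denominators of the multiplicative differential are cleared there. *)
Lemma is_cocycleP c (z : cone2 c) : is_cocycle z <-> smooth_cone2 z /\
  [/\ forall i i' i'' x, V3 (cUs c) i i' i'' x ->
        z.2.1.1 (cr i) (cr i') (cr i'') (Phi x) * z.1.1 i i'' x = z.1.1 i' i'' x * z.1.1 i i' x,
      forall i i' x v, V2 (cUs c) i i' x ->
        pull1 Phi (z.2.1.2 (cr i) (cr i')) x v =
        z.1.2 i' x v - z.1.2 i x v - dlog (z.1.1 i i') x v,
      forall i j k l x, V4 (cVs c) i j k l x ->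
        z.2.1.1 j k l x * z.2.1.1 i j l x = z.2.1.1 i k l x * z.2.1.1 i j k x,
      forall i j k x v, V3 (cVs c) i j k x ->
        z.2.1.2 j k x v - z.2.1.2 i k x v + z.2.1.2 i j x v + dlog (z.2.1.1 i j k) x v = 0
    & forall i j x u v, V2 (cVs c) i j x ->
        z.2.2 j x u v - z.2.2 i x u v - dform1 (z.2.1.2 i j) x u v = 0 ].
Proof.
rewrite /is_cocycle; split=> -[sm].
  have [[Uh _] [Ug _ _]] := sm.
  move=> [[H1 H2] [H3 H4 H5]]; split=> //; split=> //.
  - move=> i i' i'' x Ux; have := H1 i i' i'' x Ux; rewrite /= /mdelta1.
    have [[Ui Ui'] Ui''] := Ux.
    have h1 : z.1.1 i i'' x != 0 by apply: (U1_neq0 (Uh i i'')).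
    have h2 : z.1.1 i' i'' x != 0 by apply: (U1_neq0 (Uh i' i'')).
    have h3 : z.1.1 i i' x != 0 by apply: (U1_neq0 (Uh i i')).
    move=> /divr1_eq ->; by field.
  - by move=> i i' x v Ux; exact: (subr0_eq (H2 i i' x v Ux)).
  - move=> i j k l x Vx; have := H3 i j k l x Vx; rewrite /= /mdelta2.
    have [[[Vi Vj] Vk] Vl] := Vx.
    have h1 : z.2.1.1 i k l x != 0 by apply: (U1_neq0 (Ug i k l)).
    have h2 : z.2.1.1 i j k x != 0 by apply: (U1_neq0 (Ug i j k)).
    by move=> /divr1_eq <-; field.
move=> [H1 H2 H3 H4 H5]; split=> //; have [[Uh _] [Ug _ _]] := sm; split; first split.
- move=> i i' i'' x Ux; have := H1 i i' i'' x Ux; rewrite /= /mdelta1.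
  have [[Ui Ui'] Ui''] := Ux.
  have h1 : z.1.1 i i'' x != 0 by apply: (U1_neq0 (Uh i i'')).
  have h2 : z.1.1 i' i'' x != 0 by apply: (U1_neq0 (Uh i' i'')).
  have h3 : z.1.1 i i' x != 0 by apply: (U1_neq0 (Uh i i')).
  move=> E; have -> : z.2.1.1 (cr i) (cr i') (cr i'') (Phi x) = z.1.1 i' i'' x / z.1.1 i i'' x * z.1.1 i i' x.
    by apply: (mulIf h1); rewrite E; field.
  by rewrite divff // !mulf_neq0 // invr_neq0.
- by move=> i i' x v Ux; rewrite /= (H2 i i' x v Ux) /adelta0_1 subrr.
split.
- move=> i j k l x Vx; have := H3 i j k l x Vx; rewrite /= /mdelta2.
  have [[[Vi Vj] Vk] Vl] := Vx.
  have h1 : z.2.1.1 i k l x != 0 by apply: (U1_neq0 (Ug i k l)).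
  have h2 : z.2.1.1 i j k x != 0 by apply: (U1_neq0 (Ug i j k)).
  by move=> E; rewrite [X in X / _]mulrAC E; field; rewrite h1 h2.
- exact: H4.
- exact: H5.
Qed.

(** The equation z - z' = d (f, (q, B)) in the cone, free of division. The signs of [f] come from
    the term - d alpha of the cone differential. *)
Definition coboundary_eqs c (f : TA0 M (cI c)) (q : cJ c -> cJ c -> N -> R[i])
    (B : cJ c -> form1 N) (z z' : cone2 c) : Prop :=
 [/\ forall i i' x, V2 (cUs c) i i' x ->
       z.1.1 i i' x * f i' x = z'.1.1 i i' x * q (cr i) (cr i') (Phi x) * f i x,
     forall i x v, cU i x ->
       z.1.2 i x v = z'.1.2 i x v + pull1 Phi (B (cr i)) x v - dlog (f i) x v,
     forall j k l x, V3 (cVs c) j k l x ->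
       z.2.1.1 j k l x * q j l x = z'.2.1.1 j k l x * q k l x * q j k x,
     forall j k x v, V2 (cVs c) j k x ->
       z.2.1.2 j k x v = z'.2.1.2 j k x v + B k x v - B j x v - dlog (q j k) x v
   & forall j x u v, cV j x ->
       z.2.2 j x u v = z'.2.2 j x u v + dform1 (B j) x u v ].

Lemma cohomologousP c (z z' : cone2 c) : smooth_cone2 z -> smooth_cone2 z' ->
  cohomologous z z' <-> exists f q B,
    [/\ forall i, U1 (cU i) (f i), forall j k, U1 (V2 (cVs c) j k) (q j k),
        forall j, smooth_form1 (cV j) (B j) & coboundary_eqs f q B z z'].
Proof.
move=> [[Uh _] [Ug _ _]] [[Uh' _] [Ug' _ _]]; split.
  move=> [[f [q B]] [sf [sq sB]] [[H1 H2] [H3 H4 H5]]]; exists f, q, B; split=> //; split.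
  - move=> i i' x Ux; have := H1 i i' x Ux; rewrite /= /mdelta0; have [Ui Ui'] := Ux.
    have h' : z'.1.1 i i' x != 0 by apply: (U1_neq0 (Uh' i i')).
    have f0 : f i x != 0 by apply: (U1_neq0 (sf i)).
    have f0' : f i' x != 0 by apply: (U1_neq0 (sf i')).
    have q0 : q (cr i) (cr i') (Phi x) != 0 by apply: (U1_neq0 (sq _ _)); exact: crP2.
    move=> /divr1_eq E; have -> : z.1.1 i i' x = z.1.1 i i' x / z'.1.1 i i' x * z'.1.1 i i' x by rewrite divfK.
    by rewrite E; field; rewrite f0 f0'.
  - move=> i x v Ux; have /eqP := H2 i x v Ux; rewrite subr_eq0 /= subr_eq addrC => /eqP ->.
    by rewrite addrA.
  - move=> j k l x Vx; have := H3 j k l x Vx; rewrite /= /mdelta1; have [[Vj Vk] Vl] := Vx.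
    have h' : z'.2.1.1 j k l x != 0 by apply: (U1_neq0 (Ug' j k l)).
    have q1 : q j l x != 0 by apply: (U1_neq0 (sq _ _)).
    move=> /divr1_eq E; have -> : z.2.1.1 j k l x = z.2.1.1 j k l x / z'.2.1.1 j k l x * z'.2.1.1 j k l x by rewrite divfK.
    by rewrite E; field.
  - move=> j k x v Vx; have /eqP := H4 j k x v Vx; rewrite subr_eq0 /= subr_eq addrC => /eqP ->.
    by rewrite /adelta0_1; rewrite !addrA.
  - move=> j x u v Vx; have /eqP := H5 j x u v Vx; rewrite subr_eq0 /= subr_eq addrC => /eqP ->.
    by [].
move=> [f [q [B [sf sq sB [H1 H2 H3 H4 H5]]]]]; exists (f, (q, B)); first by split.
split; split.
- move=> i i' x Ux; have := H1 i i' x Ux; rewrite /= /mdelta0; have [Ui Ui'] := Ux.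
  have h' : z'.1.1 i i' x != 0 by apply: (U1_neq0 (Uh' i i')).
  have f0 : f i x != 0 by apply: (U1_neq0 (sf i)).
  have f0' : f i' x != 0 by apply: (U1_neq0 (sf i')).
  have q0 : q (cr i) (cr i') (Phi x) != 0 by apply: (U1_neq0 (sq _ _)); exact: crP2.
  move=> E; have -> : z.1.1 i i' x = z'.1.1 i i' x * q (cr i) (cr i') (Phi x) * f i x / f i' x.
    by apply: (mulIf f0'); rewrite divfK.
  by field; rewrite f0 f0' q0 h'.
- move=> i x v Ux; rewrite /= (H2 i x v Ux); ring.
- move=> j k l x Vx; have := H3 j k l x Vx; rewrite /= /mdelta1; have [[Vj Vk] Vl] := Vx.
  have h' : z'.2.1.1 j k l x != 0 by apply: (U1_neq0 (Ug' j k l)).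
  have q1 : q j l x != 0 by apply: (U1_neq0 (sq _ _)).
  have q2 : q k l x != 0 by apply: (U1_neq0 (sq _ _)).
  have q3 : q j k x != 0 by apply: (U1_neq0 (sq _ _)).
  move=> E; have -> : z.2.1.1 j k l x = z'.2.1.1 j k l x * q k l x * q j k x / q j l x.
    by apply: (mulIf q1); rewrite divfK.
  by field; rewrite q1 q2 q3 h'.
- move=> j k x v Vx; rewrite /= (H4 j k x v Vx) /adelta0_1; ring.
- move=> j x u v Vx; rewrite /= (H5 j x u v Vx); ring.
Qed.

Lemma cohomologous_refl c (z : cone2 c) : smooth_cone2 z -> cohomologous z z.
Proof.
move=> sz; apply/(cohomologousP sz sz).
exists (fun _ _ => 1), (fun _ _ _ => 1), (fun _ _ _ => 0); split.
- by move=> i; exact: U1_1.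
- by move=> j k; exact: U1_1.
- by move=> j; exact: smooth_form1_0.
split.
- by move=> i i' x _; rewrite !mulr1.
- by move=> i x v _; rewrite dlog1 /pull1; ring.
- by move=> j k l x _; rewrite !mulr1.
- by move=> j k x v _; rewrite dlog1; ring.
- by move=> j x u v _; rewrite dform1_0 addr0.
Qed.

Lemma cohomologous_sym c (z z' : cone2 c) : smooth_cone2 z -> smooth_cone2 z' ->
  cohomologous z z' -> cohomologous z' z.
Proof.
move=> sz sz' /(cohomologousP sz sz')[f [q [B [sf sq sB [H1 H2 H3 H4 H5]]]]].
apply/(cohomologousP sz' sz).
have oV j k := @V2_open c j k.
exists (fun i x => (f i x)^-1), (fun j k x => (q j k x)^-1), (fun j x v => - B j x v); split.
- by move=> i; apply: U1_V => //; exact: cU_open.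
- by move=> j k; apply: U1_V.
- by move=> j; apply: smooth_form1N => //; exact: cV_open.
split.
- move=> i i' x Ux; have [Ui Ui'] := Ux.
  have f0 : f i x != 0 by apply: (U1_neq0 (sf i)).
  have f0' : f i' x != 0 by apply: (U1_neq0 (sf i')).
  have q0 : q (cr i) (cr i') (Phi x) != 0 by apply: (U1_neq0 (sq _ _)); exact: crP2.
  have -> : z.1.1 i i' x = z'.1.1 i i' x * q (cr i) (cr i') (Phi x) * f i x / f i' x.
    by apply: (mulIf f0'); rewrite divfK // H1.
  by field; rewrite f0 f0' q0.
- move=> i x v Ux; rewrite (H2 i x v Ux) (dlogV v (cU_open i) (sf i) Ux) /pull1; ring.
- move=> j k l x Vx; have [[Vj Vk] Vl] := Vx.
  have q1 : q j l x != 0 by apply: (U1_neq0 (sq _ _)).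
  have q2 : q k l x != 0 by apply: (U1_neq0 (sq _ _)).
  have q3 : q j k x != 0 by apply: (U1_neq0 (sq _ _)).
  have -> : z.2.1.1 j k l x = z'.2.1.1 j k l x * q k l x * q j k x / q j l x.
    by apply: (mulIf q1); rewrite divfK // H3.
  by field; rewrite q1 q2 q3.
- move=> j k x v Vx; rewrite (H4 j k x v Vx) (dlogV v (oV j k) (sq j k) Vx); ring.
- move=> j x u v Vx; rewrite (H5 j x u v Vx) (dform1N _ _ (sB j) Vx); ring.
Qed.

Lemma cross_mul (K : comRingType) (h' h'' q q' a a' b : K) :
  h' * b = h'' * q' * a' -> h' * q * a * b = h'' * (q * q') * (a * a').
Proof.
move=> H; have -> : h' * q * a * b = (h' * b) * (q * a) by ring.
by rewrite H; ring.
Qed.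

Lemma cohomologous_trans c (z z' z'' : cone2 c) : smooth_cone2 z -> smooth_cone2 z' ->
  smooth_cone2 z'' -> cohomologous z z' -> cohomologous z' z'' -> cohomologous z z''.
Proof.
move=> sz sz' sz'' /(cohomologousP sz sz')[f [q [B [sf sq sB [H1 H2 H3 H4 H5]]]]].
move=> /(cohomologousP sz' sz'')[f' [q' [B' [sf' sq' sB' [K1 K2 K3 K4 K5]]]]].
apply/(cohomologousP sz sz'').
have oV j k := @V2_open c j k.
exists (fun i x => f i x * f' i x), (fun j k x => q j k x * q' j k x),
  (fun j x v => B j x v + B' j x v); split.
- by move=> i; apply: U1_M => //; exact: cU_open.
- by move=> j k; apply: U1_M.
- by move=> j; apply: smooth_form1D => //; exact: cV_open.
split.
- by move=> i i' x Ux; rewrite mulrA (H1 i i' x Ux); exact: cross_mul (K1 i i' x Ux).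
- move=> i x v Ux; rewrite (H2 i x v Ux) (K2 i x v Ux) (dlogM v (cU_open i) (sf i) (sf' i) Ux) /pull1; ring.
- by move=> j k l x Vx; rewrite mulrA (H3 j k l x Vx); exact: cross_mul (K3 j k l x Vx).
- move=> j k x v Vx; rewrite (H4 j k x v Vx) (K4 j k x v Vx) (dlogM v (oV j k) (sq j k) (sq' j k) Vx); ring.
- move=> j x u v Vx; rewrite (H5 j x u v Vx) (K5 j x u v Vx) (dform1D _ _ (sB j) (sB' j) Vx); ring.
Qed.

Lemma restrict_smooth c c' (r : refinement c' c) (z : cone2 c) :
  smooth_cone2 z -> smooth_cone2 (restrict_cone2 r z).
Proof.
move=> [[Uh sA] [Ug sA' sw]]; split; split.
- by move=> i i'; apply: U1_sub (Uh _ _) => x [/(rIP r) ? /(rIP r)].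
- by move=> i; apply: smooth_form1_sub (sA _) => x /(rIP r).
- by move=> j k l; apply: U1_sub (Ug _ _ _) => x [[/(rJP r) ? /(rJP r) ?] /(rJP r)].
- by move=> j k; apply: smooth_form1_sub (sA' _ _) => x [/(rJP r) ? /(rJP r)].
- move=> j; have [a b d e] := sw (rJ r j); split.
  + by move=> x /(rJP r); exact: a.
  + by move=> x /(rJP r); exact: b.
  + by move=> x /(rJP r); exact: d.
  + by move=> p u v k; apply: Ck_sub (e p u v k) => y [cy /(rJP r)].
Qed.

Lemma restrict_cohomologous c c' (r : refinement c' c) (z z' : cone2 c) :
  smooth_cone2 z -> smooth_cone2 z' ->
  cohomologous z z' -> cohomologous (restrict_cone2 r z) (restrict_cone2 r z').
Proof.
move=> sz sz' /(cohomologousP sz sz')[f [q [B [sf sq sB [H1 H2 H3 H4 H5]]]]].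
apply/(cohomologousP (restrict_smooth r sz) (restrict_smooth r sz')).
exists (fun i => f (rI r i)), (fun j k => q (rJ r j) (rJ r k)), (fun j => B (rJ r j)); split.
- by move=> i; apply: U1_sub (sf _) => x /(rIP r).
- by move=> j k; apply: U1_sub (sq _ _) => x [/(rJP r) ? /(rJP r)].
- by move=> j; apply: smooth_form1_sub (sB _) => x /(rJP r).
split=> /=.
- by move=> i i' x [/(rIP r) ? /(rIP r) ?]; rewrite -!r_commE H1.
- by move=> i x v /(rIP r) ?; rewrite -!r_commE H2.
- by move=> j k l x [[/(rJP r) ? /(rJP r) ?] /(rJP r) ?]; rewrite H3.
- by move=> j k x v [/(rJP r) ? /(rJP r) ?]; rewrite H4.
- by move=> j x u v /(rJP r) ?; rewrite H5.
Qed.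

(* The homotopy is the one obtained by writing formally g = delta sigma. *)
Lemma restrict_homotopy c c' (r r' : refinement c' c) (z : cone2 c) : is_cocycle z ->
  cohomologous (restrict_cone2 r z) (restrict_cone2 r' z).
Proof.
move=> /is_cocycleP[sz [H1 H2 H3 H4 H5]]; have [[Uh sA] [Ug sA' sw]] := sz.
apply/(cohomologousP (restrict_smooth r sz) (restrict_smooth r' sz)).
pose t := rJ r; pose t' := rJ r'; pose g := z.2.1.1.
have VtP j x : cV j x -> cV (t j) x by exact: rJP.
have VtP' j x : cV j x -> cV (t' j) x by exact: rJP.
have sub j k : V2 (cVs c') j k `<=` V3 (cVs c) (t j) (t k) (t' k).
  by move=> x [/VtP ? Vk]; split; [split=> //; exact: VtP | exact: VtP'].
have sub' j k : V2 (cVs c') j k `<=` V3 (cVs c) (t j) (t' j) (t' k).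
  by move=> x [Vj /VtP' ?]; split=> //; split; [exact: VtP | exact: VtP'].
have u1 j k : U1 (V2 (cVs c') j k) (g (t j) (t k) (t' k)) by apply: U1_sub (Ug _ _ _); exact: sub.
have u2 j k : U1 (V2 (cVs c') j k) (g (t j) (t' j) (t' k)) by apply: U1_sub (Ug _ _ _); exact: sub'.
have oV j k := @V2_open c' j k.
(* The prism operator. The square with vertices t j, t k, t' j, t' k is cut along the diagonal from
   t j to t' k, and [g] is taken over its two triangles with opposite exponents. *)
exists (fun i x => z.1.1 (rI r i) (rI r' i) x),
  (fun j k x => g (t j) (t k) (t' k) x / g (t j) (t' j) (t' k) x),
  (fun j x v => - z.2.1.2 (t j) (t' j) x v); split.
- by move=> i; apply: U1_sub (Uh _ _) => x Ux; split; [exact: rIP|exact: rIP].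
- by move=> j k; apply: U1_div.
- move=> j; apply: smooth_form1N; first exact: cV_open.
  by apply: smooth_form1_sub (sA' _ _) => x Vx; split; [exact: VtP|exact: VtP'].
split=> /=.
- move=> i i' x [Ui Ui']; have Ur := rIP r Ui; have Ur' := rIP r' Ui.
  have Us := rIP r Ui'; have Us' := rIP r' Ui'.
  have h0 a b : cU a x -> cU b x -> z.1.1 a b x != 0.
    by move=> Ua Ub; apply: (U1_neq0 (Uh a b)).
  (* The first cone equation eliminates the pulled back [g] in favour of values of [h], after which
     the claim is an identity of fractions. *)
  have gE a b d : cU a x -> cU b x -> cU d x ->
     g (cr a) (cr b) (cr d) (Phi x) = z.1.1 b d x * z.1.1 a b x / z.1.1 a d x.
    move=> Ua Ub Ud; apply: (mulIf (h0 _ _ Ua Ud)); rewrite divfK ?h0 //.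
    by apply: H1.
  rewrite /t /t' -!r_commE !gE //.
  by field; rewrite !h0.
- move=> i x v Ui; have Ur := rIP r Ui; have Ur' := rIP r' Ui.
  have := H2 (rI r i) (rI r' i) x v (conj Ur Ur').
  by rewrite /t /t' -!r_commE /pull1 => ->; ring.
- move=> j k l x [[Vj Vk] Vl].
  have Wj := VtP _ _ Vj; have Wk := VtP _ _ Vk; have Wl := VtP _ _ Vl.
  have Wj' := VtP' _ _ Vj; have Wk' := VtP' _ _ Vk; have Wl' := VtP' _ _ Vl.
  have g0 a b d : cV a x -> cV b x -> cV d x -> g a b d x != 0.
    by move=> Va Vb Vd; apply: (U1_neq0 (Ug a b d)).
  (* Used with [a] equal to [t j]: every value of [g] is expressed by values with first index [t j],
     and these cancel. *)
  have K a b d e : cV a x -> cV b x -> cV d x -> cV e x ->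
      g b d e x = g a d e x * g a b d x / g a b e x.
    by move=> Va Vb Vd Ve; apply: (mulIf (g0 a b e Va Vb Ve)); rewrite divfK ?g0 // H3.
  rewrite -/t -/t' -/g (K (t j) (t k) (t l) (t' l)) // (K (t j) (t k) (t' k) (t' l)) //.
  rewrite (K (t j) (t' j) (t' k) (t' l)) //.
  by field; rewrite !g0.
- move=> j k x v Vx; have Va := sub j k x Vx; have Vb := sub' j k x Vx.
  rewrite (dlog_div v (oV j k) (u1 j k) (u2 j k) Vx).
  have /eqP := H4 _ _ _ x v Va; rewrite addrC addr_eq0 => /eqP ->.
  have /eqP := H4 _ _ _ x v Vb; rewrite addrC addr_eq0 => /eqP ->.
  by rewrite -/t -/t'; ring.
- move=> j x u v Vj; have Va := VtP _ _ Vj; have Vb := VtP' _ _ Vj.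
  have sB : smooth_form1 (cV j) (z.2.1.2 (t j) (t' j)).
    by apply: smooth_form1_sub (sA' _ _) => y Vy; split; [exact: VtP|exact: VtP'].
  have := H5 _ _ x u v (conj Va Vb); rewrite (dform1N _ _ sB Vj) => /eqP.
  by rewrite subr_eq0 => /eqP <-; rewrite -/t -/t'; ring.
Qed.

Definition cocycle_of c (z : cone2 c) (hz : is_cocycle z) : cocycle Phi :=
  existT _ c (exist _ z hz).

Lemma cocycle_eq_same c (z z' : cone2 c) (hz : is_cocycle z) (hz' : is_cocycle z') :
  cohomologous z z' -> cocycle_eq (cocycle_of hz) (cocycle_of hz').
Proof.
move=> zz'; exists c, (refinement_id c), (refinement_id c).
exact: (restrict_cohomologous (refinement_id c) hz.1 hz'.1 zz').
Qed.

Lemma cocycle_eq_sym (z z' : cocycle Phi) : cocycle_eq z z' -> cocycle_eq z' z.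
Proof.
move=> [d [r [r' H]]]; exists d, r', r; apply: cohomologous_sym H; apply: restrict_smooth.
  exact: (proj2_sig (projT2 z)).1.
exact: (proj2_sig (projT2 z')).1.
Qed.

Lemma cocycle_eq_refl (z : cocycle Phi) : cocycle_eq z z.
Proof.
move: z => [c [z hz]]; exact: (cocycle_eq_same hz hz (cohomologous_refl hz.1)).
Qed.

(** On a common refinement the middle cocycle is restricted along two possibly different refinement
    maps; [restrict_homotopy] joins the two restrictions. *)
Lemma cocycle_eq_trans (z z' z'' : cocycle Phi) :
  cocycle_eq z z' -> cocycle_eq z' z'' -> cocycle_eq z z''.
Proof.
move: z z' z'' => [c [z hz]] [c' [z' hz']] [c'' [z'' hz'']].
move=> [d1 [r1 [r1' H1]]] [d2 [r2 [r2' H2]]]; rewrite /= in r1 r1' H1 r2 r2' H2.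
have [d [s1 [s2 _]]] := common_refinement d1 d2.
have sz := hz.1; have sz' := hz'.1; have sz'' := hz''.1.
exists d, (refinement_comp r1 s1), (refinement_comp r2' s2) => /=.
have K1 := restrict_cohomologous s1 (restrict_smooth r1 sz) (restrict_smooth r1' sz') H1.
have K2 := restrict_cohomologous s2 (restrict_smooth r2 sz') (restrict_smooth r2' sz'') H2.
have K3 := restrict_homotopy (refinement_comp r1' s1) (refinement_comp r2 s2) hz'.
have S (d' : covpair Phi) (t : refinement d' c') := restrict_smooth t sz'.
apply: (cohomologous_trans (restrict_smooth (refinement_comp r1 s1) sz) (S _ (refinement_comp r1' s1))
  (restrict_smooth (refinement_comp r2' s2) sz'') K1).
exact: (cohomologous_trans (S _ (refinement_comp r1' s1)) (S _ (refinement_comp r2 s2))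
  (restrict_smooth (refinement_comp r2' s2) sz'') K3 K2).
Qed.

End Cocycles.

(** * Gerbes and quasi-line bundles in coordinates *)

Section TrivialBundle.
Variables (R : realType) (m : nat) (M : manifold R m).

Definition triv_line : line R := @Line R (R[i]^o) (fun u v => (u : R[i]) * conjc (v : R[i])).

Lemma triv_lineP : is_line triv_line.
Proof.
split.
- by rewrite dimvf.
- by move=> c u v w /=; rewrite mulrDl mulrA.
- by move=> u v /=; rewrite conjcM conjcK mulrC.
- by move=> u u0 /=; rewrite -normCK exprn_gt0 // normr_gt0.
Qed.

Definition triv_bundle (A : form1 M) : lbundle M :=
  @LBundle _ _ M (fun _ => triv_line) (fun _ => setT) (fun _ _ => (1 : R[i]))
    (fun s x v => dcfun (fun y => s y : R[i]) x v + twopii R * ((A x v)%:C)%C * (s x : R[i])).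

Definition triv_frame A : section (triv_bundle A) := fun _ => (1 : R[i]).

Lemma triv_lherm A x (u : triv_bundle A x) : lherm u (triv_frame A x) = (u : R[i]).
Proof. by rewrite -[LHS]/((u : R[i]) * conjc 1) conjc1 mulr1. Qed.

Lemma triv_frame_unit A x : lherm (triv_frame A x) (triv_frame A x) = 1.
Proof. exact: triv_lherm. Qed.

Lemma uframe_triv W A : open W -> uframe W (triv_frame A) A.
Proof.
move=> oW; split => //.
- by move=> x Wx; split; [exact: triv_lineP | exact: triv_frame_unit].
- move=> p Wp; split => //; first exact: openT.
  + by move=> x _ _; exact: triv_frame_unit.
  + apply: csmooth_congr (csmooth_cst _ 1); first exact: (openI oW openT).
    by move=> x _; exact: (esym (triv_frame_unit A x)).
move=> O f t oO OW sf tE x v Ox /=; rewrite /triv_frame.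
have tE' y : O y -> (t y : R[i]) = f y by move=> /tE ->; rewrite /triv_frame /GRing.scale /= mulr1.
by rewrite (dcfun_congr v oO tE' Ox) tE' // /GRing.scale /= mulr1.
Qed.

Lemma smooth_section_triv W A (s : section (triv_bundle A)) : open W ->
  smooth_section W s -> csmooth W (fun x => s x : R[i]).
Proof.
move=> oW /(smooth_section_coef _ (uframe_triv A oW) oW (fun _ h => h)).
by apply: csmooth_congr => // x _; exact: triv_lherm.
Qed.

Lemma complex_form W (f : M -> R[i]) (A : form1 M) : open W -> csmooth W f -> smooth_form1 W A ->
  smooth_form1 W (fun x v => complex.Re (dcfun f x v + twopii R * ((A x v)%:C)%C * f x)) /\
  smooth_form1 W (fun x v => complex.Im (dcfun f x v + twopii R * ((A x v)%:C)%C * f x)).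
Proof.
move=> oW [sa sb] sA; have c1 := smooth_cst W (- (2 * pi : R)); have c2 := smooth_cst W (2 * pi : R).
split.
  apply: (@smooth_form1_congr _ _ _ W (fun x v => dfun (fun y => complex.Re (f y)) x v +
     - (2 * pi) * complex.Im (f x) * A x v)) => //.
    by move=> x v _; rewrite ReD !ReM !ImM /=; ring.
  apply: smooth_form1D => //; first exact: smooth_form1_dfun.
  by apply: smooth_form1Z => //; apply: smoothM.
apply: (@smooth_form1_congr _ _ _ W (fun x v => dfun (fun y => complex.Im (f y)) x v +
     2 * pi * complex.Re (f x) * A x v)) => //.
  by move=> x v _; rewrite ImD !ImM !ReM /=; ring.
apply: smooth_form1D => //; first exact: smooth_form1_dfun.
by apply: smooth_form1Z => //; apply: smoothM.
Qed.

Lemma dcfun_conj W (f : M -> R[i]) x v : open W -> csmooth W f -> W x ->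
  dcfun (fun y => conjc (f y)) x v = conjc (dcfun f x v).
Proof.
move=> oW [sa sb] Wx; apply: complexP; rewrite /dcfun /=.
  by apply: (dfun_congr v oW _ Wx) => y _; case: (f y).
rewrite -(dfunN v sb Wx); by apply: (dfun_congr v oW _ Wx) => y _; case: (f y).
Qed.

(** Metric compatibility of d + 2 pi i r: as [r] is real, 2 pi i r changes sign under conjugation
    and its two contributions cancel. *)
Lemma metric_identity (p q a b : R[i]) (r : R) :
  p * conjc b + a * conjc q =
  (p + twopii R * (r%:C)%C * a) * conjc b + a * conjc (q + twopii R * (r%:C)%C * b).
Proof.
have -> : conjc (q + twopii R * (r%:C)%C * b) = conjc q + conjc (twopii R * (r%:C)%C * b).
  exact: rmorphD.
have -> : conjc (twopii R * (r%:C)%C * b) = - (twopii R * (r%:C)%C * conjc b).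
  by rewrite /twopii; case: b => b1 b2; apply: complexP => /=; ring.
by ring.
Qed.

Lemma is_lb_triv W A : open W -> smooth_form1 W A -> is_lb W (triv_bundle A).
Proof.
move=> oW sA; split.
  split.
  - by move=> x _; exact: triv_lineP.
  - by move=> p _; split=> //; exact: openT.
  - by move=> p x _ _ _; exact: triv_frame_unit.
  - move=> p q _ _; have oI := openI (openI oW openT) openT.
    by apply: csmooth_congr (csmooth_cst _ 1) => // x _; exact: (esym (triv_frame_unit A x)).
move=> W' oW' WW s t ss st; have cs := smooth_section_triv oW' ss; have ct := smooth_section_triv oW' st.
split.
- by move=> E x v Wx /=; rewrite (dcfun_congr v oW' E Wx) E.
- move=> x v Wx /=; rewrite (dcfunD v oW' cs ct Wx); ring.
- move=> f sf x v Wx /=; rewrite /GRing.scale /= (dcfunM v oW' sf cs Wx); ring.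
split.
- move=> x Wx c u v /=; rewrite (sA.1 x (WW _ Wx)) /GRing.scale /=.
  rewrite /dcfun (dfun_linear c u v cs.1 Wx) (dfun_linear c u v cs.2 Wx).
  by apply: complexP; rewrite !(ReD, ImD, ReM, ImM) /=; ring.
- move=> q Wq; have oI := openI oW' openT.
  have cs' : csmooth (W' `&` setT) (fun x => s x : R[i]) by apply: csmooth_sub cs => x [].
  have sA' : smooth_form1 (W' `&` setT) A by apply: smooth_form1_sub sA => x [/WW].
  have [a b] := complex_form oI cs' sA'.
  have E x v : lherm (lb_conn s x v) (lb_frame (triv_bundle A) q x) =
      dcfun (fun y => s y : R[i]) x v + twopii R * ((A x v)%:C)%C * (s x : R[i]).
    exact: (triv_lherm (A := A) (x := x)).
  by split; [apply: smooth_form1_congr a | apply: smooth_form1_congr b] => // x v _; rewrite E.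
- move=> x v Wx /=; have ctc := csmooth_conj oW' ct.
  rewrite (dcfunM v oW' cs ctc Wx) (dcfun_conj v oW' ct Wx).
  exact: metric_identity.
Qed.

(** [lb_iso] compares Hermitian structures only, so the two connection forms are unrelated. The
    isomorphism matches the constant frame with its dual. *)
Lemma lb_iso_triv W A B : open W -> lb_iso W (triv_bundle A) (ldual (triv_bundle B)).
Proof.
move=> oW; have hl := triv_lineP.
pose f : forall x, triv_bundle A x -> ldual (triv_bundle B) x :=
  fun x u => (u : R[i]) *: (dualv (triv_frame B x) : dual_line triv_line).
have hd := dual_lineP hl.
exists f; split.
- move=> x _ c u v; rewrite [RHS](_ : _ = (c * (u : R[i]) + (v : R[i])) *: (dualv (triv_frame B x) : dual_line triv_line)) //.
  by rewrite scalerDl scalerA.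
- move=> x _ u v; rewrite /f (lhermZ _ _ _ hd) (lhermZr _ _ _ hd).
  rewrite lherm_dualv //; last exact: unit_neq0 (triv_frame_unit B x).
  by rewrite triv_frame_unit divr1.
- move=> W' oW' WW s ss; have cs := smooth_section_triv oW' ss.
  have uf := uframe_dual (uframe_triv B oW').
  apply/(smooth_section_coef _ uf oW' (fun _ h => h)); apply: csmooth_congr cs => // x _.
  rewrite /f (lhermZ _ _ _ hd) lherm_dualv //; last exact: unit_neq0 (triv_frame_unit B x).
  by rewrite triv_frame_unit invr1 mulr1.
Qed.

End TrivialBundle.

(** * Coordinates of tensors under a change of basis *)

Section CoordinateChange.
Variable R : realType.

Lemma line_basis (l : line R) (u e : l) : is_line l -> u != 0 -> e != 0 ->
  exists2 c, c != 0 & u = c *: e.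
Proof.
move=> hl u0 e0; exists (coef u e); first exact: coef_neq0.
by rewrite coefK.
Qed.

Lemma coef_thetav (bc ac ab : line R) (u u' : bc) (v v' : ac) (w w' : ab) (g x y z : R[i])
   (t : theta_line bc ac ab) :
  is_line bc -> is_line ac -> is_line ab -> u != 0 -> v != 0 -> w != 0 ->
  x != 0 -> y != 0 -> z != 0 -> u' = x *: u -> v' = y *: v -> w' = z *: w ->
  t = g *: thetav u v w -> coef t (thetav u' v' w') = g / (x / y * z).
Proof.
move=> h1 h2 h3 u0 v0 w0 x0 y0 z0 -> -> -> ->.
have ht := theta_lineP h1 h2 h3; have t0 := thetav_neq0 h1 h2 h3 u0 v0 w0.
by rewrite thetavZ // coefZr ?mulf_neq0 ?invr_neq0 // coefZ // mulrC.
Qed.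

Lemma coef_psiv (a b l : line R) (u u' : a) (v v' : b) (w w' : l) (h x y z : R[i])
   (p : psi_line a b l) :
  is_line a -> is_line b -> is_line l -> u != 0 -> v != 0 -> w != 0 ->
  x != 0 -> y != 0 -> z != 0 -> u' = x *: u -> v' = y *: v -> w' = z *: w ->
  p = h *: psiv u v w -> coef p (psiv u' v' w') = h / (y^-1 * x * z).
Proof.
move=> h1 h2 h3 u0 v0 w0 x0 y0 z0 -> -> -> ->.
have ht := psi_lineP h1 h2 h3; have t0 := psiv_neq0 h1 h2 h3 u0 v0 w0.
by rewrite psivZ // coefZr ?mulf_neq0 ?invr_neq0 // coefZ // mulrC.
Qed.

(** [g_tens] is defined with the arbitrary vectors [lvec]. In other bases the coordinate and the
    basis tensor acquire inverse scalars, so the product of coordinates in any bases is recovered;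
    the next three lemmas treat inverses and quasi-line bundles in the same way. *)
Lemma theta_tens (bc ac ab bc' ac' ab' : line R) (u : bc) (v : ac) (w : ab)
   (u' : bc') (v' : ac') (w' : ab') (g g' : R[i]) t t' :
  is_line bc -> is_line ac -> is_line ab -> is_line bc' -> is_line ac' -> is_line ab' ->
  u != 0 -> v != 0 -> w != 0 -> u' != 0 -> v' != 0 -> w' != 0 ->
  t = g *: thetav u v w -> t' = g' *: thetav u' v' w' ->
  (coef t (thetav (lvec bc) (lvec ac) (lvec ab)) *
   coef t' (thetav (lvec bc') (lvec ac') (lvec ab'))) *:
    thetav (tensv (lvec bc) (lvec bc')) (tensv (lvec ac) (lvec ac')) (tensv (lvec ab) (lvec ab')) =
  (g * g') *: thetav (tensv u u') (tensv v v') (tensv w w').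
Proof.
move=> h1 h2 h3 h1' h2' h3' u0 v0 w0 u0' v0' w0' tE tE'.
have [x x0 xE] := line_basis h1 (dim1_neq0 h1) u0.
have [y y0 yE] := line_basis h2 (dim1_neq0 h2) v0.
have [z z0 zE] := line_basis h3 (dim1_neq0 h3) w0.
have [x' x0' xE'] := line_basis h1' (dim1_neq0 h1') u0'.
have [y' y0' yE'] := line_basis h2' (dim1_neq0 h2') v0'.
have [z' z0' zE'] := line_basis h3' (dim1_neq0 h3') w0'.
rewrite (coef_thetav h1 h2 h3 u0 v0 w0 x0 y0 z0 xE yE zE tE).
rewrite (coef_thetav h1' h2' h3' u0' v0' w0' x0' y0' z0' xE' yE' zE' tE').
rewrite xE yE zE xE' yE' zE' !tensvZ thetavZ ?mulf_neq0 //; last 2 first.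
- exact: tens_lineP.
- exact: tensv_neq0.
by rewrite scalerA; congr (_ *: _); field; rewrite x0 y0 z0 x0' y0' z0'.
Qed.

Lemma theta_inv (bc ac ab : line R) (u : bc) (v : ac) (w : ab) (g : R[i]) t :
  is_line bc -> is_line ac -> is_line ab -> u != 0 -> v != 0 -> w != 0 -> g != 0 ->
  t = g *: thetav u v w ->
  (coef t (thetav (lvec bc) (lvec ac) (lvec ab)))^-1 *:
    thetav (dualv (lvec bc) : dual_line bc) (dualv (lvec ac) : dual_line ac) (dualv (lvec ab) : dual_line ab) =
  g^-1 *: thetav (dualv u : dual_line bc) (dualv v : dual_line ac) (dualv w : dual_line ab).
Proof.
move=> h1 h2 h3 u0 v0 w0 g0 tE.
have [x x0 xE] := line_basis h1 (dim1_neq0 h1) u0.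
have [y y0 yE] := line_basis h2 (dim1_neq0 h2) v0.
have [z z0 zE] := line_basis h3 (dim1_neq0 h3) w0.
rewrite (coef_thetav h1 h2 h3 u0 v0 w0 x0 y0 z0 xE yE zE tE).
rewrite xE yE zE !dualvZ // thetavZ ?invr_eq0 //; last 2 first.
- exact: dual_lineP.
- exact: dualv_neq0.
by rewrite scalerA; congr (_ *: _); field; rewrite x0 y0 z0 g0.
Qed.

Lemma psi_tens (a b l a' b' l' : line R) (u : a) (v : b) (w : l) (u' : a') (v' : b') (w' : l')
   (g g' : R[i]) t t' :
  is_line a -> is_line b -> is_line l -> is_line a' -> is_line b' -> is_line l' ->
  u != 0 -> v != 0 -> w != 0 -> u' != 0 -> v' != 0 -> w' != 0 ->
  t = g *: psiv u v w -> t' = g' *: psiv u' v' w' ->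
  (coef t (psiv (lvec a) (lvec b) (lvec l)) *
   coef t' (psiv (lvec a') (lvec b') (lvec l'))) *:
    psiv (tensv (lvec a) (lvec a')) (tensv (lvec b) (lvec b')) (tensv (lvec l) (lvec l')) =
  (g * g') *: psiv (tensv u u') (tensv v v') (tensv w w').
Proof.
move=> h1 h2 h3 h1' h2' h3' u0 v0 w0 u0' v0' w0' tE tE'.
have [x x0 xE] := line_basis h1 (dim1_neq0 h1) u0.
have [y y0 yE] := line_basis h2 (dim1_neq0 h2) v0.
have [z z0 zE] := line_basis h3 (dim1_neq0 h3) w0.
have [x' x0' xE'] := line_basis h1' (dim1_neq0 h1') u0'.
have [y' y0' yE'] := line_basis h2' (dim1_neq0 h2') v0'.
have [z' z0' zE'] := line_basis h3' (dim1_neq0 h3') w0'.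
rewrite (coef_psiv h1 h2 h3 u0 v0 w0 x0 y0 z0 xE yE zE tE).
rewrite (coef_psiv h1' h2' h3' u0' v0' w0' x0' y0' z0' xE' yE' zE' tE').
have ha := tens_lineP h1 h1'; have hb := tens_lineP h2 h2'.
have ua := tensv_neq0 h1 h1' u0 u0'; have ub := tensv_neq0 h2 h2' v0 v0'.
rewrite xE yE zE xE' yE' zE' !tensvZ psivZ ?mulf_neq0 //.
by rewrite scalerA; congr (_ *: _); field; rewrite x0 y0 z0 x0' y0' z0'.
Qed.

Lemma psi_inv (a b l : line R) (u : a) (v : b) (w : l) (g : R[i]) t :
  is_line a -> is_line b -> is_line l -> u != 0 -> v != 0 -> w != 0 -> g != 0 ->
  t = g *: psiv u v w ->
  (coef t (psiv (lvec a) (lvec b) (lvec l)))^-1 *: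
    psiv (dualv (lvec a) : dual_line a) (dualv (lvec b) : dual_line b) (dualv (lvec l) : dual_line l) =
  g^-1 *: psiv (dualv u : dual_line a) (dualv v : dual_line b) (dualv w : dual_line l).
Proof.
move=> h1 h2 h3 u0 v0 w0 g0 tE.
have [x x0 xE] := line_basis h1 (dim1_neq0 h1) u0.
have [y y0 yE] := line_basis h2 (dim1_neq0 h2) v0.
have [z z0 zE] := line_basis h3 (dim1_neq0 h3) w0.
rewrite (coef_psiv h1 h2 h3 u0 v0 w0 x0 y0 z0 xE yE zE tE).
have ha := dual_lineP h1; have hb := dual_lineP h2.
have ua := dualv_neq0 h1 u0; have ub := dualv_neq0 h2 v0.
rewrite xE yE zE !dualvZ // psivZ ?invr_eq0 //.
by rewrite scalerA; congr (_ *: _); field; rewrite x0 y0 z0 g0.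
Qed.

End CoordinateChange.

Section Coordinates.
Variables (R : realType) (m : nat) (M : manifold R m) (J : Type).
Variables (V : J -> set M) (oV : forall j, open (V j)).
Implicit Types (G : gerbe M J).

Let oV2 i j : open (V2 V i j). Proof. exact: openI. Qed.
Let oV3 i j k : open (V3 V i j k). Proof. by apply: openI => //; exact: openI. Qed.

Section GerbeCoordinates.
Variables (G : gerbe M J) (s : forall i j, section (g_L G i j)) (A : J -> J -> form1 M).
Variable (g : J -> J -> J -> M -> R[i]).
Hypothesis us : forall i j, uframe (V2 V i j) (s i j) (A i j).
Hypothesis thetaE : forall i j k x, V3 V i j k x ->
  (g_theta G i j k x : theta_line _ _ _) = g i j k x *: thetav (s j k x) (s i k x) (s i j x).

Lemma uframe_theta i j k : uframe (V3 V i j k)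
  ((fun x => thetav (s j k x) (s i k x) (s i j x)) : section (delta_lb1 (g_L G) i j k))
  (fun x v => A j k x v + - A i k x v + A i j x v).
Proof.
have sub a b (h : V3 V i j k `<=` V2 V a b) := uframe_sub (@oV3 i j k) h (us a b).
have f1 : uframe (V3 V i j k) (s j k) (A j k) by apply: sub => x [[]].
have f2 : uframe (V3 V i j k) (s i k) (A i k) by apply: sub => x [[]].
have f3 : uframe (V3 V i j k) (s i j) (A i j) by apply: sub => x [[]].
exact: (uframe_tens (uframe_tens f1 (uframe_dual f2)) f3).
Qed.

Lemma theta_unitary i j k :
  unitary_section (V3 V i j k) (g_theta G i j k) <-> U1 (V3 V i j k) (g i j k).
Proof. exact: (unitary_section_coef (uframe_theta i j k) (@oV3 i j k) (fun _ h => h) (@thetaE i j k)). Qed.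

Lemma theta_parallel i j k : U1 (V3 V i j k) (g i j k) ->
  parallel (V3 V i j k) (g_theta G i j k) <-> forall x v, V3 V i j k x ->
    dlog (g i j k) x v + (A j k x v + - A i k x v + A i j x v) = 0.
Proof.
move=> ug; exact: (parallel_coef (uframe_theta i j k) (@oV3 i j k) (fun _ h => h) ug (@thetaE i j k)).
Qed.

Lemma uframe_line i j x : V2 V i j x -> is_line (g_L G i j x) /\ s i j x != 0.
Proof.
move=> Vx; split; last exact: uframe_neq0 (us i j) Vx.
by case: (us i j) => _ /(_ _ Vx)[].
Qed.

(** [theta_closed] quantifies over all nonzero vectors. Each rescaling enters the alternating
    product twice and cancels, so testing on the frames is enough. *)
Lemma theta_closedP : (forall i j k x, V3 V i j k x -> g i j k x != 0) ->
  theta_closed V G <-> forall a b c d x, V4 V a b c d x ->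
    g b c d x / g a c d x * g a b d x / g a b c x = 1.
Proof.
move=> g0; split=> H a b c d x Vx.
  have [[[Va Vb] Vc] Vd] := Vx.
  have [h1 s1] := @uframe_line a b x (conj Va Vb); have [h2 s2] := @uframe_line a c x (conj Va Vc).
  have [h3 s3] := @uframe_line a d x (conj Va Vd); have [h4 s4] := @uframe_line b c x (conj Vb Vc).
  have [h5 s5] := @uframe_line b d x (conj Vb Vd); have [h6 s6] := @uframe_line c d x (conj Vc Vd).
  have := H a b c d x Vx _ _ _ _ _ _ s1 s2 s3 s4 s5 s6.
  have E i j k (Vi : V i x) (Vj : V j x) (Vk : V k x) :
     coef (g_theta G i j k x : theta_line _ _ _) (thetav (s j k x) (s i k x) (s i j x)) = g i j k x.
    have [k1 t1] := @uframe_line j k x (conj Vj Vk); have [k2 t2] := @uframe_line i k x (conj Vi Vk).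
    have [k3 t3] := @uframe_line i j x (conj Vi Vj).
    rewrite (thetaE (conj (conj Vi Vj) Vk)) coefZ //; first exact: theta_lineP.
    exact: thetav_neq0.
  by rewrite !E.
have [[[Va Vb] Vc] Vd] := Vx.
have [h1 s1] := @uframe_line a b x (conj Va Vb); have [h2 s2] := @uframe_line a c x (conj Va Vc).
have [h3 s3] := @uframe_line a d x (conj Va Vd); have [h4 s4] := @uframe_line b c x (conj Vb Vc).
have [h5 s5] := @uframe_line b d x (conj Vb Vd); have [h6 s6] := @uframe_line c d x (conj Vc Vd).
move=> lab lac lad lbc lbd lcd ab0 ac0 ad0 bc0 bd0 cd0.
have [x1 x10 E1] := line_basis h1 ab0 s1; have [x2 x20 E2] := line_basis h2 ac0 s2.
have [x3 x30 E3] := line_basis h3 ad0 s3; have [x4 x40 E4] := line_basis h4 bc0 s4.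
have [x5 x50 E5] := line_basis h5 bd0 s5; have [x6 x60 E6] := line_basis h6 cd0 s6.
rewrite (coef_thetav h6 h5 h4 s6 s5 s4 x60 x50 x40 E6 E5 E4 (thetaE (conj (conj Vb Vc) Vd))).
rewrite (coef_thetav h6 h3 h2 s6 s3 s2 x60 x30 x20 E6 E3 E2 (thetaE (conj (conj Va Vc) Vd))).
rewrite (coef_thetav h5 h3 h1 s5 s3 s1 x50 x30 x10 E5 E3 E1 (thetaE (conj (conj Va Vb) Vd))).
rewrite (coef_thetav h4 h2 h1 s4 s2 s1 x40 x20 x10 E4 E2 E1 (thetaE (conj (conj Va Vb) Vc))).
rewrite -(H a b c d x Vx).
have k1 := g0 _ _ _ _ (conj (conj Va Vc) Vd); have k2 := g0 _ _ _ _ (conj (conj Va Vb) Vc).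
by field; rewrite k1 k2 x10 x20 x30 x40 x50 x60.
Qed.

Section QlbCoordinates.
Variables (Q : qlb (g_fib G)) (e : forall i, section (q_E Q i)) (a : J -> form1 M).
Variable (h : J -> J -> M -> R[i]).
Hypothesis ue : forall i, uframe (V i) (e i) (a i).
Hypothesis psiE : forall i j x, V2 V i j x ->
  q_psi Q i j x = h i j x *: psiv (e i x) (e j x) (s i j x : g_fib G i j x).

Lemma uframe_qlb i x : V i x -> is_line (q_E Q i x) /\ e i x != 0.
Proof.
move=> Vx; split; last exact: uframe_neq0 (ue i) Vx.
by case: (ue i) => _ /(_ _ Vx)[].
Qed.

Lemma uframe_psi i j : uframe (V2 V i j)
  ((fun x => psiv (e i x) (e j x) (s i j x : g_fib G i j x)) :
     section (ltens (delta_lb0 (fun k => ldual (q_E Q k)) i j) (g_L G i j)))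
  (fun x v => - a j x v + - - a i x v + A i j x v).
Proof.
have f1 : uframe (V2 V i j) (e i) (a i) by apply: uframe_sub (ue i) => // x [].
have f2 : uframe (V2 V i j) (e j) (a j) by apply: uframe_sub (ue j) => // x [].
exact: (uframe_tens (uframe_tens (uframe_dual f2) (uframe_dual (uframe_dual f1))) (us i j)).
Qed.

Lemma psi_unitary i j :
  unitary_section (V2 V i j) (q_psi_section Q i j) <-> U1 (V2 V i j) (h i j).
Proof. exact: (unitary_section_coef (uframe_psi i j) (@oV2 i j) (fun _ h => h) (@psiE i j)). Qed.

Lemma psi_parallel i j : U1 (V2 V i j) (h i j) ->
  parallel (V2 V i j) (q_psi_section Q i j) <-> forall x v, V2 V i j x ->
    dlog (h i j) x v + (- a j x v + - - a i x v + A i j x v) = 0.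
Proof.
move=> uh; exact: (parallel_coef (uframe_psi i j) (@oV2 i j) (fun _ h => h) uh (@psiE i j)).
Qed.

(** The scalars of the vectors of the quasi-line bundle cancel within the left side, and those of
    the lines of the gerbe occur equally on both sides. *)
Lemma psi_thetaP : (forall i j x, V2 V i j x -> h i j x != 0) ->
  psi_theta V Q <-> forall i j k x, V3 V i j k x ->
    h j k x / h i k x * h i j x = g i j k x.
Proof.
move=> h0; split=> H i j k x Vx; have [[Vi Vj] Vk] := Vx;
have [k1 t1] := @uframe_line i j x (conj Vi Vj); have [k2 t2] := @uframe_line i k x (conj Vi Vk);
have [k3 t3] := @uframe_line j k x (conj Vj Vk);
have [l1 u1] := uframe_qlb Vi; have [l2 u2] := uframe_qlb Vj; have [l3 u3] := uframe_qlb Vk.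
  have := H i j k x Vx _ _ _ _ _ _ u1 u2 u3 t1 t2 t3.
  rewrite (psiE (conj Vj Vk)) (psiE (conj Vi Vk)) (psiE (conj Vi Vj)) (thetaE Vx).
  rewrite !coefZ //; do ?[exact: theta_lineP|exact: thetav_neq0|exact: psi_lineP|exact: psiv_neq0].
move=> ea eb ec lab lac lbc ea0 eb0 ec0 lab0 lac0 lbc0.
have [x1 x10 E1] := line_basis k1 lab0 t1; have [x2 x20 E2] := line_basis k2 lac0 t2.
have [x3 x30 E3] := line_basis k3 lbc0 t3; have [x4 x40 E4] := line_basis l1 ea0 u1.
have [x5 x50 E5] := line_basis l2 eb0 u2; have [x6 x60 E6] := line_basis l3 ec0 u3.
rewrite (coef_thetav k3 k2 k1 t3 t2 t1 x30 x20 x10 E3 E2 E1 (thetaE Vx)).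
rewrite (coef_psiv l2 l3 k3 u2 u3 t3 x50 x60 x30 E5 E6 E3 (psiE (conj Vj Vk))).
rewrite (coef_psiv l1 l3 k2 u1 u3 t2 x40 x60 x20 E4 E6 E2 (psiE (conj Vi Vk))).
rewrite (coef_psiv l1 l2 k1 u1 u2 t1 x40 x50 x10 E4 E5 E1 (psiE (conj Vi Vj))).
rewrite -(H i j k x Vx).
have h1 := h0 _ _ _ (conj Vi Vk).
by field; rewrite h1 x10 x20 x30 x40 x50 x60.
Qed.

End QlbCoordinates.
End GerbeCoordinates.

(** [f i] is the coordinate of the local section over [V i] in the frame formed by [e i] and the
    dual of [e' i]. Both quasi-line bundles use the same vector of [ell], so its scalar drops out of
    the quotient. *)
Lemma difference_coord (ell : J -> J -> M -> line R) (Q Q' : qlb ell)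
   (e : forall i, section (q_E Q i)) (e' : forall i, section (q_E Q' i)) (a a' : J -> form1 M)
   (s : forall i j x, ell i j x) (h h' : J -> J -> M -> R[i]) :
  (forall i, uframe (V i) (e i) (a i)) -> (forall i, uframe (V i) (e' i) (a' i)) ->
  (forall i j x, V2 V i j x -> is_line (ell i j x) /\ s i j x != 0) ->
  (forall i j x, V2 V i j x -> q_psi Q i j x = h i j x *: psiv (e i x) (e j x) (s i j x)) ->
  (forall i j x, V2 V i j x -> q_psi Q' i j x = h' i j x *: psiv (e' i x) (e' j x) (s i j x)) ->
  (forall i j x, V2 V i j x -> h' i j x != 0) ->
  difference_trivial V Q Q' <-> exists f : J -> M -> R[i],
    [/\ forall i, U1 (V i) (f i),
        forall i x v, V i x -> dlog (f i) x v + (a i x v + - a' i x v) = 0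
      & forall i j x, V2 V i j x -> f i x = h i j x / h' i j x * f j x ].
Proof.
move=> ue ue' hs pE pE' h0'.
have ut i := uframe_tens (ue i) (uframe_dual (ue' i)).
have hl i x : V i x -> [/\ is_line (q_E Q i x), e i x != 0, is_line (q_E Q' i x) & e' i x != 0].
  move=> Vx; have [_ /(_ _ Vx)[k1 _] _ _] := ue i; have [_ /(_ _ Vx)[k2 _] _ _] := ue' i.
  by split=> //; [exact: uframe_neq0 (ue i) Vx|exact: uframe_neq0 (ue' i) Vx].
split.
  move=> [t [t1 t2 t3]].
  pose f i x := lherm (t i x) (tensv (e i x) (dualv (e' i x))).
  have tE i x : V i x -> t i x = f i x *: tensv (e i x) (dualv (e' i x)).
    by move=> Vx; exact: (uframe_scale (t i x) (ut i) Vx).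
  have uf i : U1 (V i) (f i) by apply/(unitary_section_coef (ut i) (oV i) (fun _ h => h) (tE i)).1.
  exists f; split=> //.
    by move=> i; apply/(parallel_coef (ut i) (oV i) (fun _ h => h) (uf i) (tE i)).1.
  move=> i j x Vx; have [Vi Vj] := Vx; have [k1 n1 k2 n2] := hl _ _ Vi; have [k3 n3 k4 n4] := hl _ _ Vj.
  have [k5 n5] := hs _ _ _ Vx.
  have := t3 i j x Vx _ _ _ _ _ n1 n3 n2 n4 n5.
  rewrite (tE i x Vi) (tE j x Vj) (pE _ _ _ Vx) (pE' _ _ _ Vx) !coefZ //;
   do ?[exact: tens_lineP|exact: psi_lineP|exact: psiv_neq0|apply: tens_lineP => //; exact: dual_lineP
       |apply: tensv_neq0 => //; [exact: dual_lineP|exact: dualv_neq0]].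
move=> [f [uf f2 f3]].
exists (fun i x => f i x *: tensv (e i x) (dualv (e' i x))); split.
- by move=> i; apply/(unitary_section_coef (ut i) (oV i) (fun _ h => h) (fun x _ => erefl)).
- by move=> i; apply/(parallel_coef (ut i) (oV i) (fun _ h => h) (uf i) (fun x _ => erefl)); exact: f2.
move=> i j x Vx; have [Vi Vj] := Vx; have [k1 n1 k2 n2] := hl _ _ Vi; have [k3 n3 k4 n4] := hl _ _ Vj.
have [k5 n5] := hs _ _ _ Vx.
move=> u v w y l u0 v0 w0 y0 l0.
have [x1 x10 E1] := line_basis k1 u0 n1; have [x2 x20 E2] := line_basis k3 v0 n3.
have [x3 x30 E3] := line_basis k2 w0 n2; have [x4 x40 E4] := line_basis k4 y0 n4.
have [x5 x50 E5] := line_basis k5 l0 n5.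
rewrite (coef_psiv k1 k3 k5 n1 n3 n5 x10 x20 x50 E1 E2 E5 (pE _ _ _ Vx)).
rewrite (coef_psiv k2 k4 k5 n2 n4 n5 x30 x40 x50 E3 E4 E5 (pE' _ _ _ Vx)).
have T (A B : line R) (b1 : A) (b2 : B) (c c1 c2 : R[i]) : is_line A -> is_line B -> b1 != 0 -> b2 != 0 ->
   c1 != 0 -> c2 != 0 ->
   coef (c *: tensv b1 (dualv b2) : tens_line A (dual_line B)) (tensv (c1 *: b1) (dualv (c2 *: b2))) = c / (c1 / c2).
  move=> hA hB b10 b20 c10 c20; have hd := dual_lineP hB; have ht := tens_lineP hA hd.
  have d0 := dualv_neq0 hB b20; have t0 := tensv_neq0 hA hd b10 d0.
  by rewrite dualvZ // tensvZ coefZr ?mulf_neq0 ?invr_neq0 // coefZ // mulrC.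
rewrite E1 E3 E2 E4 !T // (f3 _ _ _ Vx).
have hh := h0' _ _ _ Vx.
by field; rewrite hh x10 x20 x30 x40 x50.
Qed.

End Coordinates.

(** * Cocycles representing a relative gerbe *)

Section Reindexing.
Variables (R : realType) (m : nat) (M : manifold R m).

Lemma is_lb_sub (W W' : set M) (L : lbundle M) : W' `<=` W -> is_lb W L -> is_lb W' L.
Proof.
move=> WW [[a b c d] e]; split; last by move=> O oO OW; apply: e => // x /OW /WW.
split.
- by move=> x /WW; exact: a.
- by move=> x /WW; exact: b.
- by move=> p x /WW Wp /WW Wx; exact: c.
- by move=> p q /WW Wp /WW Wq; apply: csmooth_sub (d p q Wp Wq) => x [[/WW ? ?] ?].
Qed.

Lemma unitary_section_sub (W W' : set M) (L : lbundle M) (s : section L) :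
  W' `<=` W -> unitary_section W s -> unitary_section W' s.
Proof.
move=> WW [a b]; split; last by move=> x /WW; exact: b.
by move=> q /WW Wq; apply: csmooth_sub (a q Wq) => x [/WW].
Qed.

Variables (J K : Type) (t : K -> J) (V : J -> set M) (W : K -> set M).
Hypothesis WV : forall k, W k `<=` V (t k).

Let WV2 k k' : V2 W k k' `<=` V2 V (t k) (t k').
Proof. by move=> x [/WV ? /WV]. Qed.
Let WV3 k k' k'' : V3 W k k' k'' `<=` V3 V (t k) (t k') (t k'').
Proof. by move=> x [[/WV ? /WV ?] /WV]. Qed.

Lemma is_gerbe_reindex (G : gerbe M J) : is_gerbe V G -> is_gerbe W (g_reindex t G).
Proof.
move=> [h1 h2 h3 h4 [h5 h6 h7]]; split.
- by move=> j k; apply: is_lb_sub (h1 _ _); exact: WV2.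
- move=> j k; have [f [f1 f2 f3]] := h2 (t j) (t k); exists f; split.
  + by move=> x /WV2; exact: f1.
  + by move=> x /WV2; exact: f2.
  + by move=> O oO OW; apply: f3 => // x /OW /WV2.
- by move=> j k l; apply: unitary_section_sub (h3 _ _ _); exact: WV3.
- by move=> a b c d x [/WV3 H /WV Vd]; apply: h4.
split.
- by move=> j k l x v /WV3; exact: h5.
- move=> j; have [a b d e] := h6 (t j); split.
  + by move=> x /WV; exact: a.
  + by move=> x /WV; exact: b.
  + by move=> x /WV; exact: d.
  + by move=> p u v k; apply: Ck_sub (e p u v k) => y [cy /WV].
- by move=> j k x u v /WV2; exact: h7.
Qed.

Lemma is_qlb_reindex (G : gerbe M J) (Q : qlb (g_fib G)) : is_qlb V Q ->
  is_qlb W (q_reindex t Q : qlb (g_fib (g_reindex t G))).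
Proof.
move=> [h1 h2 h3 h4]; split.
- by move=> j; apply: is_lb_sub (h1 _); exact: WV.
- by move=> j k; apply: unitary_section_sub (h2 _ _); exact: WV2.
- by move=> a b c x /WV3; exact: h3.
- by move=> j k x v /WV2; exact: h4.
Qed.

Lemma difference_trivial_reindex ell (Q Q' : @qlb R m M J ell) :
  difference_trivial V Q Q' -> difference_trivial W (q_reindex t Q) (q_reindex t Q').
Proof.
move=> [s [s1 s2 s3]]; exists (fun k => s (t k)); split.
- by move=> k; apply: unitary_section_sub (s1 _); exact: WV.
- by move=> k x v /WV; exact: s2.
- by move=> k k' x /WV2; exact: s3.
Qed.

End Reindexing.

(** * Transport of quasi-line bundles along equal index maps *)

Section Transport.
Variables (R : realType) (m n : nat) (M : manifold R m) (N : manifold R n).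
Variable Phi : M -> N.

(** With the index map [rho] variable, the equality along which [rg_restrict] transports can be
    eliminated; a property of the reindexed bundle then passes to the restricted one. *)
Lemma rg_restrict_ind (X : relgerbe_data Phi) c (r : refinement c (rg_cov X))
    (P : forall rho : cI c -> cJ (rg_cov X), qlb (g_fib (g_pull_reindex Phi rho (rg_G X))) -> Prop) :
  P (fun i => cr (rI r i)) (q_reindex (rI r) (rg_Q X)) ->
  P (fun i => rJ r (cr i)) (rg_restrict r).
Proof. by rewrite /rg_restrict; case: _ / (r_comm r). Qed.

Lemma rg_restrict_E (X : relgerbe_data Phi) c (r : refinement c (rg_cov X)) :
  q_E (rg_restrict r) = fun i => q_E (rg_Q X) (rI r i).
Proof. by apply: (@rg_restrict_ind X c r (fun rho Q => q_E Q = fun i => q_E (rg_Q X) (rI r i))). Qed.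

Lemma is_qlb_restrict (X : relgerbe_data Phi) c (r : refinement c (rg_cov X)) : is_relgerbe X ->
  is_qlb (cUs c) (rg_restrict r).
Proof.
move=> [_ hQ]; apply: (@rg_restrict_ind X c r (fun rho Q => is_qlb (cUs c) Q)).
by apply: (@is_qlb_reindex _ _ _ _ _ (rI r) (cUs (rg_cov X)) (cUs c) (rIP r) _ _ hQ).
Qed.

Lemma eq_rect_reindex (I I' J : Type) (G : gerbe N J) (t : I' -> I) (f g : I -> J)
    (Q : qlb (g_fib (g_pull_reindex Phi f G))) (E1 : f = g)
    (E3 : (fun i => f (t i)) = (fun i => g (t i))) :
  eq_rect _ (fun rho => qlb (g_fib (g_pull_reindex Phi rho G))) (q_reindex t Q) _ E3 =
  q_reindex t (eq_rect _ (fun rho => qlb (g_fib (g_pull_reindex Phi rho G))) Q _ E1).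
Proof. by case: _ / E1 E3 => E3; rewrite (Prop_irrelevance E3 erefl). Qed.

(** Two relative gerbes are treated at once, because an isomorphism compares both quasi-line bundles
    over one index map [kappa]. *)
Lemma rg_restrict_comp_ind (X X' : relgerbe_data Phi) c c' (r : refinement c (rg_cov X))
    (r' : refinement c (rg_cov X')) (s : refinement c' c)
    (P : forall kappa : cI c' -> cJ c,
       qlb (g_fib (g_pull_reindex Phi (fun i => rJ r (kappa i)) (rg_G X))) ->
       qlb (g_fib (g_pull_reindex Phi (fun i => rJ r' (kappa i)) (rg_G X'))) -> Prop) :
  P (fun i => cr (rI s i)) (q_reindex (rI s) (rg_restrict r)) (q_reindex (rI s) (rg_restrict r')) ->
  P (fun i => rJ s (cr i)) (rg_restrict (refinement_comp r s)) (rg_restrict (refinement_comp r' s)).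
Proof.
move=> H.
(* With [kappa] and the equalities of composites variable, the equality for [s] is eliminated; any
   two proofs of the remaining equalities agree, so the transport commutes with reindexing. *)
have gen (kappa : cI c' -> cJ c) (E : (fun i => cr (rI s i)) = kappa)
   (E3 : (fun i => cr (rI r (rI s i))) = (fun i => rJ r (kappa i)))
   (E3' : (fun i => cr (rI r' (rI s i))) = (fun i => rJ r' (kappa i))) :
  P kappa
    (eq_rect _ (fun rho => qlb (g_fib (g_pull_reindex Phi rho (rg_G X))))
      (q_reindex (fun i => rI r (rI s i)) (rg_Q X)) _ E3)
    (eq_rect _ (fun rho => qlb (g_fib (g_pull_reindex Phi rho (rg_G X'))))
      (q_reindex (fun i => rI r' (rI s i)) (rg_Q X')) _ E3').
  case: _ / E E3 E3' => E3 E3'.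
  have -> := @eq_rect_reindex _ _ _ (rg_G X) (rI s) _ _ (q_reindex (rI r) (rg_Q X)) (r_comm r) E3.
  have -> := @eq_rect_reindex _ _ _ (rg_G X') (rI s) _ _ (q_reindex (rI r') (rg_Q X')) (r_comm r') E3'.
  exact: H.
exact: (gen _ (r_comm s)).
Qed.

End Transport.

Section Representatives.
Variables (R : realType) (m n : nat) (M : manifold R m) (N : manifold R n).
Variables (Phi : M -> N) (sPhi : smooth_map Phi).
Implicit Types X : relgerbe_data Phi.

Definition psi_coord X (c : covpair Phi) (tJ : cJ c -> cJ (rg_cov X)) (kappa : cI c -> cJ c)
    (Q : qlb (g_fib (g_pull_reindex Phi (fun i => tJ (kappa i)) (rg_G X))))
    (s : forall j k, section (g_L (rg_G X) (tJ j) (tJ k)))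
    (h : cI c -> cI c -> M -> R[i]) (a : cI c -> form1 M) : Prop :=
  exists e : forall i, section (q_E Q i),
    (forall i, uframe (cUs c i) (e i) (a i)) /\
    (forall i i' x, V2 (cUs c) i i' x ->
       q_psi Q i i' x = h i i' x *: psiv (e i x) (e i' x)
         (s (kappa i) (kappa i') (Phi x) : g_L (rg_G X) (tJ (kappa i)) (tJ (kappa i')) (Phi x))).

(* [z] consists of the coordinates of [X] in unitary frames of its line bundles
   over the members of the cover [c] and their intersections. *)
Definition represents X c (r : refinement c (rg_cov X)) (z : cone2 c) : Prop :=
  [/\ forall j k, smooth_form1 (V2 (cVs c) j k) (z.2.1.2 j k),
      forall i, smooth_form1 (cUs c i) (z.1.2 i),
      z.2.2 = (fun j => g_form (rg_G X) (rJ r j))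
    & exists s : forall j k, section (g_L (rg_G X) (rJ r j) (rJ r k)),
      [/\ forall j k, uframe (V2 (cVs c) j k) (s j k) (z.2.1.2 j k),
          forall j k l x, V3 (cVs c) j k l x ->
            (g_theta (rg_G X) (rJ r j) (rJ r k) (rJ r l) x : theta_line _ _ _) =
            z.2.1.1 j k l x *: thetav (s k l x) (s j l x) (s j k x)
        & psi_coord (kappa := @cr _ _ _ _ _ _ c) (rg_restrict r) s z.1.1 z.1.2 ]].

Lemma uframe_pull_cover (c : covpair Phi) j k i i' (L : lbundle N) (s : section L) A :
  cr i = j -> cr i' = k -> uframe (V2 (cVs c) j k) s A ->
  uframe (V2 (cUs c) i i') ((fun x => s (Phi x)) : section (lpull Phi L)) (pull1 Phi A).
Proof.
move=> <- <- us; apply: uframe_sub (uframe_pull sPhi us); first exact: U2_open.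
by move=> x; exact: crP2.
Qed.

(** Once frames are chosen, [theta] and [psi] are read off by [coef]. Smoothness and modulus one of
    these coordinates are no part of [represents]; they are deduced from the axioms in
    [represents_cocycle]. *)
Lemma represents_exists X c (r : refinement c (rg_cov X)) :
  (forall j k, exists (s : section (g_L (rg_G X) (rJ r j) (rJ r k))) A,
     uframe (V2 (cVs c) j k) s A /\ smooth_form1 (V2 (cVs c) j k) A) ->
  (forall i, exists (e : section (q_E (rg_Q X) (rI r i))) A,
     uframe (cUs c i) e A /\ smooth_form1 (cUs c i) A) ->
  exists z : cone2 c, represents r z.
Proof.
move=> hs he0.
(* Abstracting the family of bundles allows rewriting with [rg_restrict_E] although the sections
   depend on it. *)
pose T (L : cI c -> lbundle M) := forall i, exists (e : section (L i)) A,
   uframe (cUs c i) e A /\ smooth_form1 (cUs c i) A.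
have he : T (q_E (rg_restrict r)) by rewrite rg_restrict_E.
pose s j k := sval (cid (hs j k)); pose A j k := sval (cid (svalP (cid (hs j k)))).
have sA j k : uframe (V2 (cVs c) j k) (s j k) (A j k) /\ smooth_form1 (V2 (cVs c) j k) (A j k).
  exact: svalP (cid (svalP (cid (hs j k)))).
pose e i := sval (cid (he i)); pose a i := sval (cid (svalP (cid (he i)))).
have ea i : uframe (cUs c i) (e i) (a i) /\ smooth_form1 (cUs c i) (a i).
  exact: svalP (cid (svalP (cid (he i)))).
pose g j k l x := coef (g_theta (rg_G X) (rJ r j) (rJ r k) (rJ r l) x : theta_line _ _ _)
   (thetav (s k l x) (s j l x) (s j k x)).
pose h i i' x := coef (q_psi (rg_restrict r) i i' x) (psiv (e i x) (e i' x)
   (s (cr i) (cr i') (Phi x) : g_L (rg_G X) (rJ r (cr i)) (rJ r (cr i')) (Phi x))).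
have ls j k x : V2 (cVs c) j k x -> is_line (g_L (rg_G X) (rJ r j) (rJ r k) x) /\ s j k x != 0.
  move=> Vx; split; last exact: uframe_neq0 (sA j k).1 Vx.
  by case: (sA j k) => -[_ /(_ _ Vx)[]].
have le i x : cUs c i x -> is_line (q_E (rg_restrict r) i x) /\ e i x != 0.
  move=> Vx; split; last exact: uframe_neq0 (ea i).1 Vx.
  by case: (ea i) => -[_ /(_ _ Vx)[]].
exists ((h, a), ((g, A), fun j => g_form (rg_G X) (rJ r j))); split => //=.
- by move=> j k; case: (sA j k).
- by move=> i; case: (ea i).
exists s; split.
- by move=> j k; case: (sA j k).
- move=> j k l x [[Vj Vk] Vl]; have [a1 b1] := ls k l x (conj Vk Vl).
  have [a2 b2] := ls j l x (conj Vj Vl); have [a3 b3] := ls j k x (conj Vj Vk).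
  exact: esym (coefK _ (theta_lineP a1 a2 a3) (thetav_neq0 a1 a2 a3 b1 b2 b3)).
exists e; split; first by move=> i; case: (ea i).
move=> i i' x Ux; have [Ui Ui'] := Ux; have [a1 b1] := ls _ _ _ (crP2 Ux).
have [a2 b2] := le _ _ Ui; have [a3 b3] := le _ _ Ui'.
exact: esym (coefK _ (psi_lineP a2 a3 a1) (psiv_neq0 a2 a3 a1 b2 b3 b1)).
Qed.

Lemma represents_cocycle X c (r : refinement c (rg_cov X)) (z : cone2 c) : is_relgerbe X ->
  represents r z -> is_cocycle z.
Proof.
move=> hX [sA sa wE [s [us thE [e [ue psE]]]]].
have hG := is_gerbe_reindex (rJP r) hX.1; have hQ := is_qlb_restrict r hX.
have oV j := @cV_open _ _ _ _ _ Phi c j; have oU i := @cU_open _ _ _ _ _ Phi c i.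
have [_ _ t1 t2 [t3 t4 t5]] := hG.
pose GN := g_reindex (rJ r) (rg_G X).
(* Unitarity comes first: closedness and parallelism are read in coordinates that must already be
   known to be nonzero or of modulus one. *)
have ug j k l : U1 (V3 (cVs c) j k l) (z.2.1.1 j k l).
  by apply/(@theta_unitary _ _ _ _ _ oV GN _ _ _ us thE j k l); exact: t1.
have g0 j k l x : V3 (cVs c) j k l x -> z.2.1.1 j k l x != 0 by move=> Vx; exact: U1_neq0 (ug j k l) Vx.
pose GM := g_pull_reindex Phi (fun i => rJ r (cr i)) (rg_G X).
pose sM i i' : section (g_L GM i i') := fun x => s (cr i) (cr i') (Phi x).
have usM i i' : uframe (V2 (cUs c) i i') (sM i i') (pull1 Phi (z.2.1.2 (cr i) (cr i'))).
  exact: uframe_pull_cover.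
have thM i i' i'' x : V3 (cUs c) i i' i'' x -> (g_theta GM i i' i'' x : theta_line _ _ _) =
   z.2.1.1 (cr i) (cr i') (cr i'') (Phi x) *: thetav (sM i' i'' x) (sM i i'' x) (sM i i' x).
  by move=> /crP3; exact: thE.
have [q1 q2 q3 q4] := hQ.
have uh i i' : U1 (V2 (cUs c) i i') (z.1.1 i i').
  by apply/(@psi_unitary _ _ _ _ _ oU GM _ _ usM (rg_restrict r) _ _ _ ue psE i i'); exact: q2.
have h0 i i' x : V2 (cUs c) i i' x -> z.1.1 i i' x != 0 by move=> Ux; exact: U1_neq0 (uh i i') Ux.
apply/is_cocycleP; split.
  by split; split=> //; move=> j; rewrite wE; exact: t4.
split.
- move=> i i' i'' x Ux; have [[Ui Ui'] Ui''] := Ux.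
  have := (psi_thetaP usM thM ue psE h0).1 q3 i i' i'' x Ux => <-.
  by have k1 := h0 _ _ _ (conj Ui Ui''); field.
- move=> i i' x v Ux.
  have := (@psi_parallel _ _ _ _ _ oU GM _ _ usM (rg_restrict r) _ _ _ ue psE i i' (uh i i')).1 (q4 i i') x v Ux.
  by move=> H; apply/eqP; rewrite -subr_eq0 -H; apply/eqP; ring.
- move=> i j k l x Vx; have [[[Vi Vj] Vk] Vl] := Vx.
  have E := (@theta_closedP _ _ _ _ _ GN _ _ _ us thE g0).1 t2 i j k l x Vx.
  have k1 := g0 _ _ _ _ (conj (conj Vi Vk) Vl); have k2 := g0 _ _ _ _ (conj (conj Vi Vj) Vk).
  by rewrite -[RHS]mul1r -E; field; rewrite k1 k2.
- move=> i j k x v Vx.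
  have := (@theta_parallel _ _ _ _ _ oV GN _ _ _ us thE i j k (ug i j k)).1 (t3 i j k) x v Vx.
  by move=> <-; ring.
- move=> i j x u v Vx; rewrite wE; have := t5 i j x u v Vx; rewrite /= => ->.
  by rewrite (curv_uframe u v (us i j) (sA i j) Vx) subrr.
Qed.

(** With the same refinement only the frames vary. Their transition functions [f] and [u] form the
    coboundary, and its 1-form [B] is zero since the 2-forms are those of [X] itself. *)
Lemma represents_unique X c (r : refinement c (rg_cov X)) (z z' : cone2 c) : is_relgerbe X ->
  represents r z -> represents r z' -> cohomologous z z'.
Proof.
move=> hX rz rz'; have cz := represents_cocycle hX rz; have cz' := represents_cocycle hX rz'.
have [sA sa wE [s [us thE [e [ue psE]]]]] := rz.
have [sA' sa' wE' [s' [us' thE' [e' [ue' psE']]]]] := rz'.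
apply/(cohomologousP cz.1 cz'.1).
pose u j k := sval (cid (uframe_change (us j k) (us' j k))).
have uP j k : [/\ U1 (V2 (cVs c) j k) (u j k), forall x, V2 (cVs c) j k x -> s' j k x = u j k x *: s j k x &
    forall x v, V2 (cVs c) j k x -> z'.2.1.2 j k x v = z.2.1.2 j k x v + dlog (u j k) x v].
  exact: svalP (cid (uframe_change (us j k) (us' j k))).
pose f i := sval (cid (uframe_change (ue i) (ue' i))).
have fP i : [/\ U1 (cUs c i) (f i), forall x, cUs c i x -> e' i x = f i x *: e i x &
    forall x v, cUs c i x -> z'.1.2 i x v = z.1.2 i x v + dlog (f i) x v].
  exact: svalP (cid (uframe_change (ue i) (ue' i))).
have ls j k x : V2 (cVs c) j k x -> [/\ is_line (g_L (rg_G X) (rJ r j) (rJ r k) x), s j k x != 0 & u j k x != 0].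
  move=> Vx; split; last by case: (uP j k) => uu _ _; exact: U1_neq0 uu Vx.
  - by case: (us j k) => _ /(_ _ Vx)[].
  - exact: uframe_neq0 (us j k) Vx.
have le i x : cUs c i x -> [/\ is_line (q_E (rg_restrict r) i x), e i x != 0 & f i x != 0].
  move=> Vx; split; last by case: (fP i) => uu _ _; exact: U1_neq0 uu Vx.
  - by case: (ue i) => _ /(_ _ Vx)[].
  - exact: uframe_neq0 (ue i) Vx.
exists f, u, (fun _ _ _ => 0); split.
- by move=> i; case: (fP i).
- by move=> j k; case: (uP j k).
- by move=> j; exact: smooth_form1_0.
split.
- move=> i i' x Ux; have [Ui Ui'] := Ux; have Vx := crP2 Ux.
  have [a1 b1 c1] := le _ _ Ui; have [a2 b2 c2] := le _ _ Ui'; have [a3 b3 c3] := ls _ _ _ Vx.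
  have := psE' i i' x Ux; rewrite (psE i i' x Ux).
  have [_ fE _] := fP i; have [_ fE' _] := fP i'; have [_ uE _] := uP (cr i) (cr i').
  rewrite (fE x Ui) (fE' x Ui') (uE _ Vx) psivZ // scalerA.
  move=> /(scaler_inj (psiv_neq0 a1 a2 a3 b1 b2 b3)) ->.
  by field.
- move=> i x v Ux; have [_ _ E] := fP i; rewrite (E x v Ux) /pull1; ring.
- move=> j k l x Vx; have [[Vj Vk] Vl] := Vx.
  have [a1 b1 c1] := ls k l x (conj Vk Vl); have [a2 b2 c2] := ls j l x (conj Vj Vl).
  have [a3 b3 c3] := ls j k x (conj Vj Vk).
  have := thE' j k l x Vx; rewrite (thE j k l x Vx).
  have [_ E1 _] := uP k l; have [_ E2 _] := uP j l; have [_ E3 _] := uP j k.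
  rewrite (E1 x (conj Vk Vl)) (E2 x (conj Vj Vl)) (E3 x (conj Vj Vk)) thetavZ // scalerA.
  move=> /(scaler_inj (thetav_neq0 a1 a2 a3 b1 b2 b3)) ->.
  by field.
- move=> j k x v Vx; have [_ _ E] := uP j k; rewrite (E x v Vx); ring.
- by move=> j x w v Vx; rewrite wE wE' dform1_0 addr0.
Qed.

Lemma represents_restrict X c c' (r : refinement c (rg_cov X)) (t : refinement c' c) (z : cone2 c) :
  represents r z -> represents (refinement_comp r t) (restrict_cone2 t z).
Proof.
move=> [sA sa wE [s [us thE [e [ue psE]]]]].
have T2 j k : V2 (cVs c') j k `<=` V2 (cVs c) (rJ t j) (rJ t k) by move=> x [/(rJP t) ? /(rJP t)].
have T3 j k l : V3 (cVs c') j k l `<=` V3 (cVs c) (rJ t j) (rJ t k) (rJ t l).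
  by move=> x [[/(rJP t) ? /(rJP t) ?] /(rJP t)].
split=> /=.
- by move=> j k; apply: smooth_form1_sub (sA _ _); exact: T2.
- by move=> i; apply: smooth_form1_sub (sa _); exact: rIP.
- by rewrite wE.
exists (fun j k => s (rJ t j) (rJ t k)); split.
- by move=> j k; apply: uframe_sub (us _ _); [exact: V2_open|exact: T2].
- by move=> j k l x /T3; exact: thE.
(* The property is stated for a variable [kappa] to suit the transport; the pair of relative gerbes
   is [X] taken twice. *)
apply: (@rg_restrict_comp_ind _ _ _ _ _ _ X X c c' r r t (fun kappa Q _ =>
  exists e : forall i, section (q_E Q i),
    (forall i, uframe (cUs c' i) (e i) (z.1.2 (rI t i))) /\
    (forall i i' x, V2 (cUs c') i i' x ->
       q_psi Q i i' x = z.1.1 (rI t i) (rI t i') x *: psiv (e i x) (e i' x)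
         (s (kappa i) (kappa i') (Phi x) : g_L (rg_G X) (rJ r (kappa i)) (rJ r (kappa i')) (Phi x))))).
exists (fun i => e (rI t i)); split.
  by move=> i; apply: uframe_sub (ue _); [exact: cU_open|exact: rIP].
by move=> i i' x [/(rIP t) Ui /(rIP t) Ui']; exact: psE.
Qed.

End Representatives.

(** * Simultaneous frames and the doubled cover *)

Section Trivialization.
Variables (R : realType) (m n : nat) (M : manifold R m) (N : manifold R n).
Variables (Phi : M -> N) (sPhi : smooth_map Phi).

Lemma open_forall (T : topologicalType) (F : finType) (P : F -> set T) :
  (forall f, open (P f)) -> open [set x | forall f, P f x].
Proof.
move=> oP.
have H (s : seq F) : open [set x | forall f, f \in s -> P f x].
  elim: s => [|f s IH].
    by rewrite (_ : [set x | _] = setT); [exact: openT|apply/seteqP; split].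
  rewrite (_ : [set x | _] = P f `&` [set x | forall f, f \in s -> P f x]); first exact: openI.
  apply/seteqP; split=> x.
    by move=> K; split=> [|f' sf']; apply: K; rewrite inE ?eqxx ?sf' ?orbT.
  by move=> [K1 K2] f'; rewrite inE => /orP[/eqP ->|/K2].
rewrite (_ : [set x | _] = [set x | forall f, f \in enum F -> P f x]) //.
by apply/seteqP; split=> x K f; [move=> _; exact: K | apply: K; rewrite mem_enum].
Qed.

(** Finitely many families of bundles are trivialized over one refinement, by applying the
    refinement lemma to the intersections of their frame domains. *)
Lemma trivializing_frames (c : covpair Phi) (F F' : finType)
    (L : F -> cJ c -> cJ c -> lbundle N) (E : F' -> cI c -> lbundle M) :
  (forall f j k, is_lb (V2 (cVs c) j k) (L f j k)) -> (forall f i, is_lb (cUs c i) (E f i)) ->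
  exists (c' : covpair Phi) (r : refinement c' c),
    (forall f j k, exists (s : section (L f (rJ r j) (rJ r k))) A,
       uframe (V2 (cVs c') j k) s A /\ smooth_form1 (V2 (cVs c') j k) A) /\
    (forall f i, exists (e : section (E f (rI r i))) A,
       uframe (cUs c' i) e A /\ smooth_form1 (cUs c' i) A).
Proof.
move=> hL hE.
pose D j k (p : N) := [set x | forall f, lb_dom (L f j k) p x].
pose E' i (p : M) := [set x | forall f, lb_dom (E f i) p x].
have hD j k y : cV j y -> cV k y -> open (D j k y) /\ D j k y y.
  move=> Vj Vk; have H f : open (lb_dom (L f j k) y) /\ lb_dom (L f j k) y y.
    by have [[_ H _ _] _] := hL f j k; apply: H.
  by split; [apply: open_forall => f; case: (H f)|move=> f; case: (H f)].
have hE' i x : cU i x -> open (E' i x) /\ E' i x x.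
  move=> Ui; have H f : open (lb_dom (E f i) x) /\ lb_dom (E f i) x x.
    by have [[_ H _ _] _] := hE f i; apply: H.
  by split; [apply: open_forall => f; case: (H f)|move=> f; case: (H f)].
have [c' [r [H1 H2]]] := trivializing_refinement sPhi hD hE'.
exists c', r; split.
  move=> f j k; apply: (uframe_exists _ (hL f (rJ r j) (rJ r k))); try exact: V2_open.
    by move=> x [/(rJP r) ? /(rJP r)].
  have [->|[p Vp sub]] := H1 j k; first by left.
  by right; exists p => // x /sub; apply.
move=> f i; apply: (uframe_exists _ (hE f (rI r i))); try exact: cU_open.
  by move=> x /(rIP r).
have [->|[p Vp sub]] := H2 i; first by left.
by right; exists p => // x /sub; apply.
Qed.

Implicit Types X : relgerbe_data Phi.

Lemma is_lb_line X c (r r' : refinement c (rg_cov X)) j k : is_relgerbe X ->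
  is_lb (V2 (cVs c) j k) (g_L (rg_G X) (rJ r j) (rJ r' k)).
Proof.
move=> [[h _ _ _ _] _]; apply: is_lb_sub (h _ _).
by move=> x [/(rJP r) ? /(rJP r')].
Qed.

Lemma is_lb_qlb X c (r : refinement c (rg_cov X)) i : is_relgerbe X ->
  is_lb (cUs c i) (q_E (rg_Q X) (rI r i)).
Proof. by move=> [_ [h _ _ _]]; apply: is_lb_sub (h _) => x /(rIP r). Qed.

Lemma representative_exists X : is_relgerbe X ->
  exists c (r : refinement c (rg_cov X)) (z : cone2 c), represents r z.
Proof.
move=> hX; pose r0 := refinement_id (rg_cov X).
have [c [r [H1 H2]]] := @trivializing_frames (rg_cov X) unit unit
  (fun _ j k => g_L (rg_G X) j k) (fun _ i => q_E (rg_Q X) i)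
  (fun _ j k => is_lb_line r0 r0 j k hX) (fun _ i => is_lb_qlb r0 i hX).
have [z rz] := represents_exists (r := r) (H1 tt) (H2 tt).
by exists c, r, z.
Qed.

Definition strip (T : Type) (x : T + T) : T := match x with inl y => y | inr y => y end.

(** Every member of both covers occurs twice. Two refinements of [c'] by [c] then combine into one
    refinement by the doubled cover and are recovered along the two inclusions. *)
Definition double_cover (c : covpair Phi) : covpair Phi :=
  @CovPair _ _ _ _ _ Phi (cI c + cI c) (cJ c + cJ c)
    (fun i => cU (strip i)) (fun j => cV (strip j))
    (fun i => match i with inl y => inl (cr y) | inr y => inr (cr y) end)
    (fun i => cU_open (strip i)) (fun j => cV_open (strip j))
    (fun x => let: ex_intro i h := cU_cover c x in ex_intro _ (inl i) h)
    (fun x => let: ex_intro i h := cV_cover c x in ex_intro _ (inl i) h)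
    (fun i => match i with inl y => fun x (h : cU y x) => crP h | inr y => fun x (h : cU y x) => crP h end).

Definition double_inl (c : covpair Phi) : refinement c (double_cover c) :=
  @Refinement _ _ _ _ _ _ c (double_cover c) inl inl (fun i x h => h) (fun j y h => h) erefl.

Definition double_inr (c : covpair Phi) : refinement c (double_cover c) :=
  @Refinement _ _ _ _ _ _ c (double_cover c) inr inr (fun i x h => h) (fun j y h => h) erefl.

Lemma double_refinement (c c' : covpair Phi) (r r' : refinement c c') :
  exists t : refinement (double_cover c) c',
    refinement_comp t (double_inl c) = r /\ refinement_comp t (double_inr c) = r'.
Proof.
pose tI (i : cI (double_cover c)) := match i with inl y => rI r y | inr y => rI r' y end.
pose tJ (j : cJ (double_cover c)) := match j with inl y => rJ r y | inr y => rJ r' y end.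
have tIP i x : cU i x -> cU (tI i) x by case: i => y; [exact: (rIP r)|exact: (rIP r')].
have tJP j x : cV j x -> cV (tJ j) x by case: j => y; [exact: (rJP r)|exact: (rJP r')].
have tc : (fun i => cr (tI i)) = (fun i => tJ (cr i)).
  by apply/funext => -[] y; exact: r_commE.
exists (@Refinement _ _ _ _ _ _ (double_cover c) c' tI tJ tIP tJP tc).
by split; apply: refinement_eq.
Qed.

(** Intersections in the doubled cover also pair a member of one copy with a member of the other,
    hence the pairs of booleans: the mixed lines with indices [rJ r j] and [rJ r' k] need frames
    too. *)
Lemma double_trivial X c (r r' : refinement c (rg_cov X)) (t : refinement (double_cover c) (rg_cov X)) :
  refinement_comp t (double_inl c) = r -> refinement_comp t (double_inr c) = r' ->
  let T (b : bool) := rJ (if b then r else r') in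
  let TI (b : bool) := rI (if b then r else r') in
  (forall (f : bool * bool) j k, exists (s : section (g_L (rg_G X) (T f.1 j) (T f.2 k))) A,
       uframe (V2 (cVs c) j k) s A /\ smooth_form1 (V2 (cVs c) j k) A) ->
  (forall f i, exists (e : section (q_E (rg_Q X) (TI f i))) A,
       uframe (cUs c i) e A /\ smooth_form1 (cUs c i) A) ->
  exists z : cone2 (double_cover c), represents t z.
Proof.
move=> <- <- T TI H1 H2; apply: represents_exists.
  case=> j [] k.
  - exact: (H1 (true, true) j k).
  - exact: (H1 (true, false) j k).
  - exact: (H1 (false, true) j k).
  - exact: (H1 (false, false) j k).
by case=> i; [exact: (H2 true i) | exact: (H2 false i)].
Qed.

(* Over a fine enough cover both representatives are restrictions of a single
   one on the doubled cover, along the two inclusions. *)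
Lemma representatives_cohomologous X c c' (r : refinement c (rg_cov X)) (r' : refinement c' (rg_cov X))
    (z : cone2 c) (z' : cone2 c') (hz : is_cocycle z) (hz' : is_cocycle z') : is_relgerbe X ->
  represents r z -> represents r' z' -> cocycle_eq (cocycle_of hz) (cocycle_of hz').
Proof.
move=> hX rz rz'; have [c0 [s [s' _]]] := common_refinement c c'.
pose q := refinement_comp r s; pose q' := refinement_comp r' s'.
pose P (b : bool) := if b then q else q'.
have [d [u [H1 H2]]] := @trivializing_frames c0 (bool * bool)%type bool
  (fun f j k => g_L (rg_G X) (rJ (P f.1) j) (rJ (P f.2) k)) (fun f i => q_E (rg_Q X) (rI (P f) i))
  (fun f j k => is_lb_line (P f.1) (P f.2) j k hX) (fun f i => is_lb_qlb (P f) i hX).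
have [t [tl tr]] := double_refinement (refinement_comp q u) (refinement_comp q' u).
have [zz rzz] : exists z : cone2 (double_cover d), represents t z.
  apply: (double_trivial tl tr).
    by move=> [[] []] j k; [exact: (H1 (true, true) j k)|exact: (H1 (true, false) j k)
      |exact: (H1 (false, true) j k)|exact: (H1 (false, false) j k)].
  by move=> [] i; [exact: (H2 true i)|exact: (H2 false i)].
have hzz := represents_cocycle sPhi hX rzz.
have R1 := represents_restrict (double_inl d) rzz; rewrite tl in R1.
have R2 := represents_restrict (double_inr d) rzz; rewrite tr in R2.
have R1' := represents_restrict u (represents_restrict s rz).
have R2' := represents_restrict u (represents_restrict s' rz').
have K1 := represents_unique sPhi hX R1' R1; have K2 := represents_unique sPhi hX R2 R2'.
have K := restrict_homotopy (double_inl d) (double_inr d) hzz.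
exists d, (refinement_comp s u), (refinement_comp s' u).
have S (e e' : covpair Phi) (w : cone2 e) (v : refinement e' e) : is_cocycle w -> smooth_cone2 (restrict_cone2 v w).
  by move=> [sw _]; exact: restrict_smooth.
have S1 := S _ _ _ (refinement_comp s u) hz; have S2 := S _ _ _ (refinement_comp s' u) hz'.
have S3 := S _ _ _ (double_inl d) hzz; have S4 := S _ _ _ (double_inr d) hzz.
(* A change of frames on the first copy, the homotopy between the two inclusions, and a change of
   frames on the second copy. *)
exact: (cohomologous_trans S1 S3 S2 K1 (cohomologous_trans S3 S4 S2 K K2)).
Qed.

End Trivialization.

(** * Isomorphisms as coboundaries *)

Section Isomorphisms.
Variables (R : realType) (m n : nat) (M : manifold R m) (N : manifold R n).
Variables (Phi : M -> N) (sPhi : smooth_map Phi).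

Section Witness.
Variables (X1 X2 : relgerbe_data Phi) (c : covpair Phi).
Variables (r1 : refinement c (rg_cov X1)) (r2 : refinement c (rg_cov X2)).
Variables (z1 z2 : cone2 c).
Hypotheses (hX1 : is_relgerbe X1) (hX2 : is_relgerbe X2).
Hypotheses (rz1 : represents r1 z1) (rz2 : represents r2 z2).

Definition difference_gerbe : gerbe N (cJ c) :=
  g_tens (g_reindex (rJ r2) (rg_G X2)) (g_inv (g_reindex (rJ r1) (rg_G X1))).

Definition iso_witness (Q : qlb (g_fib difference_gerbe)) : Prop :=
  [/\ is_qlb (cVs c) Q, forall j x u v, cV j x -> error Q j x u v = 0
    & difference_trivial (cUs c) (q_tens (rg_restrict r2) (q_inv (rg_restrict r1)))
        (q_reindex (@cr _ _ _ _ _ _ c) (q_pull Phi Q))].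

(** The frames [s] of the difference gerbe, formed from those of [X2] and the duals of those of
    [X1], are fixed before [Q]: the equivalence serves both for a given witness and for one built
    from a coboundary in these frames. *)
Lemma iso_witness_coord :
  exists s : forall j k, section (g_L difference_gerbe j k),
  (forall j k x, V2 (cVs c) j k x -> is_line (g_L difference_gerbe j k x) /\ s j k x != 0) /\
  forall (Q : qlb (g_fib difference_gerbe)) (e : forall j, section (q_E Q j))
      (B : cJ c -> form1 N) (q : cJ c -> cJ c -> N -> R[i]),
    (forall j, is_lb (cVs c j) (q_E Q j)) ->
    (forall j, uframe (cVs c j) (e j) (B j)) -> (forall j, smooth_form1 (cVs c j) (B j)) ->
    (forall j k x, V2 (cVs c) j k x ->
       q_psi Q j k x = q j k x *: psiv (e j x) (e k x) (s j k x : g_fib difference_gerbe j k x)) ->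
    iso_witness Q <-> exists f : cI c -> M -> R[i],
      [/\ forall i, U1 (cUs c i) (f i), forall j k, U1 (V2 (cVs c) j k) (q j k)
        & coboundary_eqs f q B z2 z1].
Proof.
have cz1 := represents_cocycle sPhi hX1 rz1; have cz2 := represents_cocycle sPhi hX2 rz2.
have [[Uh1 _] [Ug1 _ _]] := cz1.1; have [[Uh2 _] [Ug2 _ _]] := cz2.1.
have [sA1 sa1 w1 [s1 [us1 th1 [e1 [ue1 ps1]]]]] := rz1.
have [sA2 sa2 w2 [s2 [us2 th2 [e2 [ue2 ps2]]]]] := rz2.
have oV j := @cV_open _ _ _ _ _ Phi c j; have oU i := @cU_open _ _ _ _ _ Phi c i.
have l1 j k x : V2 (cVs c) j k x -> is_line (g_L (rg_G X1) (rJ r1 j) (rJ r1 k) x) /\ s1 j k x != 0.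
  move=> Vx; split; last exact: uframe_neq0 (us1 j k) Vx.
  by case: (us1 j k) => _ /(_ _ Vx)[].
have l2 j k x : V2 (cVs c) j k x -> is_line (g_L (rg_G X2) (rJ r2 j) (rJ r2 k) x) /\ s2 j k x != 0.
  move=> Vx; split; last exact: uframe_neq0 (us2 j k) Vx.
  by case: (us2 j k) => _ /(_ _ Vx)[].
have m1 i x : cUs c i x -> is_line (q_E (rg_restrict r1) i x) /\ e1 i x != 0.
  move=> Vx; split; last exact: uframe_neq0 (ue1 i) Vx.
  by case: (ue1 i) => _ /(_ _ Vx)[].
have m2 i x : cUs c i x -> is_line (q_E (rg_restrict r2) i x) /\ e2 i x != 0.
  move=> Vx; split; last exact: uframe_neq0 (ue2 i) Vx.
  by case: (ue2 i) => _ /(_ _ Vx)[].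
pose D := difference_gerbe.
pose s j k : section (g_L D j k) := fun x => tensv (s2 j k x) (dualv (s1 j k x)).
pose A j k : form1 N := fun x v => z2.2.1.2 j k x v + - z1.2.1.2 j k x v.
have us j k : uframe (V2 (cVs c) j k) (s j k) (A j k).
  exact: (uframe_tens (us2 j k) (uframe_dual (us1 j k))).
pose g j k l x := z2.2.1.1 j k l x * (z1.2.1.1 j k l x)^-1.
have g0 j k l x : V3 (cVs c) j k l x -> g j k l x != 0.
  by move=> Vx; rewrite mulf_neq0 ?invr_neq0 // ?(U1_neq0 (Ug1 j k l) Vx) ?(U1_neq0 (Ug2 j k l) Vx).
have thE j k l x : V3 (cVs c) j k l x ->
  (g_theta D j k l x : theta_line _ _ _) = g j k l x *: thetav (s k l x) (s j l x) (s j k x).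
  move=> Vx; have [[Vj Vk] Vl] := Vx.
  have [a1 b1] := l1 k l x (conj Vk Vl); have [a2 b2] := l1 j l x (conj Vj Vl).
  have [a3 b3] := l1 j k x (conj Vj Vk).
  have [c1 d1] := l2 k l x (conj Vk Vl); have [c2 d2] := l2 j l x (conj Vj Vl).
  have [c3 d3] := l2 j k x (conj Vj Vk).
  have g10 := U1_neq0 (Ug1 j k l) Vx.
  have E1 := theta_inv a1 a2 a3 b1 b2 b3 g10 (th1 j k l x Vx).
  exact: (theta_tens c1 c2 c3 (dual_lineP a1) (dual_lineP a2) (dual_lineP a3) d1 d2 d3
    (dualv_neq0 a1 b1) (dualv_neq0 a2 b2) (dualv_neq0 a3 b3) (th2 j k l x Vx) E1).
pose Qa := q_tens (rg_restrict r2) (q_inv (rg_restrict r1)).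
pose ea i : section (q_E Qa i) := fun x => tensv (e2 i x) (dualv (e1 i x)).
have uea i : uframe (cUs c i) (ea i) (fun x v => z2.1.2 i x v + - z1.1.2 i x v).
  exact: (uframe_tens (ue2 i) (uframe_dual (ue1 i))).
pose sM i i' x : g_L D (cr i) (cr i') (Phi x) := s (cr i) (cr i') (Phi x).
have psa i i' x : V2 (cUs c) i i' x -> q_psi Qa i i' x =
    (z2.1.1 i i' x * (z1.1.1 i i' x)^-1) *: psiv (ea i x) (ea i' x) (sM i i' x).
  move=> Ux; have [Ui Ui'] := Ux; have Vx := crP2 Ux.
  have [a1 b1] := m1 i x Ui; have [a2 b2] := m1 i' x Ui'; have [a3 b3] := l1 _ _ _ Vx.
  have [c1 d1] := m2 i x Ui; have [c2 d2] := m2 i' x Ui'; have [c3 d3] := l2 _ _ _ Vx.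
  have h10 := U1_neq0 (Uh1 i i') Ux.
  have E1 := psi_inv a1 a2 a3 b1 b2 b3 h10 (ps1 i i' x Ux).
  exact: (psi_tens c1 c2 c3 (dual_lineP a1) (dual_lineP a2) (dual_lineP a3) d1 d2 d3
    (dualv_neq0 a1 b1) (dualv_neq0 a2 b2) (dualv_neq0 a3 b3) (ps2 i i' x Ux) E1).
exists s; split.
  move=> j k x Vx; split; last exact: uframe_neq0 (us j k) Vx.
  by case: (us j k) => _ /(_ _ Vx)[].
move=> Q e B q lbE ue sB psE.
pose Qb := q_reindex (@cr _ _ _ _ _ _ c) (q_pull Phi Q).
pose eb i : section (q_E Qb i) := fun x => e (cr i) (Phi x).
have ueb i : uframe (cUs c i) (eb i) (pull1 Phi (B (cr i))).
  by apply: uframe_sub (uframe_pull sPhi (ue (cr i))) => // x /crP.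
have psb i i' x : V2 (cUs c) i i' x -> q_psi Qb i i' x =
    q (cr i) (cr i') (Phi x) *: psiv (eb i x) (eb i' x) (sM i i' x).
  by move=> Ux; exact: psE (crP2 Ux).
have lsM i i' x : V2 (cUs c) i i' x -> is_line (g_L D (cr i) (cr i') (Phi x)) /\ sM i i' x != 0.
  move=> Ux; have Vx := crP2 Ux; split; last exact: uframe_neq0 (us _ _) Vx.
  by case: (us (cr i) (cr i')) => _ /(_ _ Vx)[].
have curvE j x u v : cV j x -> curv (q_E Q j) x u v = dform1 (B j) x u v.
  exact: curv_uframe.
(* Kept conditional on unitarity of [q], which comes from the axioms of [Q] in one direction and
   from the cochain in the other. *)
have diff (uq : forall j k, U1 (V2 (cVs c) j k) (q j k)) :=
  difference_coord oU uea ueb lsM psa psb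
    (fun i i' x Ux => U1_neq0 (uq (cr i) (cr i')) (crP2 Ux)).
have q0 (uq : forall j k, U1 (V2 (cVs c) j k) (q j k)) j k x : V2 (cVs c) j k x -> q j k x != 0.
  by move=> Vx; exact: U1_neq0 (uq j k) Vx.
have PU := @psi_unitary _ _ _ _ _ oV D _ _ us Q _ _ _ ue psE.
have PP := @psi_parallel _ _ _ _ _ oV D _ _ us Q _ _ _ ue psE.
have PT := @psi_thetaP _ _ _ _ _ D _ _ _ us thE Q _ _ _ ue psE.
split.
  move=> [[t1 t2 t3 t4] er df].
  have uq j k : U1 (V2 (cVs c) j k) (q j k) by apply/PU.
  have [f [uf f2 f3]] := (diff uq).1 df.
  exists f; split=> //; split.
  - move=> i i' x Ux; have [Ui Ui'] := Ux; rewrite (f3 i i' x Ux).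
    have h10 := U1_neq0 (Uh1 i i') Ux; have qq := q0 uq _ _ _ (crP2 Ux).
    by field; rewrite h10 qq.
  - by move=> i x v Ui; apply/eqP; rewrite -subr_eq0 -(f2 i x v Ui); apply/eqP; ring.
  - move=> j k l x Vx; have [[Vj Vk] Vl] := Vx.
    have := (PT (q0 uq)).1 t3 j k l x Vx.
    have g10 := U1_neq0 (Ug1 j k l) Vx; have qq := q0 uq j l x (conj Vj Vl).
    rewrite /g => E; rewrite -[z2.2.1.1 j k l x](mulfK (invr_neq0 g10)) -E.
    by field; rewrite g10 qq.
  - move=> j k x v Vx; have := (PP j k (uq j k)).1 (t4 j k) x v Vx.
    by move=> E; apply/eqP; rewrite -subr_eq0 -E; apply/eqP; rewrite /A; ring.
  - move=> j x u v Vx; have := er j x u v Vx; rewrite /error curvE // w1 w2 /= => /eqP.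
    by rewrite subr_eq0 => /eqP <-; ring.
move=> [f [uf uq [H1 H2 H3 H4 H5]]]; split.
- split=> //.
  + by move=> j k; apply/PU.
  + apply/(PT (q0 uq)) => j k l x Vx; have [[Vj Vk] Vl] := Vx.
    have g10 := U1_neq0 (Ug1 j k l) Vx; have qq := q0 uq j l x (conj Vj Vl).
    rewrite /g; have -> : z2.2.1.1 j k l x = z1.2.1.1 j k l x * q k l x * q j k x / q j l x.
      by apply: (mulIf qq); rewrite divfK // H3.
    by field; rewrite g10 qq.
  + move=> j k; apply/(PP j k (uq j k)) => x v Vx.
    by rewrite /A (H4 j k x v Vx); ring.
- move=> j x u v Vx; have := H5 j x u v Vx.
  by rewrite w1 w2 /= /error curvE //= => ->; ring.
apply/(diff uq); exists f; split=> //.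
  by move=> i x v Ui; rewrite (H2 i x v Ui); ring.
move=> i i' x Ux; have [Ui Ui'] := Ux.
have h10 := U1_neq0 (Uh1 i i') Ux; have qq := q0 uq _ _ _ (crP2 Ux).
have f0 := U1_neq0 (uf i') Ui'.
have -> : z2.1.1 i i' x = z1.1.1 i i' x * q (cr i) (cr i') (Phi x) * f i x / f i' x.
  by apply: (mulIf f0); rewrite divfK // H1.
by field; rewrite h10 qq f0.
Qed.

Lemma iso_witness_cohomologous Q : iso_witness Q ->
  (forall j, exists (e : section (q_E Q j)) B, uframe (cVs c j) e B /\ smooth_form1 (cVs c j) B) ->
  cohomologous z2 z1.
Proof.
move=> wQ he; have [s [ls H]] := iso_witness_coord.
have cz1 := represents_cocycle sPhi hX1 rz1; have cz2 := represents_cocycle sPhi hX2 rz2.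
pose e j := sval (cid (he j)); pose B j := sval (cid (svalP (cid (he j)))).
have eB j : uframe (cVs c j) (e j) (B j) /\ smooth_form1 (cVs c j) (B j).
  exact: svalP (cid (svalP (cid (he j)))).
pose q j k x := coef (q_psi Q j k x) (psiv (e j x) (e k x) (s j k x : g_fib difference_gerbe j k x)).
have [[lbE _ _ _] _ _] := wQ.
have psE j k x : V2 (cVs c) j k x ->
   q_psi Q j k x = q j k x *: psiv (e j x) (e k x) (s j k x : g_fib difference_gerbe j k x).
  move=> Vx; have [Vj Vk] := Vx; have [a b] := ls _ _ _ Vx.
  have le j' : cV j' x -> is_line (q_E Q j' x) /\ e j' x != 0.
    move=> Vx'; split; last exact: uframe_neq0 (eB j').1 Vx'.
    by case: (eB j') => -[_ /(_ _ Vx')[]].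
  have [a1 b1] := le _ Vj; have [a2 b2] := le _ Vk.
  exact: esym (coefK _ (psi_lineP a1 a2 a) (psiv_neq0 a1 a2 a b1 b2 b)).
have [f [uf uq cb]] := (H Q e B q lbE (fun j => (eB j).1) (fun j => (eB j).2) psE).1 wQ.
apply/(cohomologousP cz2.1 cz1.1); exists f, q, B; split=> //.
by move=> j; case: (eB j).
Qed.

(** The witness consists of trivial bundles with connection forms [B], and [q] provides the
    coordinates of its [psi]. *)
Lemma cohomologous_iso_witness : cohomologous z2 z1 -> exists Q, iso_witness Q.
Proof.
have [s [ls H]] := iso_witness_coord.
have cz1 := represents_cocycle sPhi hX1 rz1; have cz2 := represents_cocycle sPhi hX2 rz2.
move=> /(cohomologousP cz2.1 cz1.1)[f [q [B [uf uq sB cb]]]].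
pose Q : qlb (g_fib difference_gerbe) := @QLB _ _ _ _ (g_fib difference_gerbe)
  (fun j => triv_bundle (B j))
  (fun j k x => q j k x *: psiv (triv_frame (B j) x) (triv_frame (B k) x) (s j k x : g_fib difference_gerbe j k x)).
exists Q; apply/(H Q (fun j => triv_frame (B j)) B q) => //.
- by move=> j; apply: is_lb_triv => //; exact: cV_open.
- by move=> j; apply: uframe_triv; exact: cV_open.
- by exists f.
Qed.

End Witness.

(** The bundles of a given witness may have frames only over a further refinement, to which the
    whole witness must be carried. *)
Lemma iso_witness_restrict (X1 X2 : relgerbe_data Phi) c c' (r1 : refinement c (rg_cov X1))
   (r2 : refinement c (rg_cov X2)) (t : refinement c' c) (Q : qlb (g_fib (difference_gerbe r1 r2))) :
  iso_witness Q ->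
  iso_witness (q_reindex (rJ t) Q :
    qlb (g_fib (difference_gerbe (refinement_comp r1 t) (refinement_comp r2 t)))).
Proof.
move=> [h1 h2 h3]; split.
- exact: (is_qlb_reindex (rJP t) h1).
- by move=> j x u v /(rJP t); exact: h2.
apply: (@rg_restrict_comp_ind _ _ _ _ _ _ X2 X1 c c' r2 r1 t (fun kappa Q2 Q1 =>
  difference_trivial (cUs c') (q_tens Q2 (q_inv Q1)) (q_reindex kappa (q_pull Phi Q)))).
exact: (difference_trivial_reindex (rIP t) h3).
Qed.

(** An isomorphism is read on a refinement adapted to it, where other representatives appear;
    [representatives_cohomologous] brings the result back to [z1] and [z2]. *)
Lemma relgerbe_isoP (X1 X2 : relgerbe_data Phi) c1 c2 (r1 : refinement c1 (rg_cov X1))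
   (r2 : refinement c2 (rg_cov X2)) (z1 : cone2 c1) (z2 : cone2 c2)
   (hz1 : is_cocycle z1) (hz2 : is_cocycle z2) : is_relgerbe X1 -> is_relgerbe X2 ->
  represents r1 z1 -> represents r2 z2 ->
  relgerbe_iso_data X1 X2 <-> cocycle_eq (cocycle_of hz1) (cocycle_of hz2).
Proof.
move=> hX1 hX2 rz1 rz2; split.
  move=> [c [q1 [q2 [Q wQ]]]].
  have lbQ : forall j, is_lb (cVs c j) (q_E Q j) by case: wQ => -[].
  (* One refinement must trivialize the lines of both gerbes and the bundles of the witness. The
     latter depend on a single index and are regarded as living on double intersections. *)
  pose L (f : option bool) j k := match f with
    | None => q_E Q j
    | Some true => g_L (rg_G X1) (rJ q1 j) (rJ q1 k)
    | Some false => g_L (rg_G X2) (rJ q2 j) (rJ q2 k) end.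
  pose E (f : bool) i := if f then q_E (rg_Q X1) (rI q1 i) else q_E (rg_Q X2) (rI q2 i).
  have hL f j k : is_lb (V2 (cVs c) j k) (L f j k).
    case: f => [[]|]; [exact: is_lb_line|exact: is_lb_line|].
    by apply: is_lb_sub (lbQ j) => x [].
  have hE f i : is_lb (cUs c i) (E f i) by case: f; exact: is_lb_qlb.
  have [d [t [H1 H2]]] := trivializing_frames sPhi hL hE.
  have [y1 ry1] := represents_exists (r := refinement_comp q1 t) (H1 (Some true)) (H2 true).
  have [y2 ry2] := represents_exists (r := refinement_comp q2 t) (H1 (Some false)) (H2 false).
  have cy1 := represents_cocycle sPhi hX1 ry1; have cy2 := represents_cocycle sPhi hX2 ry2.
  have coh : cohomologous y2 y1.
    apply: (iso_witness_cohomologous hX1 hX2 ry1 ry2 (iso_witness_restrict t wQ)) => j.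
    (* The intersection of a member with itself is that member, so the diagonal gives frames of the
       witness over the members. *)
    have [e [B [ue sB]]] := H1 None j j; exists e, B; split.
      by apply: uframe_sub ue => //; exact: cV_open.
    by apply: smooth_form1_sub sB.
  apply: (cocycle_eq_trans (representatives_cohomologous sPhi hz1 cy1 hX1 rz1 ry1)).
  apply: cocycle_eq_trans (representatives_cohomologous sPhi cy2 hz2 hX2 ry2 rz2).
  by apply: cocycle_eq_sym; exact: cocycle_eq_same.
move=> [c [t1 [t2 coh]]]; rewrite /= in t1 t2 coh.
have R1 := represents_restrict t1 rz1; have R2 := represents_restrict t2 rz2.
(* An isomorphism trivializes the second gerbe relative to the first, so the coboundary equation is
   needed with [z2] on the left. *)
have coh' := cohomologous_sym (restrict_smooth t1 hz1.1) (restrict_smooth t2 hz2.1) coh.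
have [Q wQ] := cohomologous_iso_witness hX1 hX2 R1 R2 coh'.
by exists c, (refinement_comp r1 t1), (refinement_comp r2 t2), Q.
Qed.

(** The cover of the cocycle itself serves, with the identity refinement, and the coordinate lemmas
    turn each cocycle equation into the corresponding axiom. *)
Lemma cocycle_represents c (z : cone2 c) : is_cocycle z ->
  exists (X : relgerbe_data Phi) (r : refinement c (rg_cov X)), is_relgerbe X /\ represents r z.
Proof.
move=> hz; have /is_cocycleP[sz [H1 H2 H3 H4 H5]] := hz.
have [[Uh sa] [Ug sA sw]] := sz.
have oV j := @cV_open _ _ _ _ _ Phi c j; have oU i := @cU_open _ _ _ _ _ Phi c i.
pose G : gerbe N (cJ c) := @Gerbe _ _ N (cJ c) (fun j k => triv_bundle (z.2.1.2 j k))
  (fun j k l x => z.2.1.1 j k l x *: thetav (triv_frame (z.2.1.2 k l) x)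
     (triv_frame (z.2.1.2 j l) x) (triv_frame (z.2.1.2 j k) x))
  z.2.2.
pose GM := g_pull_reindex Phi (@cr _ _ _ _ _ _ c) G.
pose s j k : section (g_L G j k) := triv_frame (z.2.1.2 j k).
pose sM i i' : section (g_L GM i i') := fun x => s (cr i) (cr i') (Phi x).
pose Q : qlb (g_fib GM) := @QLB _ _ _ _ (g_fib GM) (fun i => triv_bundle (z.1.2 i))
  (fun i i' x => z.1.1 i i' x *: psiv (triv_frame (z.1.2 i) x) (triv_frame (z.1.2 i') x)
     (sM i i' x : g_fib GM i i' x)).
pose X := RelGerbeData Q.
have us j k : uframe (V2 (cVs c) j k) (s j k) (z.2.1.2 j k) by apply: uframe_triv; exact: V2_open.
have ue i : uframe (cUs c i) (triv_frame (z.1.2 i)) (z.1.2 i) by apply: uframe_triv.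
have g0 j k l x : V3 (cVs c) j k l x -> z.2.1.1 j k l x != 0 by move=> Vx; exact: U1_neq0 (Ug j k l) Vx.
have h0 i i' x : V2 (cUs c) i i' x -> z.1.1 i i' x != 0 by move=> Vx; exact: U1_neq0 (Uh i i') Vx.
have thE j k l x : V3 (cVs c) j k l x -> (g_theta G j k l x : theta_line _ _ _) =
  z.2.1.1 j k l x *: thetav (s k l x) (s j l x) (s j k x) by [].
have usM i i' : uframe (V2 (cUs c) i i') (sM i i') (pull1 Phi (z.2.1.2 (cr i) (cr i'))).
  exact: uframe_pull_cover.
have thM i i' i'' x : V3 (cUs c) i i' i'' x -> (g_theta GM i i' i'' x : theta_line _ _ _) =
   z.2.1.1 (cr i) (cr i') (cr i'') (Phi x) *: thetav (sM i' i'' x) (sM i i'' x) (sM i i' x) by [].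
have psE i i' x : V2 (cUs c) i i' x -> q_psi Q i i' x = z.1.1 i i' x *:
   psiv (triv_frame (z.1.2 i) x) (triv_frame (z.1.2 i') x) (sM i i' x : g_fib GM i i' x) by [].
pose e i : section (q_E Q i) := triv_frame (z.1.2 i).
have PU := @psi_unitary _ _ _ _ _ oU GM _ _ usM Q e _ _ ue psE.
have PP := @psi_parallel _ _ _ _ _ oU GM _ _ usM Q e _ _ ue psE.
have PT := @psi_thetaP _ _ _ _ _ GM _ _ _ usM thM Q e _ _ ue psE.
exists X, (refinement_id c); split.
  split; split.
  - by move=> j k; apply: is_lb_triv => //; exact: V2_open.
  - by move=> j k; apply: lb_iso_triv; exact: V2_open.
  - by move=> j k l; apply/(theta_unitary oV us thE).
  - apply/(theta_closedP us thE g0) => i j k l x Vx; have [[[Vi Vj] Vk] Vl] := Vx.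
    have k1 := g0 _ _ _ _ (conj (conj Vi Vk) Vl); have k2 := g0 _ _ _ _ (conj (conj Vi Vj) Vk).
    by rewrite [X in X / _]mulrAC (H3 i j k l x Vx); field; rewrite k1 k2.
  - split=> //.
    + move=> j k l; apply/(theta_parallel oV us thE (Ug j k l)) => x v Vx.
      by rewrite -(H4 j k l x v Vx); ring.
    + move=> j k x u v Vx; rewrite (curv_uframe u v (us j k) (sA j k) Vx).
      exact: (subr0_eq (H5 j k x u v Vx)).
  - by move=> i; exact: is_lb_triv.
  - by move=> i i'; apply/PU.
  - apply/(PT h0) => i i' i'' x Ux; have [[Ui Ui'] Ui''] := Ux.
    have k1 := h0 _ _ _ (conj Ui Ui''); apply: (mulIf k1).
    by rewrite (H1 i i' i'' x Ux); field.
  - move=> i i'; apply/(PP i i' (Uh i i')) => x v Ux.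
    by rewrite (H2 i i' x v Ux); ring.
split=> //; exists s; split=> //.
by exists (fun i => triv_frame (z.1.2 i)); split.
Qed.

End Isomorphisms.

(** * The bijection of classes *)

Lemma classes_eq (T : Type) (E : T -> T -> Prop) (a b : classes E) : sval a = sval b -> a = b.
Proof. by case: a b => a pa [b pb] /= E'; subst b; rewrite (Prop_irrelevance pa pb). Qed.

(** [E'] is the relation induced by [E] along [Z], so its classes are the fibres of [Z] modulo [E].
    The inverse bijections pick a point of a class and, from [E] to [E'], a preimage under [Z] up to
    [E]. *)
Lemma classes_bijection (S T : Type) (E : S -> S -> Prop) (E' : T -> T -> Prop) (Z : T -> S) :
  (forall x, E x x) -> (forall x y, E x y -> E y x) ->
  (forall x y z, E x y -> E y z -> E x z) ->
  (forall x y, E' x y <-> E (Z x) (Z y)) -> (forall s, exists x, E (Z x) s) ->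
  exists f : classes E -> classes E', bijective f.
Proof.
move=> Er Es Et EE' surj.
have EP x y : E x y -> E x = E y.
  move=> xy; apply/funext => z; apply/propext; split=> H; last exact: Et xy H.
  exact: Et (Es _ _ xy) H.
have EP' x y : E (Z x) (Z y) -> E' x = E' y.
  move=> xy; apply/funext => z; apply/propext; split=> /EE' H; apply/EE'; last exact: Et xy H.
  exact: Et (Es _ _ xy) H.
have rep (a : classes E) : exists x, sval a = E (Z x).
  case: a => a [s aE] /=; have [x xs] := surj s; exists x; rewrite aE; exact: EP (Es _ _ xs).
have rep' (b : classes E') : exists x, sval b = E' x by case: b => b [x bE]; exists x.
pose f (a : classes E) : classes E' := exist _ (E' (sval (cid (rep a)))) (ex_intro _ _ erefl).
pose g (b : classes E') : classes E := exist _ (E (Z (sval (cid (rep' b))))) (ex_intro _ _ erefl).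
exists f, g => [a|b]; apply: classes_eq.
  have aE := svalP (cid (rep a)); apply: etrans (esym aE); apply: EP; apply/EE'.
  have fE : E' (sval (cid (rep a))) = E' (sval (cid (rep' (f a)))) := svalP (cid (rep' (f a))).
  by rewrite -fE; apply/EE'.
have bE := svalP (cid (rep' b)); apply: etrans (esym bE); apply: EP'.
have gE : E (Z (sval (cid (rep' b)))) = E (Z (sval (cid (rep (g b))))) := svalP (cid (rep (g b))).
by rewrite -gE.
Qed.

Theorem theorem4p5p1 (R : realType) (m n : nat)
    (M : manifold R m) (N : manifold R n) (Phi : M -> N)
    (Phi_smooth : smooth_map Phi) :
  exists f : deligneH2 Phi -> relgerbe_classes Phi, bijective f.
Proof.
have rep (X : relgerbe Phi) : exists z : cocycle Phi,
    exists r : refinement (projT1 z) (rg_cov (sval X)), represents r (sval (projT2 z)).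
  have [c [r [z rz]]] := representative_exists Phi_smooth (svalP X).
  by exists (cocycle_of (represents_cocycle Phi_smooth (svalP X) rz)), r.
pose Z X := sval (cid (rep X)).
have ZP X : exists r : refinement (projT1 (Z X)) (rg_cov (sval X)), represents r (sval (projT2 (Z X))).
  exact: svalP (cid (rep X)).
apply: (@classes_bijection (cocycle Phi) (relgerbe Phi) (@cocycle_eq _ _ _ _ _ Phi) (@relgerbe_iso _ _ _ _ _ Phi) Z).
- exact: cocycle_eq_refl.
- exact: cocycle_eq_sym.
- by move=> x y z; exact: cocycle_eq_trans.
- move=> X Y; have [r rX] := ZP X; have [r' rY] := ZP Y.
  move: (Z X) (Z Y) r rX r' rY => [c [z hz]] [c' [z' hz']] /= r rX r' rY.
  exact: (relgerbe_isoP Phi_smooth hz hz' (svalP X) (svalP Y) rX rY).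
(* The cocycle chosen for the realized gerbe need not be [z], but both represent that gerbe and
   hence have the same class. *)
- move=> [c [z hz]]; have [X0 [r [hX rX]]] := cocycle_represents Phi_smooth hz.
  pose X : relgerbe Phi := exist _ X0 hX; exists X.
  have [r' rY] := ZP X; move: (Z X) r' rY => [c' [z' hz']] /= r' rY.
  exact: (representatives_cohomologous Phi_smooth hz' hz hX rY rX).
Qed.
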